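(* Let $n\ge 2$ and let $K=K_1\cup\dots\cup K_{k_0}\subset\mathbb{R}^n$, $k_0\ge 3$, where $K_1,\dots,K_{k_0}$ are pairwise disjoint compact strictly convex domains with $C^2$ boundaries such that for every pair $i\neq j$ the convex hull of $K_i\cup K_j$ has no common points with any other component $K_l$, $l\ne i,j$. Let $\phi_t$ be the open billiard flow in $\Omega=\overline{\mathbb{R}^n\setminus K}$ and let $\Lambda$ be its non-wandering set. Then there exist $z_0\in\Lambda$ and $\mu>0$ such that for any unit vector $b\in E^u(z_0)$ which is tangent to $\Lambda$ at $z_0$ there exists a unit vector $a\in E^s(z_0)$ which is tangent to $\Lambda$ at $z_0$ with $|d\alpha(a,b)|\ge\mu$.
   Context: Strict convexity of the $K_i$ is understood in the sense that the second fundamental form of $\partial K$ with respect to the outward unit normal field $\nu$ is positive definite at every point. Billiard flow: $S(\Omega)=\Omega\times\mathbb{S}^{n-1}\subset\mathbb{R}^n\times\mathbb{R}^n$; $\phi_t$ moves $(q,v)$ with unit speed along straight lines in the interior of $\Omega$, with reflections $v\mapsto v-2\langle v,\nu(q)\rangle\nu(q)$ at points $q\in\partial K$. The non-wandering set $\Lambda$ is the set of all $x\in S(\Omega)$ whose trajectory $\{\phi_t(x):t\in\mathbb{R}\}$ is bounded. The flow is considered up to the identification $(q,v)\sim(q,w)$ when $q\in\partial K$ and $v,w$ are symmetric with respect to $T_q(\partial K)$; on the quotient $S(\Omega)/\!\sim$ it is continuous, and for $x\in\Lambda$ and $t$ with $x$ and $\phi_t(x)$ both having footpoints off $\partial K$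 it is smooth near $x$. $\Lambda$ is a compact hyperbolic (basic) set for $\phi_t$. Stable and unstable manifolds (considered at points $x=(q,v)\in\Lambda$ with $q\notin\partial K$): for small $\epsilon>0$, $W^s_\epsilon(x)=\{y: d(\phi_t(x),\phi_t(y))\le\epsilon\ \forall t\ge 0,\ d(\phi_t(x),\phi_t(y))\to0 \text{ as } t\to\infty\}$ and $W^u_\epsilon(x)=\{y: d(\phi_t(x),\phi_t(y))\le\epsilon\ \forall t\le 0,\ d(\phi_t(x),\phi_t(y))\to0 \text{ as } t\to-\infty\}$, with $d$ the distance taken modulo $\sim$. $E^u(x)=T_xW^u_\epsilon(x)$, $E^s(x)=T_xW^s_\epsilon(x)$, regarded as subspaces of $\mathbb{R}^n\times\mathbb{R}^n$ with the Euclidean norm. Tangent vectors to $\Lambda$: a vector $b\in E^u(z)\setminus\{0\}$ is tangent to $\Lambda$ at $z\in\Lambda$ if there exist sequences $v^{(m)}\in E^u(z)$ and $t_m\in\mathbb{R}\setminus\{0\}$ with $\exp^u_z(t_mv^{(m)})\in\Lambda\cap W^u_\epsilon(z)$ for all $m$, $v^{(m)}\to b$ and $t_m\to0$, where $\exp^u_z:E^u(z)\to W^u_{\epsilon_0}(z)$ is the (locally defined) exponential map (any local $C^1$ parametrization of $W^u$ sending $0$ to $z$ with derivative the identity at $0$ gives the same notion). Tangent vectors in $E^s(z)$ are defined in the same way using $W^s$. Symplectic form: $d\alpha((u,\tilde u),(p,\tilde p))=-\langle u,\tilde p\rangle+\langle\tilde u,p\rangle$ on $\mathbb{R}^n\times\mathbb{R}^n$.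 *)

(* Defs.v *)
From HB Require Import structures.
From mathcomp Require Import all_boot all_order all_algebra.
From mathcomp Require Import all_classical all_reals all_analysis.

Set Implicit Arguments.
Unset Strict Implicit.
Unset Printing Implicit Defensive.

Import Order.TTheory GRing.Theory Num.Theory.
Import numFieldNormedType.Exports.

Local Open Scope classical_set_scope.
Local Open Scope ring_scope.

(* The library norm on 'rV[R]_n and on products is the sup norm; it gives the
   usual topology and the usual derivatives.  Every metric notion below goes
   through the Euclidean norms [enorm] and [penorm]. *)

Definition dot (R : realType) (n : nat) (u v : 'rV[R]_n) : R :=
  \sum_(i < n) u 0 i * v 0 i.

Definition enorm (R : realType) (n : nat) (u : 'rV[R]_n) : R :=
  Num.sqrt (dot u u).

(* Points of R^n x R^n: (footpoint, velocity), or tangent vectors to it. *)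
Notation phase R n := ('rV[R]_n * 'rV[R]_n)%type.

Definition penorm (R : realType) (n : nat) (x : phase R n) : R :=
  Num.sqrt (dot x.1 x.1 + dot x.2 x.2).

Definition dalpha (R : realType) (n : nat) (a b : phase R n) : R :=
  - dot a.1 b.2 + dot a.2 b.1.

(* For [U] open and [V] of finite dimension, continuity of ['d f y v] in [y]
   for each [v] is continuity of the derivative in operator norm. *)
Definition C1_on (R : realType) (V W : normedModType R) (U : set V)
    (f : V -> W) : Prop :=
  forall x, U x ->
    differentiable f x /\ forall v, {for x, continuous (fun y => 'd f y v)}.

Definition C2_on (R : realType) (V W : normedModType R) (U : set V)
    (f : V -> W) : Prop :=
  C1_on U f /\ forall v, C1_on U (fun y => 'd f y v).

Definition grad (R : realType) (n : nat) (f : 'rV[R]_n -> R^o) (x : 'rV[R]_n) :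
    'rV[R]_n :=
  \row_(i < n) ('d f x (delta_mx 0 i) : R).

Definition bdry (T : topologicalType) (A : set T) : set T :=
  closure A `\` interior A.

Definition convex_hull (R : realType) (n : nat) (A : set 'rV[R]_n) :
    set 'rV[R]_n :=
  smallest [set B | @convex_set R 'rV[R]_n B] A.

(* [f] is a C^2 defining function of [K] near its boundary point [q]. *)
Definition boundary_chart (R : realType) (n : nat) (K : set 'rV[R]_n)
    (q : 'rV[R]_n) (U : set 'rV[R]_n) (f : 'rV[R]_n -> R^o) : Prop :=
  [/\ bdry K q, open U /\ U q, C2_on U f, grad f q != 0
    & forall x, U x -> (K x <-> f x <= 0)].

Definition unit_normal (R : realType) (n : nat) (f : 'rV[R]_n -> R^o)
    (x : 'rV[R]_n) : 'rV[R]_n :=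
  (enorm (grad f x))^-1 *: grad f x.

Definition outward_normal (R : realType) (n : nat) (K : set 'rV[R]_n)
    (q nu : 'rV[R]_n) : Prop :=
  exists U f, boundary_chart K q U f /\ nu = unit_normal f q.

(* II_q(u, w) = < d nu_q (u), w > with nu = grad f / |grad f| the outward unit
   normal field, extended off the boundary by the level sets of [f]; with this
   sign the form is nonnegative on the boundary of a convex set. *)
Definition second_fundamental_form (R : realType) (n : nat)
    (f : 'rV[R]_n -> R^o) (q u w : 'rV[R]_n) : R :=
  dot ('d (unit_normal f) q u) w.

Definition C2_boundary (R : realType) (n : nat) (K : set 'rV[R]_n) : Prop :=
  forall q, bdry K q -> exists U f, boundary_chart K q U f.

Definition positive_curvature (R : realType) (n : nat) (K : set 'rV[R]_n) :
    Prop :=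
  forall q U f, boundary_chart K q U f ->
    forall w, dot w (unit_normal f q) = 0 -> w != 0 ->
      0 < second_fundamental_form f q w w.

Definition strictly_convex_domain (R : realType) (n : nat)
    (K : set 'rV[R]_n) : Prop :=
  [/\ K !=set0, compact K, @convex_set R 'rV[R]_n K, C2_boundary K
    & positive_curvature K].

Definition exterior (R : realType) (n : nat) (K : set 'rV[R]_n) :
    set 'rV[R]_n :=
  closure (~` K).

Definition phase_space (R : realType) (n : nat) (K : set 'rV[R]_n) :
    set (phase R n) :=
  [set x | exterior K x.1 /\ enorm x.2 = 1].

Definition reflect_vec (R : realType) (n : nat) (nu v : 'rV[R]_n) :
    'rV[R]_n :=
  v - (2 * dot v nu) *: nu.

Definition ident (R : realType) (n : nat) (K : set 'rV[R]_n)
    (x y : phase R n) : Prop :=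
  x = y \/
  x.1 = y.1 /\ exists nu, outward_normal K x.1 nu /\ y.2 = reflect_vec nu x.2.

Definition free_motion (R : realType) (n : nat) (x : phase R n) (s : R) :
    phase R n :=
  (x.1 + s *: x.2, x.2).

(* At a reflection time the velocity is by convention the outgoing one; this
   makes the trajectory through a class of [ident] unique. *)
Definition billiard_trajectory (R : realType) (n : nat) (K : set 'rV[R]_n)
    (g : R -> phase R n) : Prop :=
  forall t,
    [/\ phase_space K (g t),
      ~ bdry K (g t).1 -> \forall s \near t, g s = free_motion (g t) (s - t)
    & bdry K (g t).1 ->
        exists nu v_in,
          [/\ outward_normal K (g t).1 nu,
              (g t).2 = reflect_vec nu v_in,
              \forall s \near t^'-, g s = free_motion ((g t).1, v_in) (s - t)
            & \forall s \near t^'+, g s = free_motion (g t) (s - t)]].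

Definition billiard_flow (R : realType) (n : nat) (K : set 'rV[R]_n) (t : R)
    (x : phase R n) : phase R n :=
  xget (fun=> x)
    [set g : R -> phase R n | billiard_trajectory K g /\ ident K x (g 0)] t.

Definition nonwandering (R : realType) (n : nat) (K : set 'rV[R]_n) :
    set (phase R n) :=
  [set x | phase_space K x /\
           bounded_set [set billiard_flow K t x | t in [set: R]]].

(* Distance modulo [ident]: the quotient pseudometric, i.e. the infimum of the
   lengths of chains of Euclidean jumps inside the phase space, moves between
   identified points being free.  (The minimum over pairs of representatives
   would not do: just before and just after a reflection two points are close
   in the quotient although no representatives of them are.) *)
Inductive quotient_chain (R : realType) (n : nat) (K : set 'rV[R]_n) :
    phase R n -> phase R n -> R -> Prop :=
  | chain_ident x y : ident K x y -> quotient_chain K x y 0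
  | chain_step x x' y z l :
      ident K x x' -> phase_space K x' -> phase_space K y ->
      quotient_chain K y z l -> quotient_chain K x z (penorm (x' - y) + l).

Definition quotient_dist (R : realType) (n : nat) (K : set 'rV[R]_n)
    (x y : phase R n) : R :=
  inf [set l | quotient_chain K x y l].

Definition stable_manifold (R : realType) (n : nat) (K : set 'rV[R]_n)
    (e : R) (x : phase R n) : set (phase R n) :=
  [set y | [/\ phase_space K y,
    forall t, 0 <= t ->
      quotient_dist K (billiard_flow K t x) (billiard_flow K t y) <= e
    & quotient_dist K (billiard_flow K t x) (billiard_flow K t y)
        @[t --> +oo] --> (0 : R)]].

Definition unstable_manifold (R : realType) (n : nat) (K : set 'rV[R]_n)
    (e : R) (x : phase R n) : set (phase R n) :=
  [set y | [/\ phase_space K y,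
    forall t, t <= 0 ->
      quotient_dist K (billiard_flow K t x) (billiard_flow K t y) <= e
    & quotient_dist K (billiard_flow K t x) (billiard_flow K t y)
        @[t --> -oo] --> (0 : R)]].

(* Velocities at [z] of C^1 curves in [W]: the tangent space when [W] is a C^1
   submanifold. *)
Definition tangent_space (R : realType) (V : normedModType R) (W : set V)
    (z : V) : set V :=
  [set b | exists (I : set R^o) (c : R^o -> V),
    [/\ open I /\ I 0, C1_on I c, c 0 = z, 'd c 0 1 = b
      & forall s, I s -> W (c s)]].

(* The local stable and unstable manifolds for different small [e] have the
   same germ at [z]: "for small e" is read as "for all sufficiently small
   e > 0", here and in the notions of tangency to the nonwandering set. *)
Definition stable_space (R : realType) (n : nat) (K : set 'rV[R]_n)
    (z : phase R n) : set (phase R n) :=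
  [set b | \forall e \near (0 : R)^'+,
             tangent_space (stable_manifold K e z) z b].

Definition unstable_space (R : realType) (n : nat) (K : set 'rV[R]_n)
    (z : phase R n) : set (phase R n) :=
  [set b | \forall e \near (0 : R)^'+,
             tangent_space (unstable_manifold K e z) z b].

(* [psi], restricted to [E `&` U], is a local C^1 parametrization of [W] near
   [z] by its tangent space [E], with derivative the identity of [E] at 0.  (A
   C^1 map on an open piece of a subspace extends to the ambient space by
   composition with a linear projection.) *)
Definition local_parametrization (R : realType) (V : normedModType R)
    (W E : set V) (z : V) (U : set V) (psi : V -> V) : Prop :=
  [/\ open U /\ U 0, C1_on U psi,
      psi 0 = z /\ (forall v, E v -> 'd psi 0 v = v),
      set_inj (E `&` U) psi /\ (forall v, (E `&` U) v -> W (psi v))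
    & \forall y \near z, W y -> exists2 v, (E `&` U) v & psi v = y].

Definition tangent_to (R : realType) (V : normedModType R)
    (L W E : set V) (z b : V) : Prop :=
  [/\ E b, b != 0 &
    exists U psi, local_parametrization W E z U psi /\
      exists (v : nat -> V) (t : nat -> R),
        [/\ forall m, [/\ E (v m), t m != 0, U (t m *: v m)
                       & (L `&` W) (psi (t m *: v m))],
            v @ \oo --> b & t @ \oo --> (0 : R)]].

Definition stable_tangent (R : realType) (n : nat) (K : set 'rV[R]_n)
    (z b : phase R n) : Prop :=
  \forall e \near (0 : R)^'+,
    tangent_to (nonwandering K) (stable_manifold K e z) (stable_space K z) z b.

Definition unstable_tangent (R : realType) (n : nat) (K : set 'rV[R]_n)
    (z b : phase R n) : Prop :=
  \forall e \near (0 : R)^'+,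
    tangent_to (nonwandering K) (unstable_manifold K e z) (unstable_space K z)
      z b.

(* Main.v *)
Require Import Defs.
From HB Require Import structures.
From mathcomp Require Import all_boot all_order all_algebra.
From mathcomp Require Import all_classical all_reals all_analysis.
From mathcomp Require Import ring lra.

Set Implicit Arguments.
Unset Strict Implicit.
Unset Printing Implicit Defensive.

(* No hyperbolic theory is used.  Let [q0], [q1] be closest points of two of the
   domains, [m] the unit vector from [q0] to [q1]; the base point is
   [z0 = (q0 + tau m, m)] on the orbit bouncing between [q0] and [q1], just
   after the bounce at [q0].  Flowing backward for time [2 tau] and then
   reversing the velocity is a local involution [J] of phase space that fixes
   [z0] and exchanges its local stable and unstable manifolds, so [D = dJ]
   carries unstable vectors tangent to the nonwandering set to stable ones, and
   [a] is [D b] normalized.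

   To bound [dalpha (D b) b], compare the trajectory of a point of the unstable
   manifold with the periodic one.  They bounce on the same components, and each
   bounce point lies behind the tangent hyperplane at the other; hence
   [<v, h - x>], with [x], [v] the position and velocity of one trajectory and
   [h] the position of the other, is nonpositive between bounces.  In the limit
   [b] is orthogonal to [m] and the incoming wave front is convex, i.e.
   [2 tau |dv|^2 <= <dv, u>], where [u] is the displacement of the bounce point
   and [dv] the variation of the incoming velocity.  With [S] the shape operator
   at [q0], [dalpha (D b) b = - 2 (<dv, u> + <S u, u>)], and positive curvature
   bounds [<S u, u>] below by a multiple of [|u|^2], while [|b|] and [|D b|] are
   at most a multiple of [|u|]. *)

Import Order.TTheory GRing.Theory Num.Theory.
Import numFieldNormedType.Exports.

Local Open Scope classical_set_scope.
Local Open Scope ring_scope.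

Section Euclidean.
Context {R : realType} {n : nat}.
Implicit Types (u v w : 'rV[R]_n) (k : R).

Lemma dotC u v : dot u v = dot v u.
Proof. by apply: eq_bigr => i _; rewrite mulrC. Qed.

Lemma dotDl u v w : dot (u + v) w = dot u w + dot v w.
Proof. by rewrite -big_split; apply: eq_bigr => i _; rewrite mxE mulrDl. Qed.

Lemma dotZl k u v : dot (k *: u) v = k * dot u v.
Proof. by rewrite /dot mulr_sumr; apply: eq_bigr => i _; rewrite mxE mulrA. Qed.

Lemma dotDr u v w : dot w (u + v) = dot w u + dot w v.
Proof. by rewrite dotC dotDl !(dotC w). Qed.

Lemma dotZr k u v : dot u (k *: v) = k * dot u v.
Proof. by rewrite dotC dotZl dotC. Qed.

Lemma dotNl u v : dot (- u) v = - dot u v.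
Proof. by rewrite -scaleN1r dotZl mulN1r. Qed.

Lemma dotNr u v : dot u (- v) = - dot u v.
Proof. by rewrite dotC dotNl dotC. Qed.

Lemma dotBl u v w : dot (u - v) w = dot u w - dot v w.
Proof. by rewrite dotDl dotNl. Qed.

Lemma dotBr u v w : dot w (u - v) = dot w u - dot w v.
Proof. by rewrite dotDr dotNr. Qed.

Lemma dot0l u : dot 0 u = 0.
Proof. by rewrite -(scale0r 0) dotZl mul0r. Qed.

Lemma dot0r u : dot u 0 = 0.
Proof. by rewrite dotC dot0l. Qed.

Lemma dot_ge0 u : 0 <= dot u u.
Proof. by apply: sumr_ge0 => i _; rewrite -expr2 sqr_ge0. Qed.

Lemma dot_eq0 u : (dot u u == 0) = (u == 0).
Proof.
apply/idP/eqP => [|->]; last by rewrite dot0l.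
rewrite psumr_eq0 => [/allP u0|i _]; last by rewrite -expr2 sqr_ge0.
apply/rowP => i; rewrite mxE; apply/eqP.
by have := u0 i; rewrite mem_index_enum mulf_eq0 orbb; exact.
Qed.

Lemma dot_gt0 u : (0 < dot u u) = (u != 0).
Proof. by rewrite lt_neqAle dot_ge0 andbT eq_sym dot_eq0. Qed.

Lemma enorm_ge0 u : 0 <= enorm u.
Proof. exact: sqrtr_ge0. Qed.

Lemma sqr_enorm u : enorm u ^+ 2 = dot u u.
Proof. by rewrite sqr_sqrtr // dot_ge0. Qed.

Lemma enorm_eq0 u : (enorm u == 0) = (u == 0).
Proof. by rewrite -dot_eq0 -sqr_enorm sqrf_eq0. Qed.

Lemma enorm_gt0 u : (0 < enorm u) = (u != 0).
Proof. by rewrite lt_neqAle enorm_ge0 andbT eq_sym enorm_eq0. Qed.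

Lemma enorm0 : enorm (0 : 'rV[R]_n) = 0.
Proof. by apply/eqP; rewrite enorm_eq0. Qed.

Lemma enormZ k u : enorm (k *: u) = `|k| * enorm u.
Proof.
by rewrite /enorm dotZl dotZr mulrA -expr2 sqrtrM ?sqr_ge0 // sqrtr_sqr.
Qed.

Lemma enormN u : enorm (- u) = enorm u.
Proof. by rewrite -scaleN1r enormZ normrN1 mul1r. Qed.

Lemma enormBC u v : enorm (u - v) = enorm (v - u).
Proof. by rewrite -enormN opprB. Qed.

Lemma dot_enorm1 u : enorm u = 1 -> dot u u = 1.
Proof. by rewrite -sqr_enorm => ->; rewrite expr1n. Qed.

Lemma enorm_dot1 u : dot u u = 1 -> enorm u = 1.
Proof. by rewrite /enorm => ->; rewrite sqrtr1. Qed.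

Lemma ler_dot u v : dot u v <= enorm u * enorm v.
Proof.
have [->|u0] := eqVneq u 0; first by rewrite dot0l enorm0 mul0r.
have [->|v0] := eqVneq v 0; first by rewrite dot0r enorm0 mulr0.
have := dot_ge0 (enorm v *: u - enorm u *: v).
rewrite !dotBl !dotBr !dotZl !dotZr -!sqr_enorm (dotC v u).
have : 0 < enorm u * enorm v by rewrite mulr_gt0 // enorm_gt0.
set a := enorm u; set b := enorm v; set c := dot u v => ab.
move=> h; rewrite -subr_ge0 -(pmulr_rge0 _ ab); nra.
Qed.

Lemma ler_norm_dot u v : `|dot u v| <= enorm u * enorm v.
Proof. by rewrite ler_norml lerNl -dotNl -(enormN u) !ler_dot enormN ler_dot. Qed.

Lemma ler_enormD u v : enorm (u + v) <= enorm u + enorm v.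
Proof.
rewrite -ler_sqr ?nnegrE ?addr_ge0 ?enorm_ge0 // sqrrD !sqr_enorm.
rewrite !dotDl !dotDr (dotC v u); have := ler_dot u v; lra.
Qed.

Lemma ler_enormB u v : enorm (u - v) <= enorm u + enorm v.
Proof. by rewrite (le_trans (ler_enormD _ _)) // enormN. Qed.

Lemma ler_enorm_norm u : enorm u <= n%:R * `|u|.
Proof.
have [->|] := eqVneq u 0; first by rewrite enorm0 normr0 mulr0.
rewrite -normr_gt0 => u0.
rewrite -ler_sqr ?nnegrE ?mulr_ge0 ?enorm_ge0 // sqr_enorm.
apply: (@le_trans _ _ (\sum_(i < n) `|u| ^+ 2)).
  apply: ler_sum => i _; rewrite -expr2 -real_normK ?num_real //.
  rewrite lerXn2r ?nnegrE // [leRHS]/Num.Def.normr /= mx_normrE.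
  exact: (le_bigmax _ (fun ij : 'I_1 * 'I_n => `|u ij.1 ij.2|) (0, i)).
rewrite sumr_const card_ord exprMn -[leLHS]mulr_natl ler_wpM2r ?sqr_ge0 //.
by rewrite -natrX ler_nat; case: (n) => // m; rewrite expnS leq_pmulr.
Qed.

Lemma ler_norm_enorm u : `|u| <= enorm u.
Proof.
rewrite [leLHS]/Num.Def.normr /= mx_normrE; apply/bigmax_leP; split.
  exact: enorm_ge0.
move=> [i j] _ /=; rewrite ord1 -ler_sqr ?nnegrE ?enorm_ge0 //.
rewrite sqr_enorm real_normK ?num_real // /dot (bigD1 j) //= -expr2 lerDl.
by apply: sumr_ge0 => k _; rewrite -expr2 sqr_ge0.
Qed.

Lemma dot_continuous : continuous (fun p : 'rV[R]_n * 'rV[R]_n => dot p.1 p.2).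
Proof.
move=> p; rewrite /continuous_at /dot.
apply: cvg_big => [|i _]; first exact: add_continuous.
apply: cvgM.
  apply: (cvg_comp (fun q : 'rV[R]_n * 'rV[R]_n => q.1) (fun M : 'rV[R]_n => M 0 i)).
    exact: cvg_fst.
  exact: coord_continuous.
apply: (cvg_comp (fun q : 'rV[R]_n * 'rV[R]_n => q.2) (fun M : 'rV[R]_n => M 0 i)).
  exact: cvg_snd.
exact: coord_continuous.
Qed.

Lemma cvg_dot {T : Type} {F : set_system T} {FF : Filter F}
    (f g : T -> 'rV[R]_n) u v :
  f @ F --> u -> g @ F --> v -> dot (f x) (g x) @[x --> F] --> dot u v.
Proof.
move=> fu gv.
have fgc : (f x, g x) @[x --> F] --> (u, v) by apply: (cvg_pair fu gv).
exact: (cvg_comp _ _ fgc (@dot_continuous (u, v))).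
Qed.

Lemma cvg_enorm {T : Type} {F : set_system T} {FF : Filter F}
    (f : T -> 'rV[R]_n) u :
  f @ F --> u -> enorm (f x) @[x --> F] --> enorm u.
Proof.
by move=> fu; apply: (cvg_comp _ _ (cvg_dot fu fu)); exact: sqrt_continuous.
Qed.

Lemma dot_is_bilinear :
  bilinear_for (GRing.Scale.Law.clone _ _ *:%R _)
    (GRing.Scale.Law.clone _ _ *:%R _) (@dot R n : _ -> _ -> R^o).
Proof. by split=> [u'|u] a x y /=; rewrite ?dotDl ?dotZl ?dotDr ?dotZr. Qed.

HB.instance Definition _ :=
  bilinear_isBilinear.Build R 'rV[R]_n 'rV[R]_n R^o _ _ (@dot R n)
    dot_is_bilinear.

End Euclidean.

Lemma local_to_global (R : realType) (a b : R) (rel : R -> R -> Prop) :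
  a <= b -> (forall t, rel t t) ->
  (forall r s t, rel r s -> rel s t -> rel r t) ->
  (forall t, a < t -> t <= b -> \forall s \near t^'-, a <= s -> rel s t) ->
  (forall t, a <= t -> t < b -> \forall s \near t^'+, s <= b -> rel t s) ->
  rel a b.
Proof.
move=> ab rel_refl rel_trans rel_left rel_right.
pose S := [set t | a <= t <= b /\ rel a t].
have Sa : S a by split; rewrite ?lexx.
have supS : has_sup S by split; [exists a | exists b => t [/andP[]]].
set c := sup S.
have ac : a <= c by apply: sup_upper_bound supS _ Sa.
have cb : c <= b by apply: ge_sup => [|t [/andP[]]//]; exists a.
have Sc : rel a c.
  move: ac; rewrite le_eqVlt => /predU1P[<-//|ac].
  have [e /= e0 he] := rel_left c ac cb.
  have [t [/andP[at_ tb] rt] ct] := sup_adherent e0 supS.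
  have tc : t <= c by apply: sup_upper_bound supS _ _; split; rewrite ?at_.
  move: tc; rewrite le_eqVlt => /predU1P[<-//|tc].
  apply: rel_trans rt _; apply: he => //=.
  by rewrite gtr0_norm ?subr_gt0 // ltrBlDr -ltrBlDl.
move: cb; rewrite le_eqVlt => /predU1P[<-//|cb].
have [e /= e0 he] := rel_right c ac cb.
pose t := Num.min (c + e / 2) b.
have ct : c < t by rewrite lt_min cb ltrDl divr_gt0.
have tb : t <= b by rewrite ge_min lexx orbT.
have rct : rel c t.
  apply: he => //=; rewrite distrC gtr0_norm ?subr_gt0 // ltrBlDl.
  rewrite gt_min; apply/orP; left; lra.
suff : t <= c by rewrite leNgt ct.
apply: sup_upper_bound supS _ _; split; last exact: rel_trans rct.
by rewrite tb andbT (le_trans ac) // ltW.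
Qed.

Section Differentials.
Context {R : realType} {V W : normedModType R}.
Implicit Types (f : V -> W) (x v : V).

Lemma is_diff_norm f x (df : {linear V -> W}) : continuous df ->
  (forall e, 0 < e -> \forall y \near x,
     `|f y - f x - df (y - x)| <= e * `|y - x|) ->
  is_diff x f df.
Proof.
move=> cdf hf.
have eqo : f \o shift x = cst (f x) + df +o_ 0 id.
  apply/eqaddoP => e e0.
  have := hf e e0; rewrite (near_shift 0); apply: filterS => h /=.
  by rewrite /= subr0 addrK opprD addrA.
have dfE := diff_unique cdf eqo.
split=> //; apply/diff_locallyP; rewrite dfE; split => //.
Qed.

Lemma diff_norm f x e : differentiable f x -> 0 < e ->
  \forall y \near x, `|f y - f x - 'd f x (y - x)| <= e * `|y - x|.
Proof.
move=> /diff_locally /eqaddoP fx e0; rewrite (near_shift 0).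
by apply: filterS (fx e e0) => h; rewrite /= subr0 addrK opprD addrA.
Qed.
End Differentials.

Section Bilinear.
Context {R : realType} {V U1 U2 W : normedModType R}.

Lemma is_diff_bilin (b : {bilinear U1 -> U2 -> W}) (f df : V -> U1)
    (g dg : V -> U2) x :
  continuous (fun p => b p.1 p.2) -> is_diff x f df -> is_diff x g dg ->
  is_diff x (fun y => b (f y) (g y)) (fun v => b (f x) (dg v) + b (df v) (g x)).
Proof.
move=> cb fx gx.
have bd : is_diff (f x, g x) (fun p => b p.1 p.2)
    (fun q => b (f x) q.2 + b q.1 (g x)).
  by split; [exact: differentiable_bilin | exact: diff_bilin].
exact: (@is_diff_comp _ _ _ _ (fun y => (f y, g y)) _ (fun p => b p.1 p.2)).
Qed.

End Bilinear.

Section C1_closure.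
Context {R : realType}.

Lemma C1_onS (V W : normedModType R) (A B : set V) (f : V -> W) :
  A `<=` B -> C1_on B f -> C1_on A f.
Proof. by move=> AB Bf x /AB /Bf. Qed.

Lemma C1_on_diff (V W : normedModType R) (A : set V) (f : V -> W)
    (df : V -> V -> W) : open A ->
  (forall x, A x -> is_diff x f (df x)) ->
  (forall x v, A x -> {for x, continuous (df ^~ v)}) -> C1_on A f.
Proof.
move=> oA fd cdf x Ax; have fx := fd x Ax; split; first exact: ex_diff.
move=> v; have := cdf x v Ax; rewrite /prop_for /continuous_at /=.
have -> : df x v = 'd f x v by have -> : df x = 'd f x by rewrite diff_val.
apply: cvg_trans; apply: near_eq_cvg.
have : nbhs x A by apply: open_nbhs_nbhs.
by apply: filterS => y /fd fy; have -> : df y = 'd f y by rewrite diff_val.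
Qed.

Lemma C1_on_cst (V W : normedModType R) (A : set V) (a : W) :
  C1_on A (cst a : V -> W).
Proof.
move=> x _; split; first exact: differentiable_cst.
move=> v; have -> : (fun y => 'd (cst a : V -> W) y v) = cst 0.
  by apply/funext => y; rewrite diff_cst.
exact: cst_continuous.
Qed.

Lemma C1_on_lin (V W : normedModType R) (A : set V) (f : {linear V -> W}) :
  continuous f -> C1_on A f.
Proof.
move=> cf x _; split; first exact: linear_differentiable.
move=> v; have -> : (fun y => 'd f y v) = cst (f v).
  by apply/funext => y; rewrite diff_lin.
exact: cst_continuous.
Qed.

Lemma C1_onN (V W : normedModType R) (A : set V) (f : V -> W) : open A ->
  C1_on A f -> C1_on A (fun x => - f x).
Proof.
move=> oA Af; apply: (C1_on_diff (df := fun x v => - 'd f x v)) => // x.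
  by move=> /Af [/differentiableP fx _]; exact: is_diffN.
by move=> v /Af [_ /(_ v)]; exact: cvgN.
Qed.

Lemma C1_onD (V W : normedModType R) (A : set V) (f g : V -> W) : open A ->
  C1_on A f -> C1_on A g -> C1_on A (fun x => f x + g x).
Proof.
move=> oA Af Ag; apply: (C1_on_diff (df := fun x v => 'd f x v + 'd g x v)) => //.
  move=> x Ax; have [/differentiableP fx _] := Af x Ax.
  by have [/differentiableP gx _] := Ag x Ax; exact: is_diffD.
move=> x v Ax; have [_ /(_ v) fx] := Af x Ax.
by have [_ /(_ v) gx] := Ag x Ax; exact: cvgD.
Qed.

Lemma C1_onB (V W : normedModType R) (A : set V) (f g : V -> W) : open A ->
  C1_on A f -> C1_on A g -> C1_on A (fun x => f x - g x).
Proof. by move=> oA Af Ag; exact: (C1_onD oA Af (C1_onN oA Ag)). Qed.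

Lemma C1_on_pair (V W1 W2 : normedModType R) (A : set V) (f : V -> W1)
    (g : V -> W2) : open A ->
  C1_on A f -> C1_on A g -> C1_on A (fun x => (f x, g x)).
Proof.
move=> oA Af Ag.
apply: (C1_on_diff (df := fun x v => ('d f x v, 'd g x v))) => //.
  move=> x Ax; have [/differentiableP fx _] := Af x Ax.
  by have [/differentiableP gx _] := Ag x Ax; exact: is_diff_pair.
move=> x v Ax; have [_ /(_ v) fx] := Af x Ax.
by have [_ /(_ v) gx] := Ag x Ax; exact: cvg_pair.
Qed.

Lemma C1_on_bilin (V U1 U2 W : normedModType R) (A : set V)
    (b : {bilinear U1 -> U2 -> W}) (f : V -> U1) (g : V -> U2) : open A ->
  continuous (fun p => b p.1 p.2) ->
  C1_on A f -> C1_on A g -> C1_on A (fun x => b (f x) (g x)).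
Proof.
move=> oA cb Af Ag; pose db x v := b (f x) ('d g x v) + b ('d f x v) (g x).
have cvgb (F : V -> U1) (G : V -> U2) x : {for x, continuous F} ->
    {for x, continuous G} -> {for x, continuous (fun y => b (F y) (G y))}.
  move=> cF cG.
  have FG : (F y, G y) @[y --> x] --> (F x, G x) by exact: (cvg_pair cF cG).
  exact: (cvg_comp _ _ FG (cb (F x, G x))).
apply: (C1_on_diff (df := db)) => // [x Ax|x v Ax].
  have [/differentiableP fx _] := Af x Ax.
  by have [/differentiableP gx _] := Ag x Ax; exact: is_diff_bilin.
have [dfx /(_ v) cfx] := Af x Ax; have [dgx /(_ v) cgx] := Ag x Ax.
have fc := differentiable_continuous dfx; have gc := differentiable_continuous dgx.
exact: (cvgD (cvgb _ _ x fc cgx) (cvgb _ _ x cfx gc)).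
Qed.

Lemma C1_onV (V : normedModType R) (A : set V) (f : V -> R^o) : open A ->
  (forall x, A x -> f x != 0) -> C1_on A f -> C1_on A (fun x => (f x)^-1).
Proof.
move=> oA f0 Af.
apply: (C1_on_diff (df := fun x v => - (f x) ^- 2 *: 'd f x v)) => //.
  move=> x Ax; have [fx _] := Af x Ax.
  by split; [exact: differentiableV (f0 x Ax) | exact: diffV (f0 x Ax)].
move=> x v Ax; have [dfx /(_ v) cfx] := Af x Ax.
apply: cvgZ => //; apply: cvgN; apply: cvgV; first by rewrite expf_neq0 // f0.
by apply: cvgM; exact: (differentiable_continuous dfx).
Qed.

Definition finite_dimensional (U : normedModType R) :=
  exists m (e : 'I_m -> U) (c : 'I_m -> U -> R),
    (forall i, continuous (c i)) /\ forall u, u = \sum_i c i u *: e i.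

Lemma finite_dimensional_rV n : finite_dimensional 'rV[R]_n.
Proof.
exists n, (fun i => delta_mx 0 i), (fun i (u : 'rV[R]_n) => u 0 i); split.
  by move=> i; exact: coord_continuous.
exact: row_sum_delta.
Qed.

Lemma finite_dimensional_prod (U1 U2 : normedModType R) :
  finite_dimensional U1 -> finite_dimensional U2 ->
  finite_dimensional (U1 * U2)%type.
Proof.
move=> [m1 [e1 [c1 [cc1 E1]]]] [m2 [e2 [c2 [cc2 E2]]]].
exists (m1 + m2)%N, (fun i => match fintype.split i with
  inl j => (e1 j, 0) | inr j => (0, e2 j) end),
 (fun i u => match fintype.split i with inl j => c1 j u.1 | inr j => c2 j u.2 end).
split.
  move=> i /=; case: (fintype.split i) => j u.
    by apply: (cvg_comp (@fst U1 U2) (c1 j)); [exact: cvg_fst | exact: cc1].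
  by apply: (cvg_comp (@snd U1 U2) (c2 j)); [exact: cvg_snd | exact: cc2].
move=> [u1 u2]; rewrite big_split_ord /=.
have split_l (j : 'I_m1) : fintype.split (lshift m2 j) = inl j by exact: (unsplitK (inl _ j)).
have split_r (j : 'I_m2) : fintype.split (rshift m1 j) = inr j by exact: (unsplitK (inr _ j)).
under eq_bigr do rewrite split_l.
under [X in _ = _ + X]eq_bigr do rewrite split_r.
rewrite [LHS](_ : _ = (u1, 0) + (0, u2)); last first.
  by congr (_, _); rewrite ?addr0 ?add0r.
congr (_ + _).
  rewrite {1}(E1 u1) (big_morph (fun x => (x, 0 : U2)) (op1 := +%R) (id1 := 0)) //.
    by apply: eq_bigr => j _; congr (_, _); rewrite scaler0.
  by move=> x y; congr (_, _); rewrite addr0.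
rewrite {1}(E2 u2) (big_morph (fun x => (0 : U1, x)) (op1 := +%R) (id1 := 0)) //.
  by apply: eq_bigr => j _; congr (_, _); rewrite scaler0.
by move=> x y; congr (_, _); rewrite addr0.
Qed.

(* Continuity of the derivative in each fixed direction is joint continuity
   because the space of directions is finite dimensional. *)
Lemma C1_on_joint (V U W : normedModType R) (B : set U) (g : U -> W)
    (f h : V -> U) (x : V) : finite_dimensional U -> C1_on B g -> B (f x) ->
  {for x, continuous f} -> {for x, continuous h} ->
  {for x, continuous (fun y => 'd g (f y) (h y))}.
Proof.
move=> [m [e [c [cc E]]]] Bg Bfx cf ch.
have -> : (fun y => 'd g (f y) (h y)) =
    fun y => \sum_i c i (h y) *: 'd g (f y) (e i).
  apply/funext => y; rewrite {1}(E (h y)) linear_sum.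
  by apply: eq_bigr => i _; rewrite linearZ.
apply: cvg_big => [|i _]; first exact: add_continuous.
have [_ /(_ (e i)) cg] := Bg _ Bfx.
apply: cvgZ; first exact: (cvg_comp _ _ ch (cc i _)).
exact: (cvg_comp _ _ cf cg).
Qed.

Lemma C1_on_comp (V U W : normedModType R) (A : set V) (B : set U)
    (f : V -> U) (g : U -> W) : finite_dimensional U -> open A ->
  (forall x, A x -> B (f x)) -> C1_on A f -> C1_on B g ->
  C1_on A (g \o f).
Proof.
move=> fU oA AB Af Bg.
apply: (C1_on_diff (df := fun x v => 'd g (f x) ('d f x v))) => //.
  move=> x Ax; have [/differentiableP fx _] := Af x Ax.
  have [/differentiableP gx _] := Bg _ (AB x Ax); exact: is_diff_comp.
move=> x v Ax; have [dfx /(_ v) cfx] := Af x Ax.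
apply: C1_on_joint => //; [exact: Bg | exact: AB |].
exact: differentiable_continuous.
Qed.

End C1_closure.

Section Charts.
Context {R : realType} {n : nat}.
Implicit Types (A B U : set 'rV[R]_n) (q p v w : 'rV[R]_n) (f : 'rV[R]_n -> R^o).

Lemma diff_gradE f q w : 'd f q w = dot w (grad f q).
Proof.
rewrite [w in LHS]row_sum_delta linear_sum; apply: eq_bigr => i _.
by rewrite linearZ mxE.
Qed.

Lemma bdry_mem A q : closed A -> bdry A q -> A q.
Proof. by move=> /closure_id AE [+ _]; rewrite -AE. Qed.

Lemma bdry_near A B q : (\forall x \near q, A x <-> B x) -> bdry A q -> bdry B q.
Proof.
move=> AB [clA intA]; split.
  move=> V Vq; have [x [Ax [ABx Vx]]] := clA _ (filterI AB Vq).
  by exists x; split => //; apply/ABx.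
move=> intB; apply: intA; apply: filterS (filterI AB intB) => x [ABx Bx].
exact/ABx.
Qed.

Lemma boundary_chart_near A B q U f (V : set 'rV[R]_n) : open V -> V q ->
  (forall x, V x -> A x <-> B x) -> boundary_chart A q U f ->
  boundary_chart B q (U `&` V) f.
Proof.
move=> oV Vq AB [bq [oU Uq] Uf gf Af]; split => //.
- by apply: bdry_near bq; apply: filterS AB _; apply: open_nbhs_nbhs.
- by split => //; apply: openI.
- have UV : U `&` V `<=` U by move=> x [].
  by case: Uf => C1 C2; split => [|v]; [apply: C1_onS C1 | apply: C1_onS (C2 v)].
- by move=> x [Ux Vx]; rewrite -(AB x Vx); exact: Af.
Qed.

Section One_chart.
Context {A U : set 'rV[R]_n} {q : 'rV[R]_n} {f : 'rV[R]_n -> R^o}.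
Hypothesis chart : boundary_chart A q U f.

Lemma chart_nbhs : nbhs q U.
Proof. by case: chart => _ [oU Uq] _ _ _; apply: open_nbhs_nbhs. Qed.

Lemma chart_differentiable x : U x -> differentiable f x.
Proof. by case: chart => _ _ [fC1 _] _ _ /fC1 []. Qed.

Lemma chart_root : f q = 0.
Proof.
have Uq := nbhs_singleton chart_nbhs.
have cf := differentiable_continuous (chart_differentiable Uq).
have [[clA intA] _ _ _ Af] := chart.
apply/eqP; rewrite eq_le !leNgt; apply/andP; split; apply/negP => fq.
  have fx : \forall x \near q, 0 < f x by apply: (cf [set y | 0 < y]); exact: lt_nbhsr.
  have [x [Ax [fx0 Ux]]] := clA _ (filterI fx chart_nbhs).
  by move: Ax => /(Af x Ux); rewrite leNgt fx0.
have fx : \forall x \near q, f x < 0 by apply: (cf [set y | y < 0]); exact: lt_nbhsl.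
apply: intA; apply: filterS (filterI fx chart_nbhs) => x [fx0 Ux].
by apply/(Af x Ux)/ltW.
Qed.

Lemma chart_mem : A q.
Proof.
case: chart => _ [_ Uq] _ _ Af; apply/(Af _ Uq).
by rewrite chart_root.
Qed.

Lemma chart_line w e : 0 < e ->
  \forall t \near (0 : R)^'+,
    U (q + t *: w) /\ `|f (q + t *: w) - t * dot w (grad f q)| <= t * e.
Proof.
move=> e0; have Uq := nbhs_singleton chart_nbhs.
have w1 : 0 < `|w| + 1 by rewrite ltr_pwDr.
have ew : 0 < e / (`|w| + 1) by rewrite divr_gt0.
have := diff_norm (chart_differentiable Uq) ew.
rewrite chart_root => near_q.
have line : q + t *: w @[t --> 0^'+] --> q.
  rewrite -[X in _ --> X]addr0 -(scale0r w).
  apply: cvgD; first exact: cvg_cst.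
  by apply: cvgZr_tmp; apply: cvg_at_right_filter; exact: cvg_id.
have := line _ (filterI near_q chart_nbhs).
rewrite /= nbhs_filterE; move=> near_t.
near=> t.
have t0 : 0 < t by near: t; exact: nbhs_right_gt.
have [] : (`|f (q + t *: w) - 0 - 'd f q (q + t *: w - q)| <=
   e / (`|w| + 1) * `|q + t *: w - q|) /\ U (q + t *: w).
  by near: t; exact: near_t.
rewrite subr0 [q + _]addrC addrK linearZ normrZ (gtr0_norm t0) diff_gradE => h Ut.
split=> //; apply: le_trans h _; rewrite mulrCA ler_wpM2l ?(ltW t0) //.
by rewrite -mulrA ger_pMr // mulrC ler_pdivrMr // mul1r lerDl.
Unshelve. all: by end_near. Qed.

Lemma chart_inward w : dot w (grad f q) < 0 ->
  \forall t \near (0 : R)^'+, interior A (q + t *: w).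
Proof.
move=> wg; have [_ [oU _] _ _ Af] := chart.
have e0 : 0 < - dot w (grad f q) / 2 by rewrite divr_gt0 ?oppr_gt0.
near=> t; have [Ut] : U (q + t *: w) /\
   `|f (q + t *: w) - t * dot w (grad f q)| <= t * (- dot w (grad f q) / 2).
  by near: t; exact: chart_line.
have : t * dot w (grad f q) < 0 by rewrite pmulr_rlt0.
rewrite ler_norml => tg /andP[_ h].
have ft : f (q + t *: w) < 0 by lra.
have cf := differentiable_continuous (chart_differentiable Ut).
have fx : \forall x \near q + t *: w, f x < 0.
  by apply: (cf [set y | y < 0]); exact: lt_nbhsl.
have Ux : \forall x \near q + t *: w, U x by apply: open_nbhs_nbhs.
by apply: filterS (filterI fx Ux) => x [/ltW fx0 Ux0]; apply/(Af _ Ux0).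
Unshelve. all: by end_near. Qed.

Lemma chart_outward w : 0 < dot w (grad f q) ->
  \forall t \near (0 : R)^'+, ~ A (q + t *: w).
Proof.
move=> wg; have [_ _ _ _ Af] := chart.
have e0 : 0 < dot w (grad f q) / 2 by rewrite divr_gt0.
near=> t; have [Ut] : U (q + t *: w) /\
   `|f (q + t *: w) - t * dot w (grad f q)| <= t * (dot w (grad f q) / 2).
  by near: t; exact: chart_line.
have : 0 < t * dot w (grad f q) by rewrite mulr_gt0.
rewrite ler_norml => t0 /andP[h _] /(Af _ Ut) h'; lra.
Unshelve. all: by end_near. Qed.

Lemma chart_support p : @convex_set R 'rV[R]_n A -> A p ->
  dot (p - q) (grad f q) <= 0.
Proof.
move=> cA Ap; rewrite leNgt; apply/negP => /chart_outward out.
have t1 : \forall t \near (0 : R)^'+, t < 1 by exact: nbhs_right_lt.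
have t0 : \forall t \near (0 : R)^'+, 0 < t by exact: nbhs_right_gt.
have [t [[nA t_lt1] t_gt0]] := filter_ex (filterI (filterI out t1) t0).
apply: nA; have t01 : 0 <= t <= 1 by rewrite !ltW.
have := cA p q (Itv01 (ltW t_gt0) (ltW t_lt1)).
rewrite !inE => /(_ Ap chart_mem); congr (A _).
by rewrite [LHS]/(t *: p + (1 - t) *: q) scalerBl scalerBr scale1r addrCA.
Qed.

Lemma enorm_unit_normal : enorm (unit_normal f q) = 1.
Proof.
case: chart => _ _ _ gf _.
by rewrite enormZ ger0_norm ?invr_ge0 ?enorm_ge0 // mulVf // enorm_eq0.
Qed.

Lemma unit_normal_unique (m : 'rV[R]_n) : enorm m = 1 ->
  (forall p, A p -> dot (p - q) m <= 0) -> m = unit_normal f q.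
Proof.
move=> m1 Am; set N := unit_normal f q.
have N1 : enorm N = 1 by exact: enorm_unit_normal.
apply/eqP; rewrite -subr_eq0 -dot_eq0 eq_le dot_ge0 andbT leNgt; apply/negP => mN.
have mNE : dot (m - N) (m - N) = 2 * (1 - dot N m).
  by rewrite !dotBl !dotBr (dot_enorm1 m1) (dot_enorm1 N1) (dotC m N); ring.
have mN1 : 0 < 1 - dot N m by move: mN; rewrite mNE pmulr_rgt0.
have gE : grad f q = enorm (grad f q) *: N.
  rewrite scalerA mulfV ?scale1r // enorm_eq0; by case: chart.
have g0 : 0 < enorm (grad f q) by rewrite enorm_gt0; case: chart.
have : dot (m - N) (grad f q) < 0.
  rewrite gE dotZr pmulr_rlt0 // dotBl (dot_enorm1 N1) (dotC m N); lra.
move=> /chart_inward inw.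
have t0 : \forall t \near (0 : R)^'+, 0 < t by exact: nbhs_right_gt.
have [t [/interior_subset/Am + t_gt0]] := filter_ex (filterI inw t0).
rewrite [q + _]addrC addrK dotZl pmulr_rle0 // dotBl (dot_enorm1 m1); lra.
Qed.

End One_chart.

Lemma reflect_vecK (nu v : 'rV[R]_n) : enorm nu = 1 ->
  reflect_vec nu (reflect_vec nu v) = v.
Proof.
move=> /dot_enorm1 nu1; rewrite /reflect_vec dotBl dotZl nu1 -addrA -opprD.
rewrite -scalerDl; apply/eqP; rewrite subr_eq addrC -subr_eq subrr eq_sym.
by rewrite scaler_eq0; apply/orP; left; apply/eqP; ring.
Qed.

Lemma reflect_vecN (nu v : 'rV[R]_n) : reflect_vec nu (- v) = - reflect_vec nu v.
Proof. by rewrite /reflect_vec dotNl mulrN scaleNr opprB opprK addrC. Qed.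

Lemma enorm_reflect (nu v : 'rV[R]_n) : enorm nu = 1 ->
  enorm (reflect_vec nu v) = enorm v.
Proof.
move=> /dot_enorm1 nu1; congr Num.sqrt; rewrite /reflect_vec.
rewrite !dotBl !dotBr !dotZl !dotZr nu1 (dotC nu v); ring.
Qed.

End Charts.

Section Trajectories.
Context {R : realType} {n : nat} {K : set 'rV[R]_n}.
Hypothesis normal_unique : forall q nu nu',
  outward_normal K q nu -> outward_normal K q nu' -> nu = nu'.
Implicit Types (g h : R -> phase R n) (x y : phase R n) (s t c : R).

Definition trajectory_at g t : Prop :=
  [/\ phase_space K (g t),
    ~ bdry K (g t).1 -> \forall s \near t, g s = free_motion (g t) (s - t)
  & bdry K (g t).1 ->
      exists nu v_in,
        [/\ outward_normal K (g t).1 nu,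
            (g t).2 = reflect_vec nu v_in,
            \forall s \near t^'-, g s = free_motion ((g t).1, v_in) (s - t)
          & \forall s \near t^'+, g s = free_motion (g t) (s - t)]].

Lemma enorm_outward_normal q nu : outward_normal K q nu -> enorm nu = 1.
Proof. by move=> [U [f [ch ->]]]; exact: enorm_unit_normal ch. Qed.

Lemma outward_normal_bdry q nu : outward_normal K q nu -> bdry K q.
Proof. by move=> [U [f [[]]]]. Qed.

Definition normal_at (q : 'rV[R]_n) := xget 0 (outward_normal K q).

Lemma normal_atE q nu : outward_normal K q nu -> normal_at q = nu.
Proof.
by move=> qnu; apply: xget_unique => // nu' qnu'; exact: normal_unique qnu.
Qed.

Lemma normal_at_cases q : normal_at q = 0 \/ enorm (normal_at q) = 1.
Proof.
rewrite /normal_at; case: xgetP => [nu _ /enorm_outward_normal|_]; by auto.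
Qed.

Definition incoming x : 'rV[R]_n :=
  if `[< bdry K x.1 >] then reflect_vec (normal_at x.1) x.2 else x.2.

Definition reverse_state x : phase R n := (x.1, - incoming x).

Lemma reflect_normal_atK q v :
  reflect_vec (normal_at q) (reflect_vec (normal_at q) v) = v.
Proof.
have [->|] := normal_at_cases q; last exact: reflect_vecK.
by rewrite /reflect_vec !scaler0 !subr0.
Qed.

Lemma incomingK x : incoming (x.1, incoming x) = x.2.
Proof. by rewrite /incoming /=; case: asboolP => // _; exact: reflect_normal_atK. Qed.

Lemma incomingN x : incoming (x.1, - x.2) = - incoming x.
Proof. by rewrite /incoming /=; case: asboolP => // _; exact: reflect_vecN. Qed.

Lemma incoming_free x : ~ bdry K x.1 -> incoming x = x.2.
Proof. by rewrite /incoming; case: asboolP. Qed.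

Lemma incoming_bdry x nu : outward_normal K x.1 nu ->
  incoming x = reflect_vec nu x.2.
Proof.
move=> xnu; have bx := outward_normal_bdry xnu.
by rewrite /incoming; case: asboolP => // _; rewrite (normal_atE xnu).
Qed.

Lemma incoming_inj x y : x.1 = y.1 -> incoming x = incoming y -> x = y.
Proof.
case: x y => [x v] [y w] /= <- h; congr (_, _).
by rewrite -[v]/(x, v).2 -(incomingK (x, v)) h (incomingK (x, w)).
Qed.

Lemma reverse_stateK x : reverse_state (reverse_state x) = x.
Proof.
rewrite /reverse_state (incomingN (x.1, incoming x)) incomingK opprK.
by case: x.
Qed.

Lemma enorm_incoming x : enorm (incoming x) = enorm x.2.
Proof.
rewrite /incoming; case: ifP => // _; have [->|] := normal_at_cases x.1.
  by rewrite /reflect_vec !scaler0 !subr0.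
exact: enorm_reflect.
Qed.

Lemma free_motion_inj s x y : free_motion x s = free_motion y s -> x = y.
Proof.
case: x y => [x v] [y w] [/= E vw]; congr (_, _) => //.
by move: E; rewrite vw => E; exact: (addIr _ E).
Qed.

Lemma free_motion0 x : free_motion x 0 = x.
Proof. by case: x => x v; rewrite /free_motion scale0r addr0. Qed.

Lemma free_motionD x s t : free_motion (free_motion x s) t = free_motion x (s + t).
Proof. by case: x => x v; rewrite /free_motion /= scalerDl addrA. Qed.

Lemma trajectory_left g t : trajectory_at g t ->
  \forall s \near t^'-, g s = free_motion ((g t).1, incoming (g t)) (s - t).
Proof.
move=> [_ free_t bounce_t]; have [bt|nbt] := pselect (bdry K (g t).1).
  have [nu [w [nunu gt2 lt _]]] := bounce_t bt.
  rewrite (incoming_bdry nunu) gt2 reflect_vecK //; exact: enorm_outward_normal nunu.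
rewrite incoming_free // -surjective_pairing.
by apply: cvg_within; exact: free_t.
Qed.

Lemma trajectory_right g t : trajectory_at g t ->
  \forall s \near t^'+, g s = free_motion (g t) (s - t).
Proof.
move=> [_ free_t bounce_t]; have [bt|nbt] := pselect (bdry K (g t).1).
  by have [nu [w []]] := bounce_t bt.
by apply: cvg_within; exact: free_t.
Qed.

Lemma trajectory_unique g h a b : a <= b ->
  (forall t, a <= t -> t <= b -> trajectory_at g t /\ trajectory_at h t) ->
  (g a = h a <-> g b = h b).
Proof.
move=> ab gh; apply: (local_to_global (rel := fun s t => g s = h s <-> g t = h t)) => //.
- by move=> r s t [rs sr] [st ts]; split; auto.
- move=> t at_ tb; have [/trajectory_left gt /trajectory_left ht] := gh _ (ltW at_) tb.
  near=> s => _; have -> : g s = free_motion ((g t).1, incoming (g t)) (s - t).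
    by near: s.
  have -> : h s = free_motion ((h t).1, incoming (h t)) (s - t) by near: s.
  split=> [/free_motion_inj [e1 e2]|->//]; exact: incoming_inj.
- move=> t at_ tb; have [/trajectory_right gt /trajectory_right ht] := gh _ at_ (ltW tb).
  near=> s => _; have -> : g s = free_motion (g t) (s - t) by near: s.
  have -> : h s = free_motion (h t) (s - t) by near: s.
  by split=> [->|/free_motion_inj].

Unshelve. all: by end_near. Qed.

Lemma trajectory_lipschitz g a b : a <= b ->
  (forall t, a <= t -> t <= b -> trajectory_at g t) ->
  enorm ((g b).1 - (g a).1) <= b - a.
Proof.
move=> ab ga.
apply: (local_to_global (rel := fun s t => enorm ((g t).1 - (g s).1) <= t - s)) => //.
- by move=> t; rewrite !subrr enorm0.
- move=> r s t rs st; rewrite -(subrKA (g s).1) (le_trans (ler_enormD _ _)) //; lra.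
- move=> t at_ tb; have gt := ga _ (ltW at_) tb; have /trajectory_left gtl := gt.
  near=> s => _; have -> : g s = free_motion ((g t).1, incoming (g t)) (s - t).
    by near: s.
  have st : s < t by near: s; exact: nbhs_left_lt.
  rewrite /= opprD addrA subrr add0r enormN enormZ enorm_incoming.
  by case: gt => [[_ ->]] _ _; rewrite mulr1 distrC gtr0_norm ?subr_gt0.
- move=> t at_ tb; have gt := ga _ at_ (ltW tb); have /trajectory_right gtr := gt.
  near=> s => _; have -> : g s = free_motion (g t) (s - t) by near: s.
  have st : t < s by near: s; exact: nbhs_right_gt.
  rewrite /= [_ + _ *: _]addrC addrK enormZ.
  by case: gt => [[_ ->]] _ _; rewrite mulr1 gtr0_norm ?subr_gt0.
Unshelve. all: by end_near. Qed.

Lemma trajectory_straight g a b : a <= b ->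
  (forall t, a <= t -> t <= b -> trajectory_at g t /\ ~ bdry K (g t).1) ->
  g b = free_motion (g a) (b - a).
Proof.
move=> ab ga.
apply: (local_to_global (rel := fun s t => g t = free_motion (g s) (t - s))) => //.
- by move=> t; rewrite subrr free_motion0.
- by move=> r s t rs ->; rewrite rs free_motionD [_ + (t - s)]addrC subrKA.
- move=> t at_ tb; have [/trajectory_left gt nb] := ga _ (ltW at_) tb.
  near=> s => _; have -> : g s = free_motion ((g t).1, incoming (g t)) (s - t).
    by near: s.
  by rewrite incoming_free // -surjective_pairing free_motionD subrKA subrr free_motion0.
- move=> t at_ tb; have [/trajectory_right gt nb] := ga _ at_ (ltW tb).
  by apply: filterS gt.
Unshelve. all: by end_near. Qed.

Lemma incoming_affine g t : trajectory_at g t ->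
  (\forall s \near t^'-, g s = free_motion (g t) (s - t)) ->
  incoming (g t) = (g t).2.
Proof.
move=> /trajectory_left gt gt'.
have [s [E1 E2]] := @filter_ex _ (at_left t) _ _ (filterI gt gt').
have := free_motion_inj (etrans (esym E1) E2).
by move=> /(congr1 (@snd 'rV[R]_n 'rV[R]_n)).
Qed.

Lemma near_reverse c t (P : set R) :
  (\forall s \near (c - t)^'+, P s) -> \forall s \near t^'-, P (c - s).
Proof.
move=> [e /= e0 he]; exists e => //= s /=; rewrite distrC => st s_lt_t.
by apply: he; rewrite /= ?ltrD2l ?ltrN2 // opprB [c - t + _]addrC subrKA.
Qed.

Lemma near_reverse_left c t (P : set R) :
  (\forall s \near (c - t)^'-, P s) -> \forall s \near t^'+, P (c - s).
Proof.
move=> [e /= e0 he]; exists e => //= s /=; rewrite distrC => st s_gt_t.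
by apply: he; rewrite /= ?ltrD2l ?ltrN2 // opprB [c - t + _]addrC subrKA.
Qed.

Lemma near_reverse_both c t (P : set R) :
  (\forall s \near (c - t), P s) -> \forall s \near t, P (c - s).
Proof.
move=> [e /= e0 he]; exists e => //= s /=; rewrite distrC => st.
by apply: he; rewrite /= opprB [c - t + _]addrC subrKA.
Qed.

Lemma reverse_affine_right g t : (forall s, trajectory_at g s) ->
  \forall s \near t^'+, reverse_state (g s) = free_motion ((g t).1, - (g t).2) (t - s).
Proof.
move=> tg; have [e /= e0 he] := trajectory_right (tg t).
exists e => //= s st ts; have gs : g s = free_motion (g t) (s - t) by exact: he.
rewrite /reverse_state incoming_affine //.
  by rewrite gs /free_motion /= -[t - s]opprB scaleNr scalerN opprK.
near=> r; have rs : r < s by near: r; exact: nbhs_left_lt.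
have tr : t < r by near: r; exact: nbhs_left_gt.
rewrite gs free_motionD [_ + (r - s)]addrC subrKA; apply: he => //=.
by move: st; rewrite /= !(distrC t) !gtr0_norm ?subr_gt0 //; lra.
Unshelve. all: by end_near. Qed.

Lemma reverse_affine_left g t : (forall s, trajectory_at g s) ->
  \forall s \near t^'-, reverse_state (g s) = free_motion (reverse_state (g t)) (t - s).
Proof.
move=> tg; have [e /= e0 he] := trajectory_left (tg t).
exists e => //= s st ts.
have gs : g s = free_motion ((g t).1, incoming (g t)) (s - t) by exact: he.
rewrite {1}/reverse_state incoming_affine //.
  by rewrite gs /free_motion /= -[t - s]opprB scaleNr scalerN opprK.
near=> r; have rs : r < s by near: r; exact: nbhs_left_lt.
have sr : t - e < r.
  near: r; apply: nbhs_left_gt.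
  by move: st; rewrite /= gtr0_norm ?subr_gt0 // ltrBlDr -ltrBlDl.
rewrite gs free_motionD [_ + (r - s)]addrC subrKA; apply: he => /=.
  by rewrite gtr0_norm ?subr_gt0 //; lra.
lra.
Unshelve. all: by end_near. Qed.

Lemma reverse_trajectory g c : billiard_trajectory K g ->
  billiard_trajectory K (fun t => reverse_state (g (c - t))).
Proof.
move=> tg t; have [[ext v1] free_t bounce_t] := tg (c - t); split.
- by split => //=; rewrite enormN enorm_incoming.
- move=> /= nb; have free_ct := free_t nb.
  have E : reverse_state (g (c - t)) = ((g (c - t)).1, - (g (c - t)).2).
    by rewrite /reverse_state incoming_free.
  suff near_c : \forall s \near c - t,
      reverse_state (g s) = free_motion ((g (c - t)).1, - (g (c - t)).2) (c - t - s).
    rewrite E; apply: filterS (near_reverse_both near_c) => s ->.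
    by congr free_motion; lra.
  apply: filterS (near_join free_ct) => s near_s.
  have gs := nbhs_singleton near_s.
  have free_s : \forall r \near s, g r = free_motion (g s) (r - s).
    by apply: filterS near_s => r ->; rewrite gs free_motionD [_ + (r - s)]addrC subrKA.
  have inc : incoming (g s) = (g s).2.
    by apply: incoming_affine; [exact: tg | apply: cvg_within; exact: free_s].
  rewrite /reverse_state inc gs /free_motion /= scalerN -scaleNr.
  by congr (_ + _ *: _, _); lra.
- move=> /= bt; have [nu [w [nunu gt2 _ _]]] := bounce_t bt.
  have nu1 := enorm_outward_normal nunu.
  exists nu, (- (g (c - t)).2); split => //.
  + by rewrite reflect_vecN (incoming_bdry nunu).
  + have := near_reverse (reverse_affine_right (c - t) tg); apply: filterS => s /= ->.
    by congr free_motion; lra.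
  + have := near_reverse_left (reverse_affine_left (c - t) tg); apply: filterS => s /= ->.
    by congr free_motion; lra.
Qed.

Lemma shift_trajectory g c : billiard_trajectory K g ->
  billiard_trajectory K (fun t => g (t + c)).
Proof.
move=> /(reverse_trajectory c)/(reverse_trajectory 0); congr billiard_trajectory.
by apply/funext => t; rewrite reverse_stateK; congr g; lra.
Qed.

Lemma ident_free x y : ~ bdry K x.1 -> ident K x y -> x = y.
Proof. by move=> nb [//|[_ [nu [/outward_normal_bdry]]]]. Qed.

Lemma flow_trajectory g x t : billiard_trajectory K g -> ~ bdry K x.1 ->
  g 0 = x -> billiard_flow K t x = g t.
Proof.
move=> tg nb g0; rewrite /billiard_flow; case: xgetP => [h _ [th /(ident_free nb) h0]|].
  have gh0 : h 0 = g 0 by rewrite -h0 g0.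
  have [t0|/ltW t0] := leP 0 t.
    by have [] := @trajectory_unique h g _ _ t0; [by split | move=> H _; exact: H].
  by have [] := @trajectory_unique h g _ _ t0; [by split | move=> _ H; exact: H].
by move=> /(_ g) []; split => //; left.
Qed.

Lemma flow_cases x : ~ bdry K x.1 ->
  (exists2 g, billiard_trajectory K g & g 0 = x) \/
  forall t, billiard_flow K t x = x.
Proof.
move=> nb; have [[g tg]|H] := pselect
  (exists g, billiard_trajectory K g /\ ident K x (g 0)).
  by left; exists g; case: tg => // _ /(ident_free nb).
by right => t; rewrite /billiard_flow xgetPN // => g gP; apply: H; exists g.
Qed.

End Trajectories.

Section Quotient_distance.
Context {R : realType} {n : nat} {K : set 'rV[R]_n}.
Hypothesis normal_unique : forall q nu nu',
  outward_normal K q nu -> outward_normal K q nu' -> nu = nu'.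
Implicit Types (x y : phase R n).

Lemma penorm_ge0 x : 0 <= penorm x.
Proof. exact: sqrtr_ge0. Qed.

Lemma penorm0 : penorm (0 : phase R n) = 0.
Proof. by rewrite /penorm !dot0l addr0 sqrtr0. Qed.

Lemma ler_enorm_penorm x : enorm x.1 <= penorm x.
Proof. by rewrite ler_sqrt ?lerDl ?dot_ge0 // addr_ge0 ?dot_ge0. Qed.

Lemma ler_penorm x : penorm x <= enorm x.1 + enorm x.2.
Proof.
rewrite -ler_sqr ?nnegrE ?addr_ge0 ?sqrtr_ge0 // sqr_sqrtr ?addr_ge0 ?dot_ge0 //.
rewrite -!sqr_enorm; have := enorm_ge0 x.1; have := enorm_ge0 x.2; nra.
Qed.

Definition flip x : phase R n := (x.1, - x.2).

Lemma phase_space_flip x : phase_space K x -> phase_space K (flip x).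
Proof. by move=> [ext v1]; split => //=; rewrite enormN. Qed.

Lemma penorm_flipB x y : penorm (flip x - flip y) = penorm (x - y).
Proof.
rewrite /penorm /=; congr (Num.sqrt (_ + _)).
by rewrite -opprD dotNl dotNr opprK.
Qed.

Lemma ident_flip x y : ident K x y -> ident K (flip x) (flip y).
Proof.
move=> [->|[e1 [nu [xnu e2]]]]; first by left.
by right; split => //; exists nu; split => //=; rewrite e2 reflect_vecN.
Qed.

Lemma quotient_chain_flip x y l :
  quotient_chain K x y l -> quotient_chain K (flip x) (flip y) l.
Proof.
elim=> {x y l} [x y /ident_flip|x x' y z l /ident_flip xx' px' py _ IH].
  exact: chain_ident.
rewrite -penorm_flipB; apply: chain_step xx' _ _ IH; exact: phase_space_flip.
Qed.

Lemma quotient_chain_identl x x' y l : ident K x x' -> phase_space K x' ->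
  quotient_chain K x' y l -> quotient_chain K x y l.
Proof.
move=> xx' px' x'y; have := chain_step xx' px' px' x'y.
by rewrite subrr penorm0 add0r.
Qed.

Lemma quotient_chain_identr x y y' l : ident K y y' -> phase_space K y ->
  quotient_chain K x y l -> quotient_chain K x y' l.
Proof.
move=> yy' + xy; elim: xy yy' => {x y l} [x y xy|x x' y z l xx' px' py _ IH] yz py'.
  exact: quotient_chain_identl xy py' (chain_ident yz).
exact: chain_step xx' px' py (IH yz py').
Qed.

Lemma ident_reverse_state x : ident K (reverse_state (K := K) x) (flip x) /\
  ident K (flip x) (reverse_state (K := K) x).
Proof.
rewrite /reverse_state /incoming; case: asboolP => bx; last by split; left.
rewrite /normal_at; case: xgetP => [nu _ xnu|_]; last first.
  by rewrite /reflect_vec scaler0 subr0; split; left.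
have nu1 := enorm_outward_normal xnu.
split; right; split => //; exists nu; split => //=.
  by rewrite reflect_vecN reflect_vecK.
by rewrite reflect_vecN.
Qed.

Lemma quotient_chain_reverse x y l : phase_space K x -> phase_space K y ->
  quotient_chain K x y l ->
  quotient_chain K (reverse_state (K := K) x) (reverse_state (K := K) y) l.
Proof.
move=> /phase_space_flip px /phase_space_flip py /quotient_chain_flip.
have [xx' _] := ident_reverse_state x; have [_ yy'] := ident_reverse_state y.
move=> xy; apply: quotient_chain_identl xx' px _.
exact: quotient_chain_identr yy' py xy.
Qed.

Lemma quotient_chain_foot x y l : quotient_chain K x y l ->
  enorm (x.1 - y.1) <= l.
Proof.
have ident_foot x' y' : ident K x' y' -> x'.1 = y'.1 by move=> [->|[]].
elim=> {x y l} [x y /ident_foot ->|x x' y z l /ident_foot -> _ _ _ IH].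
  by rewrite subrr enorm0.
rewrite -(subrKA y.1) (le_trans (ler_enormD _ _)) // lerD //.
exact: (ler_enorm_penorm (x' - y)).
Qed.

Lemma quotient_chain_jump x y : phase_space K x -> phase_space K y ->
  quotient_chain K x y (penorm (x - y)).
Proof.
move=> px py; rewrite -[penorm _]addr0.
by apply: (chain_step (x' := x) (y := y)) => //; [left | apply: chain_ident; left].
Qed.

Lemma quotient_chain_jump2 x a a' y : phase_space K x -> phase_space K y ->
  phase_space K a -> phase_space K a' -> ident K a a' ->
  quotient_chain K x y (penorm (x - a) + penorm (a' - y)).
Proof.
move=> px py pa pa' aa'; apply: (chain_step (x' := x) (y := a)) => //; first by left.
by apply: (quotient_chain_identl aa' pa'); exact: quotient_chain_jump.
Qed.

Lemma has_inf_quotient_chain x y : phase_space K x -> phase_space K y ->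
  has_inf [set l | quotient_chain K x y l].
Proof.
move=> px py; split; first by exists (penorm (x - y)); apply: quotient_chain_jump.
by exists 0 => l /quotient_chain_foot; apply: le_trans; exact: enorm_ge0.
Qed.

Lemma quotient_dist_le x y l : quotient_chain K x y l -> quotient_dist K x y <= l.
Proof.
move=> xy; apply: ge_inf => //.
by exists 0 => l' /quotient_chain_foot; apply: le_trans; exact: enorm_ge0.
Qed.

Lemma quotient_dist_foot x y : phase_space K x -> phase_space K y ->
  enorm (x.1 - y.1) <= quotient_dist K x y.
Proof.
move=> px py; have [ne _] := has_inf_quotient_chain px py.
apply: lb_le_inf => // l; exact: quotient_chain_foot.
Qed.

Lemma quotient_dist_ge0 x y : phase_space K x -> phase_space K y ->
  0 <= quotient_dist K x y.
Proof.
by move=> px py; apply: le_trans (quotient_dist_foot px py); exact: enorm_ge0.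
Qed.

Lemma quotient_dist_reverse x y : phase_space K x -> phase_space K y ->
  quotient_dist K (reverse_state (K := K) x) (reverse_state (K := K) y) <=
  quotient_dist K x y.
Proof.
move=> px py; have [ne _] := has_inf_quotient_chain px py.
by apply: lb_le_inf => // l /(quotient_chain_reverse px py)/quotient_dist_le.
Qed.

End Quotient_distance.

Section Table.
Context {R : realType} {n k0 : nat} {Kc : 'I_k0 -> set 'rV[R]_n}.
Hypothesis convex_Kc : forall i, strictly_convex_domain (Kc i).
Hypothesis disjoint_Kc : forall i j, i != j -> Kc i `&` Kc j = set0.
Local Notation K := (\bigcup_i Kc i).

Lemma closed_component i : closed (Kc i).
Proof.
have [_ cK _ _ _] := convex_Kc i.
by apply: compact_closed cK; exact: norm_hausdorff.
Qed.

Lemma closed_table : closed K.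
Proof. by apply: closed_bigcup => [|i _]; [exact: finite_finset | exact: closed_component]. Qed.

Lemma open_near_component i q : Kc i q ->
  exists V, [/\ open V, V q & forall x, V x -> K x <-> Kc i x].
Proof.
move=> Kq; exists (~` \bigcup_(j in [set j | j != i]) Kc j); split.
- by apply: closed_openC; apply: closed_bigcup => [|j _];
    [exact: finite_finset | exact: closed_component].
- by move=> [j /= ji Kjq]; have := disjoint_Kc ji; rewrite -subset0 => /(_ q); exact.
- move=> x nx; split=> [[j _ Kjx]|Kix]; last by exists i.
  have [<-//|ji] := eqVneq j i.
  by exfalso; apply: nx; exists j.
Qed.

Lemma chart_of_component i q U f : boundary_chart (Kc i) q U f ->
  exists V, boundary_chart K q V f.
Proof.
move=> ch; have Kq : Kc i q by exact: chart_mem ch.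
have [V [oV Vq VK]] := open_near_component Kq; exists (U `&` V).
by apply: (boundary_chart_near oV Vq _ ch) => x /VK [? ?]; split.
Qed.

Lemma chart_of_table i q U f : Kc i q -> boundary_chart K q U f ->
  exists V, boundary_chart (Kc i) q V f.
Proof.
move=> Kq ch; have [V [oV Vq VK]] := open_near_component Kq; exists (U `&` V).
exact: (boundary_chart_near oV Vq VK ch).
Qed.

Lemma outward_normal_component i q nu : Kc i q -> outward_normal K q nu ->
  outward_normal (Kc i) q nu.
Proof.
by move=> Kq [U [f [/(chart_of_table Kq)[V ch] ->]]]; exists V, f.
Qed.

Lemma table_support i q p nu : Kc i q -> Kc i p -> outward_normal K q nu ->
  dot (p - q) nu <= 0.
Proof.
move=> Kq Kp /(outward_normal_component Kq) [U [f [ch ->]]].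
have [_ _ cK _ _] := convex_Kc i.
by rewrite dotZr mulr_ge0_le0 ?invr_ge0 ?enorm_ge0 // (chart_support ch).
Qed.

Lemma normal_of_support i q m nu : Kc i q -> outward_normal K q nu ->
  enorm m = 1 -> (forall p, Kc i p -> dot (p - q) m <= 0) -> m = nu.
Proof.
move=> Kq /(outward_normal_component Kq) [U [f [ch ->]]].
by move=> m1; apply: (unit_normal_unique ch).
Qed.

Lemma table_normal_unique q nu nu' :
  outward_normal K q nu -> outward_normal K q nu' -> nu = nu'.
Proof.
move=> qnu qnu'; have [i _ Kq] := bdry_mem closed_table (outward_normal_bdry qnu).
apply: (normal_of_support Kq qnu' (enorm_outward_normal qnu)) => p Kp.
exact: (table_support Kq Kp qnu).
Qed.

Lemma incoming_inward g t nu : billiard_trajectory K g ->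
  outward_normal K (g t).1 nu -> dot (incoming (K := K) (g t)) nu <= 0.
Proof.
move=> tg tnu; rewrite leNgt; apply/negP => unu.
have [U [f [ch nuE]]] := tnu.
have : dot (- incoming (K := K) (g t)) (grad f (g t).1) < 0.
  have g0 : 0 < enorm (grad f (g t).1) by rewrite enorm_gt0; case: ch.
  have -> : grad f (g t).1 = enorm (grad f (g t).1) *: nu.
    by rewrite nuE scalerA mulfV ?scale1r // gt_eqF.
  by rewrite dotZr dotNl pmulr_rlt0 // oppr_lt0.
move=> /(chart_inward ch) inw.
have gt := trajectory_left table_normal_unique (tg t).
have inw' : \forall s \near t^'-, interior K ((g t).1 + (s - t) *: incoming (K := K) (g t)).
  have : \forall s \near 0^'+, interior K ((g t).1 + s *: - incoming (K := K) (g t)) by exact: inw.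
  rewrite -{1}(subrr t) => /near_reverse; apply: filterS => s.
  by rewrite scalerN -scaleNr opprB.
have [s [E]] := @filter_ex _ (at_left t) _ _ (filterI gt inw').
have [[ext _] _ _] := tg s; move: ext; rewrite E /exterior closure_setC /=.
by apply.
Qed.

(* The pairing of the bounces of [g] with those of [h] is encoded by [theta],
   which is constant equal to [beta k] on the window around [ctr k] and the
   identity elsewhere.  Along [g] the quantity
   [<v, h (theta t) - x> - (theta t - t)] does not increase: between bounces
   because [h] has speed 1, at bounces because the component hit by [g] lies
   behind its tangent hyperplane. *)
Lemma trajectory_compare (I : Type) (g h : R -> phase R n) (T0 w : R)
    (ctr beta : I -> R) :
  billiard_trajectory K g -> billiard_trajectory K h ->
  (forall k l, k = l \/ 2 * w < `|ctr k - ctr l|) ->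
  (forall k, `|beta k - ctr k| <= w) ->
  (forall t, t <= T0 -> bdry K (g t).1 -> exists k, `|t - ctr k| <= w /\
     exists i, Kc i (g t).1 /\ Kc i (h (beta k)).1) ->
  (forall k, w < `|T0 - ctr k|) ->
  (forall e, 0 < e -> exists T, [/\ T <= T0, forall k, w < `|T - ctr k|
     & enorm ((h T).1 - (g T).1) <= e]) ->
  dot (g T0).2 ((h T0).1 - (g T0).1) <= 0.
Proof.
move=> tg th sep betaP bounceP T0P TP.
have /choice [theta thetaP] : forall t, exists s,
    (exists k, `|t - ctr k| <= w /\ s = beta k) \/
    ((forall k, w < `|t - ctr k|) /\ s = t).
  move=> t; have [[k tk]|H] := pselect (exists k, `|t - ctr k| <= w).
    by exists (beta k); left; exists k.
  exists t; right; split => // k; rewrite ltNge; apply/negP => tk.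
  by apply: H; exists k.
have theta_mono s t : s <= t -> theta s <= theta t.
  move=> st; have [[k [sk ->]]|[sP ->]] := thetaP s;
    have [[l [tl ->]]|[tP ->]] := thetaP t => //.
  - have := betaP k; have := betaP l; have [->//|] := sep k l.
    move: sk tl; rewrite !ler_norml ltr_normr => /andP[? ?] /andP[? ?].
    by move=> /orP[] ? /andP[? ?] /andP[? ?]; lra.
  - have := betaP k; have := tP k; move: sk.
    by rewrite !ler_norml ltr_normr => /andP[? ?] /orP[] ? /andP[? ?]; lra.
  - have := betaP l; have := sP l; move: tl.
    by rewrite !ler_norml ltr_normr => /andP[? ?] /orP[] ? /andP[? ?]; lra.
have theta_out t : (forall k, w < `|t - ctr k|) -> theta t = t.
  by move=> tP; have [[k [tk _]]|[]//] := thetaP t; move: (tP k); rewrite ltNge tk.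
pose G t := dot (g t).2 ((h (theta t)).1 - (g t).1) - (theta t - t).
have speed (u : 'rV[R]_n) s t : enorm u = 1 -> s <= t ->
    dot u ((h (theta t)).1 - (h (theta s)).1) <= theta t - theta s.
  move=> u1 /theta_mono st; apply: le_trans (ler_dot _ _) _; rewrite u1 mul1r.
  by apply: (trajectory_lipschitz table_normal_unique) => // r _ _; exact: th.
have G_nincr T : T <= T0 -> G T0 <= G T.
  move=> TT0; apply: (local_to_global (rel := fun s t => G t <= G s)) => //.
  - by move=> r s t rs st; exact: le_trans rs.
  - move=> t _ tT0; have [[_ v1] _ _] := tg t.
    have gt := trajectory_left table_normal_unique (tg t).
    set u := incoming (K := K) (g t).
    have u1 : enorm u = 1 by rewrite enorm_incoming.
    have jump : dot ((g t).2 - u) ((h (theta t)).1 - (g t).1) <= 0.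
      have [bt|nb] := pselect (bdry K (g t).1); last first.
        by rewrite /u incoming_free // subrr dot0l.
      have [k [tk [i [Kg Kh]]]] := bounceP t tT0 bt.
      have thk : theta t = beta k.
        have [[l [tl ->]]|[/(_ k)]] := thetaP t; last by rewrite ltNge tk.
        have [->//|] := sep l k; move: tk tl; rewrite !ler_norml ltr_normr.
        by move=> /andP[? ?] /andP[? ?] /orP[] ?; lra.
      have [_ _ /(_ bt) [nu [_ [tnu _ _ _]]]] := tg t.
      have nu1 := enorm_outward_normal tnu.
      have unu : dot u nu <= 0 by exact: incoming_inward.
      have hnu : dot ((h (theta t)).1 - (g t).1) nu <= 0.
        by rewrite thk; exact: table_support Kg Kh tnu.
      have -> : (g t).2 - u = - (2 * dot u nu) *: nu.
        have -> : (g t).2 = reflect_vec nu u.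
          by rewrite /u (incoming_bdry table_normal_unique tnu) reflect_vecK.
        by rewrite /reflect_vec addrAC subrr add0r scaleNr.
      by rewrite dotZl [dot nu _]dotC; nra.
    near=> s => _; have st : s < t by near: s; exact: nbhs_left_lt.
    have gs : g s = free_motion ((g t).1, u) (s - t) by near: s.
    rewrite /G gs /= !dotBr dotDr dotZr (dot_enorm1 u1).
    have := speed u s t u1 (ltW st); move: jump; rewrite dotBl !dotBr; lra.
  - move=> t _ _; have [[_ v1] _ _] := tg t.
    have gt := trajectory_right (tg t).
    near=> s => _; have st : t < s by near: s; exact: nbhs_right_gt.
    have gs : g s = free_motion (g t) (s - t) by near: s.
    rewrite /G gs /= !dotBr dotDr dotZr (dot_enorm1 v1).
    have := speed _ t s v1 (ltW st); rewrite !dotBr; lra.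
have -> : dot (g T0).2 ((h T0).1 - (g T0).1) = G T0.
  by rewrite /G theta_out // subrr subr0.
apply/ler_addgt0Pl => e /TP [T [TT0 Tout hg]]; rewrite addr0.
apply: le_trans (G_nincr T TT0) _; rewrite /G theta_out // subrr subr0.
apply: le_trans (ler_dot _ _) _; have [[_ ->] _ _] := tg T.
by rewrite mul1r.
Unshelve. all: by end_near. Qed.

End Table.

Section Closest_points.
Context {R : realType} {n : nat}.
Implicit Types (A B : set 'rV[R]_n).

Lemma closest_pair A B : A !=set0 -> B !=set0 -> compact A -> compact B ->
  exists p q, [/\ A p, B q & forall p' q', A p' -> B q' ->
    enorm (q - p) <= enorm (q' - p')].
Proof.
move=> [a Aa] [b Bb] cA cB.
have AB0 : A `*` B !=set0 by exists (a, b).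
have cf : continuous (fun x : 'rV[R]_n * 'rV[R]_n => enorm (x.2 - x.1)).
  by move=> x; apply: cvg_enorm; apply: cvgB; [exact: cvg_snd | exact: cvg_fst].
have [[p q] /set_mem[/= Ap Bq] min] :=
  compact_EVT_min AB0 (compact_setX cA cB) (continuous_subspaceT cf).
exists p, q; split => // p' q' Ap' Bq'; exact: (min (p', q') (mem_set (conj Ap' Bq'))).
Qed.

Lemma convex_setP A p q t : @convex_set R 'rV[R]_n A -> A p -> A q ->
  0 <= t <= 1 -> A (q + t *: (p - q)).
Proof.
move=> cA Ap Aq /andP[t0 t1]; have := cA p q (Itv01 t0 t1).
rewrite !inE => /(_ Ap Aq); congr (A _).
by rewrite [LHS]/(t *: p + (1 - t) *: q) scalerBl scalerBr scale1r addrCA.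
Qed.

Lemma closest_point_support A q z : @convex_set R 'rV[R]_n A -> A q ->
  (forall p, A p -> enorm (z - q) <= enorm (z - p)) ->
  forall p, A p -> dot (p - q) (z - q) <= 0.
Proof.
move=> cA Aq minq p Ap; rewrite leNgt; apply/negP => pos.
set D := dot (p - q) (p - q); set s := dot (p - q) (z - q) in pos.
have D0 : 0 < D.
  by rewrite /D dot_gt0; apply: contraTneq pos => e; rewrite /s e dot0l ltxx.
pose t := Num.min 1 (s / D).
have t0 : 0 < t by rewrite lt_min ltr01 divr_gt0.
have tD : t * D <= s by rewrite -ler_pdivlMr // ge_min lexx orbT.
have t01 : 0 <= t <= 1 by rewrite ltW //= ge_min lexx.
have := minq _ (convex_setP cA Ap Aq t01).
rewrite -ler_sqr ?nnegrE ?enorm_ge0 // !sqr_enorm opprD addrA.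
have expand (a b : 'rV[R]_n) :
    dot (a - t *: b) (a - t *: b) = dot a a - 2 * t * dot b a + t * (t * dot b b).
  by rewrite dotBl !dotBr !dotZr !dotZl (dotC a b); ring.
rewrite expand -/s -/D; have : 0 < t * s by rewrite mulr_gt0.
have : t * (t * D) <= t * s by rewrite ler_pM2l.
lra.
Qed.

Lemma bdry_of_support A q m : A q -> m != 0 ->
  (forall p, A p -> dot (p - q) m <= 0) -> bdry A q.
Proof.
move=> Aq m0 sup; split; first exact: subset_closure.
move=> intA; have line : q + t *: m @[t --> (0 : R)^'+] --> q.
  rewrite -[X in _ --> X]addr0 -(scale0r m).
  apply: cvgD; first exact: cvg_cst.
  by apply: cvgZr_tmp; apply: cvg_at_right_filter; exact: cvg_id.
have At : \forall t \near (0 : R)^'+, A (q + t *: m) by apply: line.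
have t0 : \forall t \near (0 : R)^'+, 0 < t by exact: nbhs_right_gt.
have [t [/sup + t_gt0]] := @filter_ex _ (at_right 0) _ _ (filterI At t0).
by rewrite [q + _]addrC addrK dotZl pmulr_rle0 // leNgt dot_gt0 m0.
Qed.

End Closest_points.

Section Periodic_orbit.
Context {R : realType} {n k0 : nat} {Kc : 'I_k0 -> set 'rV[R]_n}.
Hypothesis convex_Kc : forall i, strictly_convex_domain (Kc i).
Hypothesis disjoint_Kc : forall i j, i != j -> Kc i `&` Kc j = set0.
Hypothesis no_eclipse : forall i j l, i != j -> l != i -> l != j ->
  convex_hull (Kc i `|` Kc j) `&` Kc l = set0.
Local Notation K := (\bigcup_i Kc i).

Context {i0 i1 : 'I_k0} {q0 q1 : 'rV[R]_n}.
Hypothesis i01 : i0 != i1.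
Hypothesis Kq0 : Kc i0 q0.
Hypothesis Kq1 : Kc i1 q1.
Hypothesis closest : forall p0 p1, Kc i0 p0 -> Kc i1 p1 ->
  enorm (q1 - q0) <= enorm (p1 - p0).

Let d := enorm (q1 - q0).
Let m := d^-1 *: (q1 - q0).

Lemma gap_gt0 : 0 < d.
Proof.
rewrite enorm_gt0 subr_eq0; apply/eqP => q01.
have := disjoint_Kc i01; rewrite -subset0 => /(_ q0); apply.
by split => //; rewrite -q01.
Qed.

Lemma enorm_axis : enorm m = 1.
Proof.
by rewrite enormZ gtr0_norm ?invr_gt0 ?gap_gt0 // mulVf // gt_eqF // gap_gt0.
Qed.

Lemma axisE : q1 = q0 + d *: m.
Proof. by rewrite scalerA mulfV ?gt_eqF ?gap_gt0 // scale1r addrC subrK. Qed.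

Lemma support0 p : Kc i0 p -> dot (p - q0) m <= 0.
Proof.
move=> Kp; rewrite dotZr mulr_ge0_le0 ?invr_ge0 ?enorm_ge0 //.
have [_ _ cK _ _] := convex_Kc i0.
by apply: closest_point_support Kp => // p' Kp'; exact: closest.
Qed.

Lemma support1 p : Kc i1 p -> dot (p - q1) (- m) <= 0.
Proof.
move=> Kp; rewrite -scalerN opprB dotZr mulr_ge0_le0 ?invr_ge0 ?enorm_ge0 //.
have [_ _ cK _ _] := convex_Kc i1.
apply: closest_point_support Kp => // p' Kp'; rewrite 2!(enormBC q0); exact: closest.
Qed.

Lemma outward_normal_of_support i q u : Kc i q -> enorm u = 1 ->
  (forall p, Kc i p -> dot (p - q) u <= 0) -> outward_normal K q u.
Proof.
move=> Kq u1 sup; have [_ _ _ C2K _] := convex_Kc i.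
have u0 : u != 0 by rewrite -enorm_gt0 u1 ltr01.
have [U [f ch]] := C2K _ (bdry_of_support Kq u0 sup).
have [V chK] := chart_of_component convex_Kc disjoint_Kc ch.
by exists V, f; split => //; exact: unit_normal_unique ch _ u1 sup.
Qed.

Lemma outward_normal0 : outward_normal K q0 m.
Proof. exact: (outward_normal_of_support Kq0 enorm_axis support0). Qed.

Lemma outward_normal1 : outward_normal K q1 (- m).
Proof.
apply: (outward_normal_of_support Kq1); first by rewrite enormN enorm_axis.
exact: support1.
Qed.

Lemma segment_other l rho : l != i0 -> l != i1 -> 0 <= rho <= d ->
  ~ Kc l (q0 + rho *: m).
Proof.
move=> l0 l1 /andP[rho0 rhod] Kl.
have := no_eclipse i01 l0 l1; rewrite -subset0; apply; split; last exact: Kl.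
move=> B [cB sB].
have -> : q0 + rho *: m = q0 + (rho / d) *: (q1 - q0) by rewrite scalerA.
apply: convex_setP => //; [by apply: sB; right | by apply: sB; left |].
by rewrite divr_ge0 ?enorm_ge0 //= ler_pdivrMr ?gap_gt0 // mul1r.
Qed.

Lemma segment_free rho : 0 < rho < d -> ~ K (q0 + rho *: m).
Proof.
move=> /andP[rho0 rhod] [l _ Kl]; have m1 := dot_enorm1 enorm_axis.
have [l0|l0] := eqVneq l i0.
  move: Kl; rewrite l0 => /support0.
  by rewrite [q0 + _]addrC addrK dotZl m1 mulr1 leNgt rho0.
have [l1|l1] := eqVneq l i1.
  move: Kl; rewrite l1 => /support1.
  by rewrite axisE opprD addrACA subrr add0r dotBl !dotNr !(dotZl _ m) m1; lra.
by apply: segment_other Kl => //; rewrite !ltW.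
Qed.

Definition zigzag (t : R) : phase R n :=
  let r := t - (Num.floor (t / (2 * d)))%:~R * (2 * d) in
  if r < d then (q0 + r *: m, m) else (q0 + (2 * d - r) *: m, - m).

Definition bounce_time (k : int * bool) : R :=
  k.1%:~R * (2 * d) + (if k.2 then d else 0).

Definition bounce_component (k : int * bool) := if k.2 then i1 else i0.

Lemma floor_period t (k : int) : k%:~R * (2 * d) <= t -> t < k%:~R * (2 * d) + 2 * d ->
  Num.floor (t / (2 * d)) = k.
Proof.
have d2 : 0 < 2 * d by rewrite mulr_gt0 // gap_gt0.
move=> h1 h2; apply: floor_def.
by rewrite ler_pdivlMr // h1 ltr_pdivrMr // intrD mulrDl mul1r.
Qed.

Lemma zigzag_up t (k : int) : bounce_time (k, false) <= t -> t < bounce_time (k, true) ->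
  zigzag t = (q0 + (t - bounce_time (k, false)) *: m, m).
Proof.
have d0 := gap_gt0; rewrite /bounce_time /= addr0 => h1 h2.
rewrite /zigzag (floor_period h1) ?ifT //; lra.
Qed.

Lemma zigzag_down t (k : int) : bounce_time (k, true) <= t ->
  t < bounce_time (k + 1, false) ->
  zigzag t = (q0 + (bounce_time (k + 1, false) - t) *: m, - m).
Proof.
have d0 := gap_gt0; rewrite /bounce_time /= addr0 intrD mulrDl mul1r => h1 h2.
have fl : Num.floor (t / (2 * d)) = k by apply: floor_period; lra.
have -> : zigzag t = if t - k%:~R * (2 * d) < d then
    (q0 + (t - k%:~R * (2 * d)) *: m, m)
  else (q0 + (2 * d - (t - k%:~R * (2 * d))) *: m, - m) by rewrite /zigzag fl.
rewrite ltNge ifF; first by congr (_ + _ *: _, _); lra.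
by apply/negbF; lra.
Qed.

Lemma bounce_timeS (k : int) :
  (bounce_time (k, true) = bounce_time (k, false) + d) *
  (bounce_time (k + 1, false) = bounce_time (k, true) + d).
Proof. by rewrite /bounce_time /= intrD; split; lra. Qed.

Lemma zigzag_cases t : exists k,
  [\/ t = bounce_time (k, false), bounce_time (k, false) < t < bounce_time (k, true),
      t = bounce_time (k, true) |
      bounce_time (k, true) < t < bounce_time (k + 1, false)].
Proof.
have d0 := gap_gt0; exists (Num.floor (t / (2 * d))); set k := Num.floor _.
have /andP[] := floor_itv (t / (2 * d)); rewrite -/k.
have d2 : 0 < 2 * d by rewrite mulr_gt0.
rewrite ler_pdivlMr // ltr_pdivrMr // intrD mulrDl mul1r => h1 h2.
rewrite !bounce_timeS /bounce_time /= addr0.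
have [e|e|e] := ltgtP t (k%:~R * (2 * d)); last by apply: Or41.
  by exfalso; lra.
have [e'|e'|e'] := ltgtP t (k%:~R * (2 * d) + d); last by apply: Or43.
  by apply: Or42.
by apply: Or44; apply/andP; split => //; lra.
Qed.

Lemma bounce_time_sep k l : k = l \/ d <= `|bounce_time k - bounce_time l|.
Proof.
have d0 := gap_gt0; case: k l => [k b] [l c].
have int_sep (x y : int) (b' c' : bool) : x < y ->
    bounce_time (x, b') + d <= bounce_time (y, c').
  rewrite -lezD1 -(ler_int R) intrD => xy.
  have : 0 <= (y%:~R - x%:~R - 1) * d by apply: mulr_ge0; [lra | exact: ltW].
  rewrite /bounce_time /=; case: b'; case: c' => /=; lra.
have [kl|kl|<-] := ltgtP k l.
- by right; have := int_sep _ _ b c kl; rewrite ler_normr => h; apply/orP; right; lra.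
- by right; have := int_sep _ _ c b kl; rewrite ler_normr => h; apply/orP; left; lra.
have [<-|] := eqVneq b c; first by left.
move=> bc; right; rewrite ler_normr /bounce_time /=.
by case: b c bc => [] [] // _; apply/orP; [left|right]; lra.
Qed.

Lemma zigzag_bounce k : zigzag (bounce_time k) =
  if k.2 then (q1, - m) else (q0, m).
Proof.
have d0 := gap_gt0; case: k => k [] /=.
  rewrite (zigzag_down (k := k)) ?bounce_timeS; [|lra|lra].
  by congr (_, _); rewrite [RHS]axisE; congr (_ + _ *: _); lra.
by rewrite (zigzag_up (k := k)) ?bounce_timeS ?subrr ?scale0r ?addr0 //; lra.
Qed.

Lemma bounce_component_zigzag k : Kc (bounce_component k) (zigzag (bounce_time k)).1.
Proof. by rewrite zigzag_bounce /bounce_component; case: k.2. Qed.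

Lemma exterior_free q : ~ K q -> exterior K q.
Proof. by move=> nK; apply: subset_closure. Qed.

Lemma exterior_bdry q : bdry K q -> exterior K q.
Proof. by move=> [_ nint]; rewrite /exterior closure_setC. Qed.

Lemma bdry_table q : bdry K q -> K q.
Proof. by apply: bdry_mem; exact: closed_table. Qed.

Lemma zigzag_trajectory : billiard_trajectory K zigzag.
Proof.
have d0 := gap_gt0; move=> t; have [k] := zigzag_cases t.
have free_near a b (x : R) : a < x < b -> \forall s \near x, a <= s /\ s < b.
  move=> /andP[ax xb]; near=> s; split.
    by apply/ltW; near: s; exact: lt_nbhsr.
  by near: s; exact: lt_nbhsl.
have near_left a (x : R) : a < x -> \forall s \near x^'-, a <= s /\ s < x.
  move=> ax; near=> s; split; first by apply/ltW; near: s; exact: nbhs_left_gt.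
  by near: s; exact: nbhs_left_lt.
have near_right b (x : R) : x < b -> \forall s \near x^'+, x <= s /\ s < b.
  move=> ax; near=> s; split; first by apply/ltW; near: s; exact: nbhs_right_gt.
  by near: s; exact: nbhs_right_lt.
have m1 := dot_enorm1 enorm_axis.
case=> [tE|tk|tE|tk].
- have b0 := outward_normal_bdry outward_normal0.
  have zt : zigzag t = (q0, m) by rewrite tE zigzag_bounce.
  rewrite zt; split => /=; first by split; [exact: exterior_bdry | exact: enorm_axis].
    by [].
  move=> _; exists m, (- m); split; first exact: outward_normal0.
  + rewrite /reflect_vec dotNl m1 mulrN1 -[LHS]add0r scaleNr opprK.
    by rewrite -[2]/(1 + 1) scalerDl scale1r addrA addNr.
  + have [E1 E2] := bounce_timeS (k - 1); rewrite subrK in E2.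
    apply: filterS (near_left (bounce_time (k - 1, true)) t _); last by lra.
    move=> s [s1 s2]; rewrite (zigzag_down (k := k - 1)) ?subrK -?tE //.
    by rewrite /free_motion /= scalerN -scaleNr opprB.
  + apply: filterS (near_right (bounce_time (k, true)) t _); last first.
      by rewrite bounce_timeS; lra.
    by move=> s [s1 s2]; rewrite (zigzag_up (k := k)) -?tE.
- have zt : zigzag t = (q0 + (t - bounce_time (k, false)) *: m, m).
    by case/andP: tk => h1 h2; apply: zigzag_up => //; exact: ltW.
  have nK : ~ K (zigzag t).1.
    rewrite zt; apply: segment_free; move: tk; rewrite bounce_timeS; lra.
  split.
  + by split; [exact: exterior_free | rewrite zt enorm_axis].
  + move=> _; apply: filterS (free_near _ _ _ tk) => s [s1 s2].
    rewrite (zigzag_up s1 s2) zt /free_motion /= -(addrA q0) -scalerDl.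
    by congr (_ + _ *: _, _); lra.
  + by move/bdry_table.
- have b1 := outward_normal_bdry outward_normal1.
  have zt : zigzag t = (q1, - m) by rewrite tE zigzag_bounce.
  rewrite zt; split => /=.
    by split; [exact: exterior_bdry | rewrite enormN enorm_axis].
    by [].
  move=> _; exists (- m), m; split; first exact: outward_normal1.
  + rewrite /reflect_vec dotNr m1 mulrN1 scalerN scaleNr opprK.
    by rewrite -[2]/(1 + 1) scalerDl scale1r opprD addrA subrr add0r.
  + apply: filterS (near_left (bounce_time (k, false)) t _); last first.
      by rewrite tE bounce_timeS; lra.
    move=> s [s1 s2]; rewrite (zigzag_up (k := k)) -?tE //.
    rewrite /free_motion /= axisE -(addrA q0) -scalerDl; congr (_ + _ *: _, _).
    by rewrite tE bounce_timeS; lra.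
  + apply: filterS (near_right (bounce_time (k + 1, false)) t _); last first.
      by rewrite bounce_timeS; lra.
    move=> s [s1 s2]; rewrite (zigzag_down (k := k)) -?tE //.
    rewrite /free_motion /= axisE scalerN -scaleNr -(addrA q0) -scalerDl.
    by congr (_ + _ *: _, _); rewrite tE !bounce_timeS; lra.
- have zt : zigzag t = (q0 + (bounce_time (k + 1, false) - t) *: m, - m).
    by case/andP: tk => h1 h2; apply: zigzag_down => //; exact: ltW.
  have nK : ~ K (zigzag t).1.
    rewrite zt; apply: segment_free; move: tk; rewrite !bounce_timeS; lra.
  split.
  + by split; [exact: exterior_free | rewrite zt enormN enorm_axis].
  + move=> _; apply: filterS (free_near _ _ _ tk) => s [s1 s2].
    rewrite (zigzag_down s1 s2) zt /free_motion /= scalerN -scaleNr -(addrA q0) -scalerDl.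
    by congr (_ + _ *: _, _); lra.
  + by move/bdry_table.
Unshelve. all: by end_near. Qed.

End Periodic_orbit.

Section Shadowing.
Context {R : realType} {n k0 : nat} {Kc : 'I_k0 -> set 'rV[R]_n}.
Hypothesis convex_Kc : forall i, strictly_convex_domain (Kc i).
Hypothesis disjoint_Kc : forall i j, i != j -> Kc i `&` Kc j = set0.
Hypothesis no_eclipse : forall i j l, i != j -> l != i -> l != j ->
  convex_hull (Kc i `|` Kc j) `&` Kc l = set0.
Local Notation K := (\bigcup_i Kc i).

Context {i0 i1 : 'I_k0} {q0 q1 : 'rV[R]_n}.
Hypothesis i01 : i0 != i1.
Hypothesis Kq0 : Kc i0 q0.
Hypothesis Kq1 : Kc i1 q1.
Hypothesis closest : forall p0 p1, Kc i0 p0 -> Kc i1 p1 ->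
  enorm (q1 - q0) <= enorm (p1 - p0).

Let d := enorm (q1 - q0).
Let m := d^-1 *: (q1 - q0).
Local Notation Z := (@zigzag R n q0 q1).
Local Notation bounce := (@bounce_time R n q0 q1).
Local Notation comp := (@bounce_component k0 i0 i1).

Let d_gt0 : 0 < d.
Proof. exact: (gap_gt0 disjoint_Kc i01 Kq0 Kq1). Qed.

Let m1 : enorm m = 1.
Proof. exact: (enorm_axis disjoint_Kc i01 Kq0 Kq1). Qed.

Let q1E : q1 = q0 + d *: m.
Proof. exact: (axisE disjoint_Kc i01 Kq0 Kq1). Qed.

Let Z_traj : billiard_trajectory K Z.
Proof. exact: (zigzag_trajectory convex_Kc disjoint_Kc no_eclipse i01). Qed.

Let bounceS (k : int) : (bounce (k, true) = bounce (k, false) + d) *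
  (bounce (k + 1, false) = bounce (k, true) + d).
Proof. exact: bounce_timeS. Qed.

Let Z_up t (k : int) : bounce (k, false) <= t -> t < bounce (k, true) ->
  Z t = (q0 + (t - bounce (k, false)) *: m, m).
Proof. exact: (zigzag_up disjoint_Kc i01 Kq0 Kq1). Qed.

Let Z_down t (k : int) : bounce (k, true) <= t -> t < bounce (k + 1, false) ->
  Z t = (q0 + (bounce (k + 1, false) - t) *: m, - m).
Proof. exact: (zigzag_down disjoint_Kc i01 Kq0 Kq1). Qed.

Let S0 p : Kc i0 p -> dot (p - q0) m <= 0.
Proof. exact: (support0 convex_Kc Kq0 Kq1 closest). Qed.

Let S1 p : Kc i1 p -> dot (p - q1) (- m) <= 0.
Proof. exact: (support1 convex_Kc Kq0 Kq1 closest). Qed.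

Let normals := table_normal_unique convex_Kc disjoint_Kc.

Lemma near_segment_far : \forall e \near (0 : R)^'+, forall l, l != i0 -> l != i1 ->
  forall rho p, 0 <= rho <= d -> Kc l p -> e < enorm (q0 + rho *: m - p).
Proof.
apply: filter_forall => l.
have [l0|l0] := eqVneq l i0; first by near=> e.
have [l1|l1] := eqVneq l i1; first by near=> e.
have [[a Ka] cK _ _ _] := convex_Kc l.
have seg0 : (`[0, d]%classic `*` Kc l) !=set0.
  by exists (0, a); split => //=; rewrite in_itv /= lexx ltW.
have cf : continuous (fun x : R * 'rV[R]_n => enorm (q0 + x.1 *: m - x.2)).
  move=> x; apply: cvg_enorm; apply: cvgB; last exact: cvg_snd.
  by apply: cvgD; [exact: cvg_cst | apply: cvgZr_tmp; exact: cvg_fst].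
have [[r0 p0] /set_mem[/= r0d Kp0] min] :=
  compact_EVT_min seg0 (compact_setX (@segment_compact _ 0 d) cK) (continuous_subspaceT cf).
have gap : 0 < enorm (q0 + r0 *: m - p0).
  rewrite enorm_gt0 subr_eq0; apply/eqP => E.
  apply: (segment_other disjoint_Kc no_eclipse i01 Kq0 Kq1 l0 l1 (rho := r0)).
    by move: r0d; rewrite in_itv.
  by rewrite -/d -/m E.
near=> e => _ _ rho p rhod Kp; apply: lt_le_trans (min (rho, p) _).
  by near: e; exact: nbhs_right_lt.
by apply/mem_set; split => //=; rewrite in_itv.
Unshelve. all: by end_near. Qed.

Lemma zigzag_segment t : exists rho, [/\ 0 <= rho <= d, (Z t).1 = q0 + rho *: m,
  forall e, rho <= e -> exists k, `|t - bounce (k, false)| <= e &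
  forall e, d - rho <= e -> exists k, `|t - bounce (k, true)| <= e].
Proof.
have d0 := d_gt0.
have up k : bounce (k, false) <= t -> t < bounce (k, true) -> exists rho,
  [/\ 0 <= rho <= d, (Z t).1 = q0 + rho *: m,
  forall e, rho <= e -> exists k, `|t - bounce (k, false)| <= e &
  forall e, d - rho <= e -> exists k, `|t - bounce (k, true)| <= e].
  move=> t1 t2; exists (t - bounce (k, false)); split.
  - by move: t2; rewrite bounceS; lra.
  - by rewrite (Z_up t1 t2).
  - by move=> e te; exists k; rewrite ger0_norm ?subr_ge0.
  - move=> e te; exists k; rewrite distrC ger0_norm ?subr_ge0 ?(ltW t2) //.
    by rewrite bounceS; lra.
have down k : bounce (k, true) <= t -> t < bounce (k + 1, false) -> exists rho,
  [/\ 0 <= rho <= d, (Z t).1 = q0 + rho *: m,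
  forall e, rho <= e -> exists k, `|t - bounce (k, false)| <= e &
  forall e, d - rho <= e -> exists k, `|t - bounce (k, true)| <= e].
  move=> t1 t2; exists (bounce (k + 1, false) - t); split.
  - by move: t2; rewrite bounceS; lra.
  - by rewrite (Z_down t1 t2).
  - by move=> e te; exists (k + 1); rewrite distrC ger0_norm ?subr_ge0 ?(ltW t2).
  - move=> e te; exists k; rewrite ger0_norm ?subr_ge0 //.
    by move: te; rewrite bounceS; lra.
have [k [tE|/andP[/ltW]|tE|/andP[/ltW]]] := zigzag_cases disjoint_Kc i01 Kq0 Kq1 t.
- have h1 : bounce (k, false) <= t by rewrite tE.
  by apply: (up k h1); rewrite bounceS tE ltrDl.
- exact: up.
- have h1 : bounce (k, true) <= t by rewrite tE.
  by apply: (down k h1); rewrite (bounceS k).2 tE ltrDl.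
- exact: down.
Qed.

Section Shadow.
Context {e T : R} {Y : R -> phase R n}.
Hypothesis e_gt0 : 0 < e.
Hypothesis e_small : 8 * e < d.
Hypothesis e_far : forall l, l != i0 -> l != i1 ->
  forall rho p, 0 <= rho <= d -> Kc l p -> e < enorm (q0 + rho *: m - p).
Hypothesis Y_traj : billiard_trajectory K Y.
Hypothesis Y_near : forall t, t <= T -> enorm ((Z t).1 - (Y t).1) <= e.

Lemma shadow_bounce t : t <= T -> bdry K (Y t).1 ->
  exists k, `|t - bounce k| <= e /\ Kc (comp k) (Y t).1.
Proof.
have d0 := d_gt0; have e0 := e_gt0.
move=> /Y_near near_t /(bdry_mem (closed_table convex_Kc)) [l _ Kl].
have [rho [rhod Zt low high]] := zigzag_segment t.
have mm := dot_enorm1 m1.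
have le_e u : enorm u = 1 -> dot ((Z t).1 - (Y t).1) u <= e.
  by move=> u1; apply: le_trans (ler_dot _ _) _; rewrite u1 mulr1.
have [l0|l0] := eqVneq l i0.
  have [|k tk] := low e; last by exists (k, false); split => //; rewrite /bounce_component /= -l0.
  have := S0 (p := (Y t).1); rewrite -l0 => /(_ Kl); have := le_e m m1.
  by rewrite Zt !dotBl dotDl (dotZl _ m) mm; lra.
have [l1|l1] := eqVneq l i1.
  have [|k tk] := high e; last by exists (k, true); split => //; rewrite /bounce_component /= -l1.
  have := S1 (p := (Y t).1); rewrite -l1 => /(_ Kl).
  have := le_e (- m); rewrite enormN => /(_ m1).
  by rewrite Zt q1E !dotBl !dotDl !dotNr !(dotZl _ m) mm; lra.
by move: near_t; rewrite leNgt Zt (e_far l0 l1 rhod Kl).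
Qed.

Lemma shadow_bounce_ex k : bounce k + 3 * e <= T ->
  exists b, `|b - bounce k| <= 3 * e /\ Kc (comp k) (Y b).1.
Proof.
have d0 := d_gt0; have e0 := e_gt0; have es := e_small.
move=> kT; set c := bounce k.
have [[b [bc bb]]|nob] :=
    pselect (exists b, `|b - c| <= 3 * e /\ bdry K (Y b).1).
  exists b; split => //; have bT : b <= T by move: bc; rewrite ler_norml -/c in kT *; lra.
  have [l [bl Kl]] := shadow_bounce bT bb.
  have [->//|] := bounce_time_sep disjoint_Kc i01 Kq0 Kq1 k l.
  rewrite -/d -/c; move: bc bl; rewrite !ler_norml ler_normr => /andP[_a_ _b_] /andP[_a1_ _b1_].
  by move=> /orP[] ?; exfalso; lra.
exfalso.
have straight a b : a <= b -> c - 3 * e <= a -> b <= c + 3 * e ->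
    (Y b).1 = (Y a).1 + (b - a) *: (Y a).2 /\ (Y b).2 = (Y a).2.
  move=> ab ca bc; have -> : Y b = free_motion (Y a) (b - a); last by [].
  apply: (trajectory_straight normals ab).
  move=> t ta tb; split; first exact: Y_traj.
  by move=> bt; apply: nob; exists t; split => //; rewrite ler_norml; lra.
have [Y1 V1] : (Y c).1 = (Y (c - 3 * e)).1 + (3 * e) *: (Y (c - 3 * e)).2 /\
    (Y c).2 = (Y (c - 3 * e)).2.
  have [|||-> ->] := straight (c - 3 * e) c; [lra|lra|lra|].
  by split => //; congr (_ + _ *: _); lra.
have [Y2 _] : (Y (c + 3 * e)).1 = (Y c).1 + (3 * e) *: (Y c).2 /\
    (Y (c + 3 * e)).2 = (Y c).2.
  have [|||-> ->] := straight c (c + 3 * e); [lra|lra|lra|].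
  by split => //; congr (_ + _ *: _); lra.
have [u [uu [Zm Zp]]] : exists u, dot u u = 1 /\
   ((Z (c - 3 * e)).1 = (Z c).1 + (3 * e) *: u /\
    (Z (c + 3 * e)).1 = (Z c).1 + (3 * e) *: u).
  have mm := dot_enorm1 m1.
  rewrite {2 4}/c (zigzag_bounce disjoint_Kc i01 Kq0 Kq1) -/d -/m /c.
  case: k @c kT nob straight Y1 V1 Y2 => k [] c kT nob straight Y1 V1 Y2 /=.
    exists (- m); rewrite dotNl dotNr opprK mm; split => //; split.
      rewrite (Z_up (k := k)) /=; [|rewrite /c ?bounceS; lra|rewrite /c ?bounceS; lra].
      by rewrite /c ?bounceS q1E scalerN -scaleNr -(addrA q0) -scalerDl; congr (_ + _ *: _); lra.
    rewrite (Z_down (k := k)) /=; [|rewrite /c ?bounceS; lra|rewrite /c ?bounceS; lra].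
    by rewrite /c ?bounceS q1E scalerN -scaleNr -(addrA q0) -scalerDl; congr (_ + _ *: _); lra.
  have E := bounceS (k - 1); rewrite subrK in E.
  exists m; split => //; split.
    rewrite (Z_down (k := k - 1)) ?subrK /=; [|rewrite /c ?E; lra|rewrite /c ?E; lra].
    by rewrite /c; congr (_ + _ *: _); lra.
  rewrite (Z_up (k := k)) /=; [|rewrite /c ?bounceS; lra|rewrite /c ?bounceS; lra].
  by rewrite /c; congr (_ + _ *: _); lra.
have bound t v : t <= T -> dot v v = 1 -> dot ((Z t).1 - (Y t).1) v <= e.
  move=> /Y_near tT /enorm_dot1 v1; apply: le_trans (ler_dot _ _) _.
  by rewrite v1 mulr1.
have := bound (c - 3 * e) u; have := bound (c + 3 * e) u; have := bound c (- u).
rewrite dotNl !dotNr opprK uu Y2 Y1 V1 Zm Zp !dotBl !dotDl !dotZl uu.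
move=> B1 B2 B3; have := B1 _ erefl; have := B2 _ erefl; have := B3 _ erefl.
by move: kT; rewrite -/c; lra.
Qed.

End Shadow.

Lemma shadow_compare e T Y : 0 < e -> 8 * e < d ->
  (forall l, l != i0 -> l != i1 ->
   forall rho p, 0 <= rho <= d -> Kc l p -> e < enorm (q0 + rho *: m - p)) ->
  billiard_trajectory K Y ->
  (forall t, t <= T -> enorm ((Z t).1 - (Y t).1) <= e) ->
  (forall k, 3 * e < `|T - bounce k|) ->
  (forall c, 0 < c -> exists M, forall t, t < M ->
     enorm ((Z t).1 - (Y t).1) <= c) ->
  dot (Y T).2 ((Z T).1 - (Y T).1) <= 0 /\
  dot (Z T).2 ((Y T).1 - (Z T).1) <= 0.
Proof.
move=> e0 es e_far Y_traj Y_near out asym.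
have d0 := d_gt0.
have sep k l : k = l \/ 2 * (3 * e) < `|bounce k - bounce l|.
  have [|h] := bounce_time_sep disjoint_Kc i01 Kq0 Kq1 k l; first by left.
  by right; move: h; rewrite -/d; lra.
have far c : 0 < c -> exists T', [/\ T' <= T, forall k, 3 * e < `|T' - bounce k|
    & enorm ((Z T').1 - (Y T').1) <= c].
  move=> /asym [M hM].
  pose k := Num.floor (Num.min M T / (2 * d)) - 1; pose T' := bounce (k, false) + d / 2.
  have T'lt : T' < Num.min M T.
    have : (Num.floor (Num.min M T / (2 * d)))%:~R <= Num.min M T / (2 * d).
      by have /andP[] := floor_itv (Num.min M T / (2 * d)).
    rewrite ler_pdivlMr ?mulr_gt0 // /T' /bounce_time /= -/d intrD mulrDl; lra.
  exists T'; split.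
  - by apply/ltW/(lt_le_trans T'lt); rewrite ge_min lexx orbT.
  - move=> l; have [<-|] := bounce_time_sep disjoint_Kc i01 Kq0 Kq1 (k, false) l.
      by rewrite /T' addrC addKr gtr0_norm; lra.
    by rewrite -/d /T' !ler_normr ltr_normr => /orP[] h; apply/orP; [left|right]; lra.
  - by apply: hM; apply: (lt_le_trans T'lt); rewrite ge_min lexx.
split.
  apply: (trajectory_compare convex_Kc disjoint_Kc (beta := bounce) Y_traj Z_traj sep) => //.
  - by move=> k; rewrite subrr normr0; lra.
  - move=> t tT bt; have [k [tk Kk]] := shadow_bounce e0 e_far Y_near tT bt.
    exists k; split; first by lra.
    by exists (comp k); split => //; exact: (bounce_component_zigzag disjoint_Kc i01).
have /choice[beta betaP] : forall k, exists b, `|b - bounce k| <= 3 * e /\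
    (bounce k <= T -> Kc (comp k) (Y b).1).
  move=> k; have [kT|kT] := leP (bounce k) T; last first.
    by exists (bounce k); rewrite subrr normr0; split; lra.
  have kT' : bounce k + 3 * e <= T.
    by move: (out k); rewrite ger0_norm ?subr_ge0 //; lra.
  by have [b [bk Kb]] := shadow_bounce_ex e0 es e_far Y_traj Y_near kT'; exists b.
have Z_near t : t <= T -> enorm ((Z t).1 - (Z t).1) <= e.
  by move=> _; rewrite subrr enorm0 ltW.
apply: (trajectory_compare convex_Kc disjoint_Kc (beta := beta) Z_traj Y_traj sep) => //.
- by move=> k; have [] := betaP k.
- move=> t tT bt; have [k [tk Kk]] := shadow_bounce e0 e_far Z_near tT bt.
  exists k; split; first by lra.
  exists (comp k); split => //; have [_] := betaP k; apply.
  move: tk (out k); rewrite ler_norml ltr_normr => /andP[? ?] /orP[] ?; lra.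
- by move=> c /far [T' [h1 h2 h3]]; exists T'; split => //; rewrite enormBC.
Qed.

End Shadowing.

Section Scale_dot.
Context {R : realType}.

Lemma scale_is_bilinear (V : normedModType R) :
  bilinear_for (GRing.Scale.Law.clone _ _ *:%R _)
    (GRing.Scale.Law.clone _ _ *:%R _) (@GRing.scale R V : R^o -> V -> V).
Proof.
split=> [u'|u] a x y /=; first by rewrite scalerDl scalerA.
by rewrite scalerDr !scalerA mulrC.
Qed.

HB.instance Definition _ (V : normedModType R) :=
  bilinear_isBilinear.Build R R^o V V _ _ (@GRing.scale R V)
    (scale_is_bilinear V).

Lemma C1_onZ (V W : normedModType R) (A : set V) (k : V -> R^o) (f : V -> W) :
  open A -> C1_on A k -> C1_on A f -> C1_on A (fun x => k x *: f x).
Proof.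
move=> oA Ak Af.
by apply: (C1_on_bilin (b := @GRing.scale R W : {bilinear R^o -> W -> W}) oA) => //;
  exact: scale_continuous.
Qed.

Lemma is_diffZf (V W : normedModType R) (k dk : V -> R^o) (f df : V -> W) x :
  is_diff x k dk -> is_diff x f df ->
  is_diff x (fun y => k y *: f y) (fun v => k x *: df v + dk v *: f x).
Proof.
by apply: (is_diff_bilin (b := @GRing.scale R W : {bilinear R^o -> W -> W}));
  exact: scale_continuous.
Qed.

Lemma C1_on_dot (V : normedModType R) n (A : set V) (f g : V -> 'rV[R]_n) :
  open A -> C1_on A f -> C1_on A g -> C1_on A (fun x => dot (f x) (g x) : R^o).
Proof.
move=> oA Af Ag.
by apply: (C1_on_bilin (b := @dot R n : {bilinear 'rV[R]_n -> 'rV[R]_n -> R^o}) oA) => //;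
  exact: dot_continuous.
Qed.

Lemma is_diff_dot (V : normedModType R) n (f df g dg : V -> 'rV[R]_n) x :
  is_diff x f df -> is_diff x g dg ->
  is_diff x (fun y => dot (f y) (g y) : R^o)
    (fun v => dot (f x) (dg v) + dot (df v) (g x)).
Proof.
by apply: (is_diff_bilin (b := @dot R n : {bilinear 'rV[R]_n -> 'rV[R]_n -> R^o}));
  exact: dot_continuous.
Qed.

Lemma C1_on_sqrt : C1_on [set x : R^o | 0 < x] (Num.sqrt : R^o -> R^o).
Proof.
have pos_open : open [set x : R^o | 0 < x] by exact: open_gt.
apply: (C1_on_diff (df := fun x v : R^o => v *: ((2 * Num.sqrt x)^-1 : R^o))) => // [x /= x0|x v /= x0].
  have xd := is_derive1_sqrt x0; have sd : derivable Num.sqrt x 1 by exact: ex_derive.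
  split; first exact/derivable1_diffP.
  by rewrite deriv1E // derive1E derive_sqrt.
apply: cvgZ; first exact: cvg_cst.
apply: cvgV; first by rewrite mulf_neq0 // gt_eqF // sqrtr_gt0.
by apply: cvgM; [exact: cvg_cst | exact: sqrt_continuous].
Qed.

Lemma C1_on_grad n (A : set 'rV[R]_n) (f : 'rV[R]_n -> R^o) : open A ->
  C2_on A f -> C1_on A (grad f).
Proof.
move=> oA [_ C2f].
pose F i x : 'rV[R]_n := ('d f x (delta_mx 0 i) : R^o) *: delta_mx 0 i.
have FC1 i : C1_on A (F i) by apply: C1_onZ => //; exact: C1_on_cst.
have -> : grad f = fun x => \sum_(i < n) F i x.
  apply/funext => x; rewrite [LHS]row_sum_delta.
  by apply: eq_bigr => i _; rewrite mxE.
elim: (index_enum 'I_n) => [|i r IH].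
  rewrite (_ : (fun x => _) = cst 0); first exact: C1_on_cst.
  by apply/funext => x; rewrite big_nil.
rewrite (_ : (fun x => _) = fun x => F i x + \sum_(j <- r) F j x).
  refine (C1_onD oA (FC1 i) IH).
by apply/funext => x; rewrite big_cons.
Qed.

Lemma C1_on_unit_normal n (A : set 'rV[R]_n) (f : 'rV[R]_n -> R^o) : open A ->
  (forall x, A x -> grad f x != 0) -> C2_on A f -> C1_on A (unit_normal f).
Proof.
move=> oA g0 C2f; have C1g := C1_on_grad oA C2f.
apply: C1_onZ => //; apply: C1_onV => // [x Ax|]; first by rewrite enorm_eq0 g0.
apply: (C1_on_comp (U := R^o) (B := [set x : R^o | 0 < x])
  (f := fun x => dot (grad f x) (grad f x) : R^o)) => //.
- by exists 1%N, (fun=> 1), (fun _ u => u); split => [_|u];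
    [move=> x; exact: cvg_id | rewrite big_ord1 [RHS]mulr1].
- by move=> x Ax /=; rewrite dot_gt0 g0.
- exact: C1_on_dot.
- exact: C1_on_sqrt.
Qed.

End Scale_dot.

Section Collision.
Context {R : realType} {n : nat} {K U : set 'rV[R]_n} {q nu : 'rV[R]_n}
  {f : 'rV[R]_n -> R^o} {r tau delta : R}.
Hypothesis chart : boundary_chart K q U f.
Hypothesis nuE : nu = unit_normal f q.
Hypothesis transverse : forall x v, `|x - q| < r -> `|v - nu| < r ->
  U x /\ 0 < dot v (grad f x).
Hypothesis tau_gt0 : 0 < tau.
Hypothesis delta_gt0 : 0 < delta.
Hypothesis delta_lt : delta + 4 * tau + 3 * tau * delta < r.

Let nu1 : enorm nu = 1.
Proof. by rewrite nuE; exact: enorm_unit_normal chart. Qed.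

Let C1f : C1_on U f.
Proof. by have [_ _ [] ] := chart. Qed.

Definition ray (y : phase R n) (s : R) : 'rV[R]_n := y.1 - s *: y.2.

Definition near_base : set (phase R n) :=
  [set y | `|y.1 - (q + tau *: nu)| < delta /\ `|y.2 - nu| < delta].

Lemma delta_lt_r : delta < r.
Proof.
have t0 := tau_gt0; have d0 := delta_gt0; have dl := delta_lt.
by have : 0 < tau * delta by [rewrite mulr_gt0]; lra.
Qed.

Lemma ray_near y s : near_base y -> `|s| <= 3 * tau -> `|ray y s - q| < r.
Proof.
move=> [y1 y2] s3; have t0 := tau_gt0; have dl := delta_lt.
have -> : ray y s - q = (y.1 - (q + tau *: nu)) + (tau - s) *: nu - s *: (y.2 - nu).
  by apply/rowP => i; rewrite !mxE; ring.
apply: le_lt_trans (ler_normB _ _) _; apply: le_lt_trans (lerD (ler_normD _ _) (lexx _)) _.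
rewrite !normrZ.
have nule : `|nu| <= 1 by rewrite -nu1 ler_norm_enorm.
have h1 : `|tau - s| * `|nu| <= 4 * tau.
  rewrite -[leRHS]mulr1; apply: ler_pM => //.
  by apply: le_trans (ler_normB _ _) _; rewrite gtr0_norm //; lra.
have h2 : `|s| * `|y.2 - nu| <= 3 * tau * delta by apply: ler_pM => //; exact: ltW.
lra.
Qed.

Lemma ray_transverse y s : near_base y -> `|s| <= 3 * tau ->
  U (ray y s) /\ 0 < dot y.2 (grad f (ray y s)).
Proof.
move=> yb s3; apply: transverse; first exact: ray_near.
by case: yb => _ /lt_trans; apply; exact: delta_lt_r.
Qed.

Lemma is_diff_ray_time y s : is_diff (s : R^o) (ray y : R^o -> 'rV[R]_n) (fun t => - (t *: y.2)).
Proof.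
have zd : is_diff (s : R^o) (fun t : R^o => t *: y.2) (fun t => t *: y.2) by exact: is_diff_scalel.
have h := is_diffB (is_diff_cst y.1 (s : R^o)) zd.
refine (is_diff_eq h _); apply/funext => t; exact: sub0r.
Qed.

Lemma is_diff_f_ray y s : U (ray y s) ->
  is_diff (s : R^o) (f \o ray y : R^o -> R^o) (fun t => - (t * dot y.2 (grad f (ray y s)))).
Proof.
move=> /C1f [/differentiableP fd _].
refine (is_diff_eq (is_diff_comp (is_diff_ray_time y s) fd) _).
by apply/funext => t /=; rewrite diff_gradE dotNl dotZl.
Qed.

Lemma ray_continuous y s : U (ray y s) -> {for s, continuous (f \o ray y : R^o -> R^o)}.
Proof. by move=> /is_diff_f_ray [fd _]; exact: differentiable_continuous. Qed.

Lemma ray_decreasing y s t : near_base y -> - (3 * tau) <= s -> s < t -> t <= 3 * tau ->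
  f (ray y t) < f (ray y s).
Proof.
move=> yb ls st lt3.
have inb x : - (3 * tau) <= x <= 3 * tau -> U (ray y x) /\ 0 < dot y.2 (grad f (ray y x)).
  by move=> xb; apply: ray_transverse => //; rewrite ler_norml.
have fx x : x \in `]- (3 * tau), 3 * tau[ ->
    is_diff (x : R^o) (f \o ray y : R^o -> R^o) (fun t => - (t * dot y.2 (grad f (ray y x)))).
  rewrite in_itv /= => /andP[x1 x2].
  by have [|Ux _] := inb x; [rewrite !ltW | exact: is_diff_f_ray].
apply: (@ltr0_derive1_decr R (f \o ray y) (- (3 * tau)) (3 * tau)) => //.
- by move=> x /fx [fd _]; apply/derivable1_diffP.
- move=> x xb; have fd := fx x xb; rewrite derive1E' ?ex_diff // diff_val mul1r.
  rewrite oppr_lt0; move: xb; rewrite in_itv /= => /andP[x1 x2].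
  by have [|//] := inb x; rewrite !ltW.
- apply: continuous_in_subspaceT => x; rewrite inE /= in_itv /= => /inb [Ux _].
  exact: ray_continuous.
Qed.

Definition collision_domain : set (phase R n) :=
  near_base `&` [set y | 0 < f y.1 /\ f (ray y (2 * tau)) < 0].

Local Notation O := collision_domain.

Definition hit_time (y : phase R n) : R :=
  xget 0 [set s | 0 < s < 2 * tau /\ f (ray y s) = 0].

Lemma ray0 y : ray y 0 = y.1.
Proof. by rewrite /ray scale0r subr0. Qed.

Lemma hit_time_unique y s : near_base y -> 0 < s < 2 * tau -> f (ray y s) = 0 ->
  hit_time y = s.
Proof.
have t0 := tau_gt0; move=> yb sb fs; apply: xget_unique => // t [tb ft].
have [st|ts|//] := ltgtP t s.
  have := @ray_decreasing y t s yb; rewrite fs ft ltxx => h.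
  by exfalso; suff : false by []; apply: h; lra.
have := @ray_decreasing y s t yb; rewrite fs ft ltxx => h.
by exfalso; suff : false by []; apply: h; lra.
Qed.

Lemma hit_timeP y : O y -> 0 < hit_time y < 2 * tau /\ f (ray y (hit_time y)) = 0.
Proof.
have t0 := tau_gt0; move=> [yb [f0 f2]].
have t20 : 0 <= 2 * tau by lra.
have cont : {within `[0, 2 * tau], continuous (f \o ray y)}.
  apply: continuous_in_subspaceT => x; rewrite inE /= in_itv /= => xb.
  apply: ray_continuous; apply: (ray_transverse yb _).1; rewrite ler_norml; lra.
have [|s] := IVT t20 cont (v := 0).
  by rewrite /= ray0 ge_min le_max (ltW f0) (ltW f2) orbT.
rewrite in_itv /= => sb fs.
have s0 : s != 0 by apply: contraTneq f0 => s0; move: fs; rewrite /= s0 ray0 => ->; rewrite ltxx.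
have s2 : s != 2 * tau by apply: contraTneq f2 => s2; move: fs; rewrite /= s2 => ->; rewrite ltxx.
have sb' : 0 < s < 2 * tau by rewrite !lt_neqAle s2 eq_sym s0.
by rewrite (hit_time_unique yb sb' fs).
Qed.

Lemma open_near_base : open near_base.
Proof.
have -> : near_base = (fst @^-1` (ball (q + tau *: nu) delta)) `&` (snd @^-1` (ball nu delta)).
  apply/seteqP; split=> y; rewrite /near_base -!ball_normE /= => -[h1 h2]; split;
    by rewrite distrC.
apply: openI; apply: open_comp => //; try exact: ball_open.
  by move=> ? _; exact: cvg_fst.
by move=> ? _; exact: cvg_snd.
Qed.

Lemma cvg_ray y s : ray z s @[z --> y] --> ray y s.
Proof.
by apply: cvgB; [exact: cvg_fst | apply: cvgZl_tmp; exact: cvg_snd].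
Qed.

Lemma near_ray_sign y s (P : set R) : U (ray y s) -> nbhs (f (ray y s)) P ->
  \forall z \near y, P (f (ray z s)).
Proof.
move=> /C1f [/differentiable_continuous fc _] Pf.
have h : f (ray z s) @[z --> y] --> f (ray y s).
  by apply: (@cvg_comp _ _ _ (fun z => ray z s) f _ _ _ (cvg_ray (y := y) (s := s))); exact: fc.
exact: (h P Pf).
Qed.

Lemma open_collision_domain : open O.
Proof.
have t0 := tau_gt0; rewrite openE => y [yb [f0 f2]].
have [U0 _] : U (ray y 0) /\ 0 < dot y.2 (grad f (ray y 0)).
  by apply: ray_transverse => //; rewrite normr0; lra.
have [U2 _] : U (ray y (2 * tau)) /\ 0 < dot y.2 (grad f (ray y (2 * tau))).
  by apply: ray_transverse => //; rewrite gtr0_norm; lra.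
have n0 : \forall z \near y, 0 < f (ray z 0).
  by apply: (near_ray_sign (P := [set x | 0 < x])) => //; rewrite ray0; exact: lt_nbhsr.
have n2 : \forall z \near y, f (ray z (2 * tau)) < 0.
  by apply: (near_ray_sign (P := [set x | x < 0])) => //; exact: lt_nbhsl.
have nb := open_nbhs_nbhs (conj open_near_base yb).
apply: filterS (filterI nb (filterI n0 n2)) => z [zb [z0 z2]].
by move: z0; rewrite /= ray0 => z0; split => //; split.
Qed.

Lemma hit_time_between y a b : near_base y -> 0 <= a -> a < b -> b <= 2 * tau ->
  0 < f (ray y a) -> f (ray y b) < 0 -> O y /\ a < hit_time y < b.
Proof.
have t0 := tau_gt0; move=> yb a0 ab b2 fa fb.
have Oy : O y.
  split => //; split.
    move: a0; rewrite le_eqVlt => /predU1P[a0|a0]; first by move: fa; rewrite -a0 ray0.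
    rewrite -(ray0 y); apply: (lt_trans fa); apply: ray_decreasing => //; lra.
  move: b2; rewrite le_eqVlt => /predU1P[<-//|b2].
  apply: lt_trans fb; apply: ray_decreasing => //; lra.
split => //; have [rb fr] := hit_timeP Oy; apply/andP; split; rewrite ltNge; apply/negP.
  rewrite le_eqVlt => /predU1P[E|ra]; first by move: fa; rewrite -E fr ltxx.
  have : f (ray y a) < f (ray y (hit_time y)) by apply: ray_decreasing => //; lra.
  by rewrite fr ltNge (ltW fa).
rewrite le_eqVlt => /predU1P[E|rb']; first by move: fb; rewrite E fr ltxx.
have : f (ray y (hit_time y)) < f (ray y b) by apply: ray_decreasing => //; lra.
by rewrite fr ltNge (ltW fb).
Qed.

Lemma hit_time_continuous y : O y -> hit_time z @[z --> y] --> hit_time y.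
Proof.
have t0 := tau_gt0; move=> Oy; have [rb fr] := hit_timeP Oy; have yb := Oy.1.
apply/cvgrPdist_lt => e e0.
pose a := Num.max 0 (hit_time y - e); pose b := Num.min (2 * tau) (hit_time y + e).
have a0 : 0 <= a by rewrite le_max lexx.
have ar : a < hit_time y by rewrite gt_max; apply/andP; split; lra.
have rb' : hit_time y < b by rewrite lt_min; apply/andP; split; lra.
have b2 : b <= 2 * tau by rewrite ge_min lexx.
have fa : 0 < f (ray y a) by rewrite -fr; apply: ray_decreasing => //; lra.
have fb : f (ray y b) < 0 by rewrite -fr; apply: ray_decreasing => //; lra.
have Ua : U (ray y a) by apply: (ray_transverse yb _).1; rewrite ler_norml; lra.
have Ub : U (ray y b) by apply: (ray_transverse yb _).1; rewrite ler_norml; lra.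
have na : \forall z \near y, 0 < f (ray z a).
  by apply: (near_ray_sign (P := [set x | 0 < x])) => //; exact: lt_nbhsr.
have nb : \forall z \near y, f (ray z b) < 0.
  by apply: (near_ray_sign (P := [set x | x < 0])) => //; exact: lt_nbhsl.
have nn := open_nbhs_nbhs (conj open_near_base yb).
apply: filterS (filterI nn (filterI na nb)) => z [zb [fza fzb]].
have [_ /andP[]] := hit_time_between zb a0 (lt_trans ar rb') b2 fza fzb.
rewrite gt_max lt_min => /andP[_ h1] /andP[_ h2].
by rewrite ltr_norml; lra.
Qed.

Definition hit y : 'rV[R]_n := ray y (hit_time y).

Lemma cvg_hit y : O y -> hit z @[z --> y] --> hit y.
Proof.
move=> Oy; apply: cvgB; first exact: cvg_fst.
by apply: cvgZ; [exact: hit_time_continuous | exact: cvg_snd].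
Qed.

Lemma hitP y : O y -> [/\ U (hit y), 0 < dot y.2 (grad f (hit y)) & f (hit y) = 0].
Proof.
have t0 := tau_gt0; move=> Oy; have [rb fr] := hit_timeP Oy.
have [|Uh gh] := ray_transverse (s := hit_time y) Oy.1; first by rewrite ler_norml; lra.
by split.
Qed.

Lemma ler_norm_fst (x : phase R n) : `|x.1| <= `|x|.
Proof. by rewrite [leRHS]prod_normE le_max lexx. Qed.

Lemma ler_norm_snd (x : phase R n) : `|x.2| <= `|x|.
Proof. by rewrite [leRHS]prod_normE le_max lexx orbT. Qed.

Definition dhit_time y (w : phase R n) : R^o :=
  (dot y.2 (grad f (hit y)))^-1 * dot (w.1 - hit_time y *: w.2) (grad f (hit y)).

Lemma is_diff_hit_time y : O y -> is_diff y (hit_time : _ -> R^o) (dhit_time y).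
Proof.
move=> Oy; have [Uh gh fh] := hitP Oy.
have dlin : linear (dhit_time y).
  have scE (a b : R^o) : a *: b = a * b by [].
  move=> a w w'; rewrite /dhit_time /= [X in _ = X + _]scE.
  rewrite !dotBl !dotDl !dotZl !dotDl !dotZl; ring.
pose L : {linear phase R n -> R^o} := HB.pack (dhit_time y) (GRing.isLinear.Build _ _ _ _ _ dlin).
have cL : continuous L.
  move=> w; apply: cvgM; first exact: cvg_cst.
  apply: cvg_dot; last exact: cvg_cst.
  by apply: cvgB; [exact: cvg_fst | apply: cvgZl_tmp; exact: cvg_snd].
rewrite -[dhit_time y]/(L : _ -> _); apply: is_diff_norm => // e e0.
have [fd _] := C1f Uh; have cdf := diff_continuous fd.
have [k k0 dfk] := linear_lipschitz cdf.
set s := hit_time y; set g := grad f (hit y) in gh *; set D := dot y.2 g in gh *.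
pose M := `|y.2| + 1; pose C1 := 1 + `|s|; pose C3 := 2 * (k + 1) * C1 / D.
have M0 : 0 < M by rewrite ltr_pwDr.
have C10 : 0 < C1 by rewrite ltr_wpDr.
have C30 : 0 < C3 by rewrite divr_gt0 // !mulr_gt0 // addr_gt0.
pose Q := C1 + (M + 1) * C3.
have Q0 : 0 < Q by rewrite addr_gt0 // mulr_gt0 // addr_gt0.
pose e' := Num.min 1 (Num.min (D / (2 * (M + 1))) (e * D / Q)).
have e'0 : 0 < e'.
  rewrite !lt_min ltr01 /=; apply/andP; split; last by rewrite divr_gt0 // mulr_gt0.
  by rewrite divr_gt0 // mulr_gt0 // addr_gt0.
have e'1 : e' <= 1 by rewrite ge_min lexx.
have e'2 : e' * (M + 1) <= D / 2.
  rewrite ler_pdivlMr // -mulrA [(M + 1) * 2]mulrC -ler_pdivlMr.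
    by rewrite !ge_min lexx orbT.
  by rewrite mulr_gt0 // addr_gt0.
have e'3 : e' * Q <= e * D.
  by rewrite -ler_pdivlMr // !ge_min lexx !orbT.
have n1 : \forall z \near y, `|f (hit z) - f (hit y) - 'd f (hit y) (hit z - hit y)| <=
    e' * `|hit z - hit y|.
  exact: (cvg_hit Oy (diff_norm fd e'0)).
have c2 : z.2 @[z --> y] --> y.2 by exact: cvg_snd.
have n2 : \forall z \near y, `|z.2| < M.
  have yM : `|y.2| < M by rewrite ltrDl.
  exact: (cvg_norm c2 (lt_nbhsl yM)).
have n3 : \forall z \near y, `|'d f (hit y) y.2 - 'd f (hit y) z.2| < e'.
  have c3 : 'd f (hit y) z.2 @[z --> y] --> 'd f (hit y) y.2.
    by apply: (@cvg_comp _ _ _ (fun z : phase R n => z.2) ('d f (hit y)) _ _ _ c2); exact: cdf.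
  by move/cvgrPdist_lt : c3; apply.
have n4 := open_nbhs_nbhs (conj open_collision_domain Oy).
near=> z.
have Oz : O z by near: z.
have h1 : `|f (hit z) - f (hit y) - 'd f (hit y) (hit z - hit y)| <=
    e' * `|hit z - hit y| by near: z.
have h2 : `|z.2| < M by near: z.
have h3 : `|'d f (hit y) y.2 - 'd f (hit y) z.2| < e' by near: z.
have [_ _ fz] := hitP Oz.
set sg := hit_time z - s; pose A := (z - y).1 - s *: (z - y).2.
have hE : hit z - hit y = A - sg *: z.2.
  by rewrite /hit /ray /A /sg -/s; apply/rowP => i; rewrite !mxE; ring.
have AE : `|A| <= C1 * `|z - y|.
  rewrite /C1 mulrDl mul1r; apply: le_trans (ler_normB _ _) _.
  by rewrite normrZ lerD ?ler_norm_fst // ler_wpM2l // ler_norm_snd.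
move: h1; rewrite fz fh subrr sub0r normrN hE linearB linearZ /= => h1.
have h1' : `|'d f (hit y) A - sg * 'd f (hit y) z.2| <= e' * (C1 * `|z - y| + `|sg| * M).
  apply: le_trans h1 _; rewrite ler_pM2l //; apply: le_trans (ler_normB _ _) _.
  by rewrite lerD // normrZ ler_wpM2l // ltW.
have dA : `|'d f (hit y) A| <= k * (C1 * `|z - y|).
  by apply: le_trans (dfk _) _; rewrite ler_pM2l.
have DE : 'd f (hit y) y.2 = D by rewrite diff_gradE.
have h4 : `|sg * D - 'd f (hit y) A| <= e' * (C1 * `|z - y| + (M + 1) * `|sg|).
  have -> : sg * D - 'd f (hit y) A =
     sg * ('d f (hit y) y.2 - 'd f (hit y) z.2) - ('d f (hit y) A - sg * 'd f (hit y) z.2).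
    by rewrite DE; ring.
  apply: le_trans (ler_normB _ _) _; rewrite normrM.
  have : `|sg| * `|'d f (hit y) y.2 - 'd f (hit y) z.2| <= `|sg| * e'.
    by rewrite ler_wpM2l // ltW.
  lra.
have h5 : `|sg| <= C3 * `|z - y|.
  have h6 : `|sg| * D <= `|'d f (hit y) A| + `|sg * D - 'd f (hit y) A|.
    rewrite -{1}(gtr0_norm gh) -normrM -{1}(subrK ('d f (hit y) A) (sg * D)).
    by rewrite addrC ler_normD.
  have h7 : e' * ((M + 1) * `|sg|) <= D / 2 * `|sg| by rewrite mulrA ler_wpM2r.
  have h8 : e' * (C1 * `|z - y|) <= 1 * (C1 * `|z - y|).
    by rewrite ler_wpM2r // mulr_ge0 // ltW.
  rewrite /C3 mulrAC ler_pdivlMr //; lra.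
have h9 : `|sg * D - 'd f (hit y) A| <= e * D * `|z - y|.
  apply: le_trans h4 _; apply: (@le_trans _ _ (e' * (Q * `|z - y|))).
    have -> : Q * `|z - y| = C1 * `|z - y| + (M + 1) * (C3 * `|z - y|) by rewrite /Q; ring.
    by rewrite ler_pM2l // lerD2l ler_pM2l // addr_gt0.
  by rewrite mulrA ler_wpM2r.
have -> : hit_time z - hit_time y - L (z - y) = D^-1 * (sg * D - 'd f (hit y) A).
  rewrite [L _]/(dhit_time y (z - y)) /dhit_time -/g -/D -/s -/A -/sg diff_gradE -/g.
  by rewrite mulrBr mulrCA mulVf ?gt_eqF // mulr1.
rewrite normrM gtr0_norm ?invr_gt0 // ler_pdivrMl //.
by apply: le_trans h9 _; rewrite mulrAC mulrC.
Unshelve. all: by end_near. Qed.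

Lemma C1_on_hit_time : C1_on O (hit_time : _ -> R^o).
Proof.
apply: (C1_on_diff (df := dhit_time)) => [||y w Oy]; first exact: open_collision_domain.
  exact: is_diff_hit_time.
have [Uh gh fh] := hitP Oy.
have cg : {for hit y, continuous (grad f)}.
  have [_ [oU _] C2f _ _] := chart.
  by apply: differentiable_continuous; have [] := C1_on_grad oU C2f Uh.
have cgh : grad f (hit z) @[z --> y] --> grad f (hit y).
  exact: (@cvg_comp _ _ _ hit (grad f) _ _ _ (cvg_hit Oy) cg).
apply: cvgM.
  apply: cvgV; first by rewrite gt_eqF.
  by apply: cvg_dot => //; exact: cvg_snd.
apply: cvg_dot => //; apply: cvgB; first exact: cvg_cst.
by apply: cvgZr_tmp; exact: hit_time_continuous.
Qed.

Lemma C1_on_fst (V W : normedModType R) (A : set (V * W)%type) : C1_on A (@fst V W).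
Proof. by apply: C1_on_lin => x; exact: cvg_fst. Qed.

Lemma C1_on_snd (V W : normedModType R) (A : set (V * W)%type) : C1_on A (@snd V W).
Proof. by apply: C1_on_lin => x; exact: cvg_snd. Qed.

Definition hit_normal y : 'rV[R]_n := unit_normal f (hit y).

Definition bounced y : 'rV[R]_n := reflect_vec (hit_normal y) y.2.

(* Flow backward for time [2 * tau], through the collision, then reverse the
   velocity. *)
Definition reversal y : phase R n :=
  (hit y - (2 * tau - hit_time y) *: bounced y, - bounced y).

Let oO : open O := open_collision_domain.

Lemma hit_grad y : O y -> grad f (hit y) != 0.
Proof.
by move=> /hitP [_ gh _]; apply: contraTneq gh => ->; rewrite dot0r ltxx.
Qed.

Lemma enorm_hit_normal y : O y -> enorm (hit_normal y) = 1.
Proof.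
move=> /hit_grad gh; rewrite /hit_normal enormZ ger0_norm ?invr_ge0 ?enorm_ge0 //.
by rewrite mulVf // enorm_eq0.
Qed.

Lemma C1_on_hit : C1_on O hit.
Proof.
have h2 := C1_onZ oO C1_on_hit_time (C1_on_snd (A := O)).
exact: (C1_onB oO (C1_on_fst (A := O)) h2).
Qed.

Let B := U `&` [set x | grad f x != 0].

Lemma C1_on_chart_normal : C1_on B (unit_normal f).
Proof.
have [_ [oU _] C2f _ _] := chart.
have oB : open B.
  rewrite openE => x [Ux gx]; apply: filterI; first exact: (open_nbhs_nbhs (conj oU Ux)).
  have gc := differentiable_continuous (C1_on_grad oU C2f Ux).1.
  have g0 : 0 < dot (grad f x) (grad f x) by rewrite dot_gt0.
  have h : \forall z \near x, 0 < dot (grad f z) (grad f z).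
    exact: (cvg_dot gc gc (lt_nbhsr g0)).
  by apply: filterS h => z; rewrite dot_gt0.
have BU : B `<=` U by move=> x [].
have C2B : C2_on B f by case: C2f => h1 h2; split=> [|v]; [exact: C1_onS h1 | exact: C1_onS (h2 v)].
by apply: (C1_on_unit_normal oB) => // x [].
Qed.

Lemma C1_on_hit_normal : C1_on O hit_normal.
Proof.
have hB y : O y -> B (hit y).
  by move=> Oy; split; [have [] := hitP Oy | exact: hit_grad].
exact: (C1_on_comp (finite_dimensional_rV n) oO hB C1_on_hit C1_on_chart_normal).
Qed.

Lemma C1_on_bounced : C1_on O bounced.
Proof.
have S := C1_on_snd (A := O) (V := 'rV[R]_n) (W := 'rV[R]_n).
have h1 := C1_on_dot oO S C1_on_hit_normal.
have h2 := C1_onZ oO (C1_on_cst (A := O) (W := R^o) 2) h1.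
exact: (C1_onB oO S (C1_onZ oO h2 C1_on_hit_normal)).
Qed.

Lemma C1_on_reversal : C1_on O reversal.
Proof.
have h1 := C1_onB oO (C1_on_cst (A := O) (W := R^o) (2 * tau)) C1_on_hit_time.
have h2 := C1_onB oO C1_on_hit (C1_onZ oO h1 C1_on_bounced).
exact: (C1_on_pair oO h2 (C1_onN oO C1_on_bounced)).
Qed.

Lemma ray_reversal y s : ray (reversal y) s = hit y - (2 * tau - hit_time y - s) *: bounced y.
Proof. by rewrite /ray /=; apply/rowP => i; rewrite !mxE; ring. Qed.

Lemma hit_time_reversal y : O y -> O (reversal y) -> hit_time (reversal y) = 2 * tau - hit_time y.
Proof.
move=> Oy OJy; have [rb _] := hit_timeP Oy; have [_ _ fh] := hitP Oy.
apply: hit_time_unique; [exact: OJy.1 | lra |].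
by rewrite ray_reversal subrr scale0r subr0.
Qed.

Lemma hit_reversal y : O y -> O (reversal y) -> hit (reversal y) = hit y.
Proof.
by move=> Oy OJy; rewrite /hit hit_time_reversal // ray_reversal subrr scale0r subr0.
Qed.

Lemma bounced_reversal y : O y -> O (reversal y) -> bounced (reversal y) = - y.2.
Proof.
move=> Oy OJy; rewrite /bounced /hit_normal hit_reversal // reflect_vecN reflect_vecK //.
exact: enorm_hit_normal.
Qed.

Lemma reversalK y : O y -> O (reversal y) -> reversal (reversal y) = y.
Proof.
move=> Oy OJy; rewrite [LHS]/reversal hit_time_reversal // hit_reversal // bounced_reversal //.
rewrite opprK [y in RHS]surjective_pairing; congr (_, _).
by rewrite /hit /ray; apply/rowP => i; rewrite !mxE; ring.
Qed.

Lemma enorm_bounced y : O y -> enorm (bounced y) = enorm y.2.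
Proof. by move=> Oy; rewrite enorm_reflect // enorm_hit_normal. Qed.

Let z0 : phase R n := (q + tau *: nu, nu).

Lemma near_base_z0 : near_base z0.
Proof. by split; rewrite /= subrr normr0. Qed.

Lemma ray_z0 s : ray z0 s = q + (tau - s) *: nu.
Proof. by rewrite /ray /= scalerBl addrA. Qed.

Lemma collision_domain_z0 : O z0.
Proof.
have t0 := tau_gt0; have zb := near_base_z0; have f0 := chart_root chart.
have frt : f (ray z0 tau) = 0 by rewrite ray_z0 subrr scale0r addr0.
split => //; split.
  by rewrite -(ray0 z0) -frt; apply: ray_decreasing => //; lra.
by rewrite -frt; apply: ray_decreasing => //; lra.
Qed.

Lemma hit_time_z0 : hit_time z0 = tau.
Proof.
have t0 := tau_gt0; apply: hit_time_unique; [exact: near_base_z0 | lra |].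
by rewrite ray_z0 subrr scale0r addr0 (chart_root chart).
Qed.

Lemma hit_z0 : hit z0 = q.
Proof. by rewrite /hit hit_time_z0 ray_z0 subrr scale0r addr0. Qed.

Lemma hit_normal_z0 : hit_normal z0 = nu.
Proof. by rewrite /hit_normal hit_z0. Qed.

Lemma bounced_z0 : bounced z0 = - nu.
Proof.
rewrite /bounced hit_normal_z0 /reflect_vec /= (dot_enorm1 nu1).
by apply/rowP => i; rewrite !mxE; ring.
Qed.

Lemma reversal_z0 : reversal z0 = z0.
Proof.
rewrite /reversal hit_z0 hit_time_z0 bounced_z0 opprK; congr (_, _).
by apply/rowP => i; rewrite !mxE; ring.
Qed.

(* The vectors orthogonal to the orbit: [u] is the displacement of the collision
   point and [dv] the variation of the velocity before the collision. *)
Lemma diff_reversal_z0 (w : phase R n) :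
  dot w.1 nu = 0 -> dot w.2 nu = 0 ->
  let u := w.1 - tau *: w.2 in
  let Su := 'd (unit_normal f) q u in
  let dv := w.2 - 2 *: Su - (2 * dot nu Su) *: nu in
  'd reversal z0 w = (u - tau *: dv, - dv).
Proof.
move=> w1 w2 u Su dv; have Oz := collision_domain_z0.
have rd : is_diff z0 (hit_time : _ -> R^o) (dhit_time z0) by exact: is_diff_hit_time.
have fd : is_diff z0 (@fst 'rV[R]_n 'rV[R]_n) fst.
  by split; [apply: linear_differentiable | apply: diff_lin] => x; exact: cvg_fst.
have sd : is_diff z0 (@snd 'rV[R]_n 'rV[R]_n) snd.
  by split; [apply: linear_differentiable | apply: diff_lin] => x; exact: cvg_snd.
have hd := is_diffB fd (is_diffZf rd sd).
have hE : (fst - (fun y : phase R n => hit_time y *: y.2)) = hit by [].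
rewrite hE in hd.
have Bq : B q.
  by have [_ [_ Uq] _ gq _] := chart; split.
have Nd : is_diff (hit z0) (unit_normal f) ('d (unit_normal f) q).
  by rewrite hit_z0; apply: differentiableP; have [] := C1_on_chart_normal Bq.
have nd := is_diff_comp hd Nd.
have dd := is_diff_dot sd nd.
have kd := is_diff_comp dd (is_diff_scaler (2 : R) _).
have bd := is_diffB sd (is_diffZf kd nd).
have td := is_diffB (is_diff_cst (2 * tau : R^o) z0) rd.
have jd := is_diff_pair (is_diffB hd (is_diffZf td bd)) (is_diffN bd).
have dr0 : dhit_time z0 w = 0.
  rewrite /dhit_time hit_time_z0 hit_z0; have [_ _ _ gq _] := chart.
  have -> : grad f q = enorm (grad f q) *: nu.
    by rewrite nuE scalerA mulfV ?scale1r // enorm_eq0.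
  by rewrite !dotZr dotBl dotZl w1 w2; ring.
pose X := w.1 - (hit_time z0 *: w.2 + dhit_time z0 w *: nu).
pose V := w.2 - ((2 * dot nu (hit_normal z0)) *: 'd (unit_normal f) q X +
  (2 * (dot nu ('d (unit_normal f) q X) + dot w.2 (hit_normal z0))) *: hit_normal z0).
have -> : 'd reversal z0 w =
    (X - ((2 * tau - hit_time z0) *: V + (0 - dhit_time z0 w) *: bounced z0), - V).
  exact: (congr1 (fun F => F w) (@diff_val _ _ _ _ _ _ _ jd)).
have XE : X = u by rewrite /X dr0 scale0r addr0 hit_time_z0.
have VE : V = dv.
  rewrite /V hit_normal_z0 XE (dot_enorm1 nu1) w2 addr0 mulr1 /dv -/Su.
  by rewrite opprD addrA.
rewrite XE VE dr0 subrr scale0r addr0 hit_time_z0; congr (_ - _ *: _, _); ring.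
Qed.

Lemma outward_normal_hit y : O y -> outward_normal K (hit y) (hit_normal y).
Proof.
have t0 := tau_gt0; move=> Oy; have [Uh gh fh] := hitP Oy; have [rb fr] := hit_timeP Oy.
have [_ [oU _] C2f _ Kf] := chart.
suff bK : bdry K (hit y).
  have gh' := hit_grad Oy.
  have ch' : boundary_chart K (hit y) U f := And5 bK (conj oU Uh) C2f gh' Kf.
  exact: (ex_intro _ U (ex_intro _ f (conj ch' erefl))).
split; first by apply: subset_closure; apply/(Kf _ Uh); rewrite fh.
move=> intK.
have cr : ray y s @[s --> (hit_time y)^'-] --> hit y.
  apply: cvgB; first exact: cvg_cst.
  by apply: cvgZr_tmp; apply: cvg_at_left_filter; exact: cvg_id.
have nK : \forall s \near (hit_time y)^'-, K (ray y s) by exact: cr intK.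
have n0 : \forall s \near (hit_time y)^'-, 0 < s by apply: nbhs_left_gt; lra.
have n1 : \forall s \near (hit_time y)^'-, s < hit_time y by exact: nbhs_left_lt.
have [s [Ks [s0 s1]]] := @filter_ex _ (at_left (hit_time y)) _ _ (filterI nK (filterI n0 n1)).
have [|Us _] := ray_transverse (s := s) Oy.1; first by rewrite ler_norml; lra.
have : f (ray y (hit_time y)) < f (ray y s) by apply: ray_decreasing Oy.1 _ s1 _; lra.
by rewrite fr ltNge => /negP; apply; exact/(Kf _ Us).
Qed.

Definition collision_path y (t : R) : phase R n :=
  if - hit_time y <= t then (hit y + (t + hit_time y) *: y.2, y.2)
  else (hit y + (t + hit_time y) *: bounced y, bounced y).

Lemma collision_path0 y : O y -> collision_path y 0 = y.
Proof.
move=> /hit_timeP [rb _]; rewrite /collision_path ifT; last by lra.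
rewrite [y in RHS]surjective_pairing; congr (_, _).
by rewrite /hit /ray; apply/rowP => i; rewrite !mxE; ring.
Qed.

Lemma collision_path_before y t : O y -> t <= - (2 * tau) ->
  collision_path y t = free_motion (flip (reversal y)) (t + 2 * tau).
Proof.
move=> /hit_timeP [rb _] t2; rewrite /collision_path ifF; last by apply/negbTE; rewrite -ltNge; lra.
rewrite /free_motion /flip /reversal /= opprK; congr (_, _).
by apply/rowP => i; rewrite !mxE; ring.
Qed.

Lemma collision_path_trajectory y t : O y -> O (reversal y) -> enorm y.2 = 1 ->
  - (3 * tau) <= t -> t <= 0 -> trajectory_at (K := K) (collision_path y) t.
Proof.
have t0 := tau_gt0; move=> Oy OJy y1 t3 t_le0.
have [rb fr] := hit_timeP Oy; have [rb' fr'] := hit_timeP OJy.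
have [_ _ _ _ Kf] := chart.
have notK x : U x -> 0 < f x -> ~ bdry K x /\ exterior K x.
  move=> Ux fx; have nK : \forall z \near x, ~ K z.
    have [oU Uq] : open U /\ U q by case: chart.
    have fc := differentiable_continuous (C1f Ux).1.
    have fz : \forall z \near x, 0 < f z by exact: fc (lt_nbhsr fx).
    apply: filterS (filterI fz (open_nbhs_nbhs (conj oU Ux))) => z [fz0 Uz].
    by move=> /(Kf _ Uz); rewrite leNgt fz0.
  split; last by apply: subset_closure; exact: nbhs_singleton nK.
  by move=> [clK _]; have [z [Kz nKz]] := clK _ nK.
have [tr|rt|tE] := ltgtP t (- hit_time y).
- have pE s : s < - hit_time y -> collision_path y s = (hit y + (s + hit_time y) *: bounced y, bounced y).
    by move=> sr; rewrite /collision_path ifF //; apply/negbTE; rewrite -ltNge.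
  have footE : hit y + (t + hit_time y) *: bounced y = ray (reversal y) (2 * tau + t).
    by rewrite ray_reversal; apply/rowP => i; rewrite !mxE; ring.
  have [|Ux _] := ray_transverse (s := 2 * tau + t) OJy.1; first by rewrite ler_norml; lra.
  have [|nb ext] := notK _ Ux.
    rewrite -fr'; apply: ray_decreasing OJy.1 _ _ _; rewrite ?hit_time_reversal //; lra.
  rewrite -footE in nb ext; split.
  + by rewrite pE //; split => //=; rewrite enorm_bounced.
  + move=> _; near=> s; rewrite !pE //; last by near: s; exact: lt_nbhsl.
    by rewrite /free_motion /=; congr (_, _); apply/rowP => i; rewrite !mxE; ring.
  + by rewrite pE // => /nb.
- have pE s : - hit_time y <= s -> collision_path y s = (hit y + (s + hit_time y) *: y.2, y.2).
    by move=> sr; rewrite /collision_path sr.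
  have footE : hit y + (t + hit_time y) *: y.2 = ray y (- t).
    by rewrite /hit /ray; apply/rowP => i; rewrite !mxE; ring.
  have [|Ux _] := ray_transverse (s := - t) Oy.1; first by rewrite ler_norml; lra.
  have [|nb ext] := notK _ Ux.
    rewrite -fr; apply: ray_decreasing Oy.1 _ _ _; lra.
  rewrite -footE in nb ext; split.
  + by rewrite pE ?ltW //; split.
  + move=> _; near=> s; rewrite !pE ?(ltW rt) //; last first.
      by apply/ltW; near: s; exact: lt_nbhsr.
    by rewrite /free_motion /=; congr (_, _); apply/rowP => i; rewrite !mxE; ring.
  + by rewrite pE ?ltW // => /nb.
- have onh := outward_normal_hit Oy; have bh := outward_normal_bdry onh.
  have pt : collision_path y t = (hit y, y.2).
    by rewrite /collision_path tE lexx addNr scale0r addr0.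
  rewrite /trajectory_at pt; split => //=.
    by split => //=; case: bh => _ nint; rewrite /exterior closure_setC.
  move=> _; exists (hit_normal y), (bounced y); split => //.
  + by rewrite /bounced reflect_vecK // enorm_hit_normal.
  + near=> s; have st : s < - hit_time y by rewrite -tE; near: s; exact: nbhs_left_lt.
    rewrite /collision_path ifF /free_motion /= ?tE ?opprK //.
    by apply/negbTE; rewrite -ltNge.
  + near=> s; have st : - hit_time y < s by rewrite -tE; near: s; exact: nbhs_right_gt.
    by rewrite /collision_path (ltW st) /free_motion /= ?tE ?opprK.
Unshelve. all: by end_near. Qed.

Lemma collision_trajectory (normal_uniq : forall x nu1 nu2,
    outward_normal K x nu1 -> outward_normal K x nu2 -> nu1 = nu2) g y t :
  billiard_trajectory K g -> g 0 = y -> O y -> O (reversal y) ->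
  - (3 * tau) <= t -> t <= 0 -> g t = collision_path y t.
Proof.
move=> tg g0 Oy OJy t3 t0; have [[_ v1] _ _] := tg 0; rewrite g0 in v1.
have [|_ ] := trajectory_unique normal_uniq (g := g) (h := collision_path y) t0.
  move=> s ts s0; split; first exact: tg.
  by apply: collision_path_trajectory => //; exact: le_trans ts.
by apply; rewrite g0 collision_path0.
Qed.

End Collision.

Section Transport.
Context {R : realType} {V : normedModType R} {J : V -> V} {O : set V} {z0 : V}.
Hypothesis finV : finite_dimensional V.
Hypothesis openO : open O.
Hypothesis Oz0 : O z0.
Hypothesis JO : forall y, O y -> O (J y).
Hypothesis JK : forall y, O y -> J (J y) = y.
Hypothesis C1J : C1_on O J.
Hypothesis Jz0 : J z0 = z0.

Let D : V -> V := 'd J z0.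

Lemma nbhs_O : nbhs z0 O.
Proof. exact: (open_nbhs_nbhs (conj openO Oz0)). Qed.

Lemma diff_involution w : D (D w) = w.
Proof.
have [Jd _] := C1J Oz0; have /differentiableP Jd' := Jd.
have Jd2 : is_diff (J z0) J D by rewrite Jz0.
have JJ := is_diff_comp Jd' Jd2.
have <- : 'D_w (J \o J) z0 = D (D w).
  by rewrite deriveE; [rewrite diff_val | exact: ex_diff].
have -> : 'D_w (J \o J) z0 = 'D_w id z0.
  by apply: near_eq_derive; apply: filterS nbhs_O => y /JK.
exact: derive_id.
Qed.

Let J_cont y : O y -> {for y, continuous J}.
Proof. by move=> /C1J [Jd _]; exact: differentiable_continuous. Qed.

Lemma near_J (P : set V) : nbhs z0 P -> \forall y \near z0, P (J y).
Proof. by move=> Pz; have := J_cont Oz0; apply; rewrite Jz0. Qed.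

Lemma tangent_space_transport (W1 W2 : set V) b :
  (\forall y \near z0, W1 y -> W2 (J y)) ->
  tangent_space W1 z0 b -> tangent_space W2 z0 (D b).
Proof.
move=> W12 [I [c [[oI I0] C1c c0 cb Ic]]].
pose N := interior (O `&` [set y | W1 y -> W2 (J y)]).
have Nz : nbhs z0 N by exact: (nbhs_interior (filterI nbhs_O W12)).
have c_cont s : I s -> {for s, continuous c}.
  by move=> /C1c [cd _]; exact: differentiable_continuous.
pose I' := I `&` [set s | N (c s)].
have oI' : open I'.
  rewrite openE => s [Is Ns]; apply: filterI; first exact: (open_nbhs_nbhs (conj oI Is)).
  by apply: (c_cont s Is); apply: (open_nbhs_nbhs (conj (@open_interior _ _) Ns)).
have I'0 : I' 0 by split => //=; rewrite c0; exact: nbhs_singleton Nz.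
have cO s : I' s -> O (c s) by move=> [_ /interior_subset []].
have C1c' : C1_on I' c by apply: C1_onS C1c => s [].
have cJ0 : (J \o c) 0 = z0 by rewrite /= c0.
exists I', (J \o c); split; [exact: (conj oI' I'0) | | exact: cJ0 | |].
- exact: (C1_on_comp finV oI' cO C1c' C1J).
- have /differentiableP cd := (C1c _ I0).1.
  have Jd : is_diff (c 0) J D by rewrite c0; have [/differentiableP] := C1J Oz0.
  by rewrite (@diff_val _ _ _ _ _ _ _ (is_diff_comp cd Jd)) /= cb.
- by move=> s [Is /interior_subset [_]]; apply; exact: Ic.
Qed.

Section Parametrization.
Context {W1 W2 E1 E2 U : set V} {psi : V -> V}.
Hypothesis E21 : forall v, E2 v -> E1 (D v).
Hypothesis E12 : forall v, E1 v -> E2 (D v).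
Hypothesis W12 : forall y, O y -> W1 y -> W2 (J y).
Hypothesis W21 : \forall y \near z0, W2 y -> W1 (J y).
Hypothesis param : local_parametrization W1 E1 z0 U psi.

Let U' := [set v | U (D v) /\ O (psi (D v))].
Let psi' := J \o psi \o D.

Let D_cont : continuous D.
Proof. by apply: diff_continuous; have [] := C1J Oz0. Qed.

Let C1D : C1_on U' D.
Proof. exact: C1_on_lin D_cont. Qed.

Lemma local_parametrization_transport : local_parametrization W2 E2 z0 U' psi'.
Proof.
have [[oU U0] C1psi [psi0 dpsi] [psi_inj psiW] psi_onto] := param.
have D0 : D 0 = 0 by rewrite /D linear0.
have psi_cont v : U v -> {for v, continuous psi}.
  by move=> /C1psi [pd _]; exact: differentiable_continuous.
have oU' : open U'.
  rewrite openE => v [Uv Ov]; have Dv := @D_cont v.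
  have nU : nbhs (D v) (U `&` [set w | O (psi w)]).
    apply: filterI; first exact: (open_nbhs_nbhs (conj oU Uv)).
    by apply: (psi_cont _ Uv); exact: (open_nbhs_nbhs (conj openO Ov)).
  exact: Dv nU.
have U'0 : U' 0 by rewrite /U' /= D0 psi0.
have UU' v : U' v -> U (D v) by case.
have OU' v : U' v -> O ((psi \o D) v) by case.
have C1psiD := C1_on_comp finV oU' UU' C1D C1psi.
split; first exact: (conj oU' U'0).
- exact: (C1_on_comp finV oU' OU' C1psiD C1J).
- split; first by rewrite /psi' /= D0 psi0.
  move=> v E2v.
  have dD : is_diff 0 D D by split; [exact: linear_differentiable D_cont | exact: diff_lin D_cont].
  have dp : is_diff (D 0) psi ('d psi 0).
    by rewrite D0; apply: differentiableP; have [] := C1psi _ U0.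
  have dJ : is_diff ((psi \o D) 0) J D.
    by rewrite /= D0 psi0; have [/differentiableP] := C1J Oz0.
  rewrite (@diff_val _ _ _ _ _ _ _ (is_diff_comp (is_diff_comp dD dp) dJ)) /=.
  by rewrite dpsi ?diff_involution //; exact: E21.
- split.
    move=> v w; rewrite !inE => -[E2v [Uv Ov]] [E2w [Uw Ow]] /(congr1 J).
    rewrite /psi' /= !JK // => vw.
    rewrite -(diff_involution v) -(diff_involution w); congr (D _).
    by apply: psi_inj => //; rewrite inE; split => //; exact: E21.
  by move=> v [E2v [Uv Ov]]; apply: W12 => //; apply: psiW; split => //; exact: E21.
- apply: filterS (filterI nbhs_O (filterI W21 (near_J psi_onto))).
  move=> y [Oy [W21y onto]] W2y; have [v [E1v Uv] vy] := onto (W21y W2y).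
  exists (D v).
    by split; [exact: E12 | split; rewrite diff_involution // vy; exact: JO].
  by rewrite /psi' /= diff_involution vy JK.
Qed.

Lemma tangent_to_transport (L : set V) b :
  (forall y, O y -> W1 y -> L y -> L (J y)) ->
  E1 b -> b != 0 ->
  (exists (v : nat -> V) (t : nat -> R),
        [/\ forall m, [/\ E1 (v m), t m != 0, U (t m *: v m)
                       & (L `&` W1) (psi (t m *: v m))],
            v @ \oo --> b & t @ \oo --> (0 : R)]) ->
  tangent_to L W2 E2 z0 (D b).
Proof.
move=> LJ E1b b0 [v [t [vt vb t0]]].
have [[oU U0] C1psi [psi0 _] _ _] := param.
split; first exact: E12.
  by apply: contra_neq b0 => Db; rewrite -(diff_involution b) Db /D linear0.
exists U', psi'; split; first exact: local_parametrization_transport.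
have tv : t m *: v m @[m --> \oo] --> (0 : V).
  by rewrite -(scale0r b); exact: cvgZ.
have psi_cont : {for 0, continuous psi}.
  by apply: differentiable_continuous; have [] := C1psi _ U0.
have nO : \forall m \near \oo, O (psi (t m *: v m)).
  have nO0 : nbhs (0 : V) (psi @^-1` O) by apply: psi_cont; rewrite psi0; exact: nbhs_O.
  exact: tv nO0.
have [N _ hN] := nO.
exists (fun m => D (v (m + N)%N)), (fun m => t (m + N)%N); split.
- move=> m; have [E1v tn0 Uv [Lv Wv]] := vt (m + N)%N.
  have Om : O (psi (t (m + N)%N *: v (m + N)%N)) by apply: hN; rewrite /= leq_addl.
  have DE : D (t (m + N)%N *: D (v (m + N)%N)) = t (m + N)%N *: v (m + N)%N.
    by rewrite /D linearZ /= -/D diff_involution.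
  split => //; first exact: E12.
    by rewrite /U' /= DE.
  by rewrite /psi' /= DE; split; [exact: LJ | exact: W12].
- have h : v (m + N)%N @[m --> \oo] --> b by have := vb; rewrite -(cvg_shiftn N).
  exact: (cvg_comp _ _ h (@D_cont b)).
- by have := t0; rewrite -(cvg_shiftn N).
Qed.

End Parametrization.
End Transport.

Section Scaling.
Context {R : realType} {V : normedModType R}.

Lemma tangent_space_scale (W : set V) z b k :
  tangent_space W z b -> tangent_space W z (k *: b).
Proof.
move=> [I [c [[oI I0] C1c c0 cb Ic]]].
pose sc := ( *:%R k : R^o -> R^o).
have sc_cont : continuous sc by move=> s; apply: cvgZl_tmp; exact: cvg_id.
have sc0 : sc 0 = 0 by exact: scaler0.
have oI' : open (sc @^-1` I) by apply: open_comp oI => s _; exact: sc_cont.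
have finR : finite_dimensional (R^o : normedModType R).
  by exists 1%N, (fun=> 1), (fun _ u => u); split => [_|u];
    [move=> x; exact: cvg_id | rewrite big_ord1 [RHS]mulr1].
exists (sc @^-1` I), (c \o sc); split => //.
- by split => //=; rewrite /preimage /= sc0.
- apply: (C1_on_comp finR oI' _ _ C1c) => //.
  exact: (C1_on_lin (f := GRing.scale k : {linear R^o -> R^o}) sc_cont).
- by rewrite /= sc0.
- have cd : is_diff (sc 0) c ('d c 0).
    by rewrite sc0; apply: differentiableP; have [] := C1c _ I0.
  rewrite (@diff_val _ _ _ _ _ _ _ (is_diff_comp (is_diff_scaler k 0) cd)) /=.
  have -> : k *: (1 : R^o) = k *: (1 : R^o) by [].
  by rewrite linearZ /= cb.
- by move=> s; exact: Ic.
Qed.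

Lemma tangent_to_scale (L W E : set V) z b k : k != 0 ->
  (forall v, E v -> E (k *: v)) ->
  tangent_to L W E z b -> tangent_to L W E z (k *: b).
Proof.
move=> k0 Ek [Eb b0 [U [psi [param [v [t [vt vb t0]]]]]]]; split.
- exact: Ek.
- by rewrite scaler_eq0 negb_or k0.
exists U, psi; split => //; exists (fun m => k *: v m), (fun m => t m / k); split.
- move=> m; have [Ev tn0 Uv LWv] := vt m.
  have E' : (t m / k) *: (k *: v m) = t m *: v m by rewrite scalerA divfK.
  by rewrite E'; split => //; [exact: Ek | rewrite mulf_neq0 ?invr_neq0].
- by apply: cvgZl_tmp.
- by rewrite -(mul0r k^-1); apply: cvgM; [exact: t0 | exact: cvg_cst].
Qed.

End Scaling.

Section Reversal_symmetry.
Context {R : realType} {n : nat} {K : set 'rV[R]_n} {O : set (phase R n)}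
  {J : phase R n -> phase R n} {z0 : phase R n} {Z : R -> phase R n} {T : R}.
Hypothesis normal_unique : forall q nu nu',
  outward_normal K q nu -> outward_normal K q nu' -> nu = nu'.
Hypothesis T_ge0 : 0 <= T.
Hypothesis O_free : forall y, O y -> ~ bdry K y.1.
Hypothesis Oz0 : O z0.
Hypothesis openO : open O.
Hypothesis JO : forall y, O y -> O (J y).
Hypothesis Jz0 : J z0 = z0.
Hypothesis J_cont : {for z0, continuous J}.
Hypothesis J_flow : forall g, billiard_trajectory K g -> O (g 0) ->
  g (- T) = flip (J (g 0)).
Hypothesis Z_traj : billiard_trajectory K Z.
Hypothesis Zz0 : Z 0 = z0.
Hypothesis Z_moves : forall y, phase_space K y -> exists2 c, 0 < c &
  forall M, (exists2 t, t < M & c < quotient_dist K (Z t) y) /\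
            (exists2 t, M < t & c < quotient_dist K (Z t) y).
Hypothesis Z_near : forall e, 0 < e -> \forall y \near z0, O y ->
  forall g, billiard_trajectory K g -> g 0 = y ->
  forall t, - T <= t -> t <= 0 -> quotient_dist K (Z t) (g t) <= e.

Lemma flow_Z t : billiard_flow K t z0 = Z t.
Proof. by apply: flow_trajectory => //; exact: O_free. Qed.

Lemma trajectory_phase_space g t : billiard_trajectory K g -> phase_space K (g t).
Proof. by move=> /(_ t) []. Qed.

Lemma unstable_trajectory e y : O y -> unstable_manifold K e z0 y ->
  exists2 g, billiard_trajectory K g & g 0 = y.
Proof.
move=> Oy [py _ cvg0]; have [//|const] := flow_cases (O_free Oy).
have [c c0 far] := Z_moves py.
move/cvgrPdist_le : cvg0 => /(_ c c0) [M [_ hM]].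
have [[t tM ct] _] := far M; have := hM t tM.
rewrite const flow_Z sub0r normrN ger0_norm; last first.
  by apply: quotient_dist_ge0 => //; exact: trajectory_phase_space.
by rewrite leNgt ct.
Qed.

Lemma stable_trajectory e y : O y -> stable_manifold K e z0 y ->
  exists2 g, billiard_trajectory K g & g 0 = y.
Proof.
move=> Oy [py _ cvg0]; have [//|const] := flow_cases (O_free Oy).
have [c c0 far] := Z_moves py.
move/cvgrPdist_le : cvg0 => /(_ c c0) [M [_ hM]].
have [_ [t tM ct]] := far M; have := hM t tM.
rewrite const flow_Z sub0r normrN ger0_norm; last first.
  by apply: quotient_dist_ge0 => //; exact: trajectory_phase_space.
by rewrite leNgt ct.
Qed.

Lemma J_trajectory g : billiard_trajectory K g -> O (g 0) ->
  let h t := reverse_state (K := K) (g (- T - t)) in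
  billiard_trajectory K h /\ h 0 = J (g 0).
Proof.
move=> tg Og h; split; first exact: reverse_trajectory.
rewrite /h subr0 J_flow // /reverse_state incomingN.
rewrite opprK incoming_free //=; first by rewrite -surjective_pairing.
by apply: O_free; exact: JO.
Qed.

Lemma J_quotient_dist g t : billiard_trajectory K g -> O (g 0) ->
  quotient_dist K (billiard_flow K t z0) (billiard_flow K t (J (g 0))) <=
  quotient_dist K (Z (- T - t)) (g (- T - t)).
Proof.
move=> tg Og; have [th h0] := J_trajectory tg Og.
have OZ : O (Z 0) by rewrite Zz0.
have [tZ Z0] := J_trajectory Z_traj OZ; rewrite Zz0 Jz0 in Z0.
rewrite (flow_trajectory normal_unique _ th (O_free (JO Og)) h0).
rewrite (flow_trajectory normal_unique _ tZ _ Z0); last exact: O_free.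
by apply: quotient_dist_reverse; exact: trajectory_phase_space.
Qed.

Lemma J_phase_space g : billiard_trajectory K g -> O (g 0) ->
  phase_space K (J (g 0)).
Proof.
move=> tg Og; have [th <-] := J_trajectory tg Og; exact: trajectory_phase_space th.
Qed.

Let dist_bound g t (c : R) : billiard_trajectory K g -> O (g 0) ->
  `|0 - quotient_dist K (billiard_flow K (- T - t) z0) (billiard_flow K (- T - t) (g 0))| <= c ->
  `|0 - quotient_dist K (billiard_flow K t z0) (billiard_flow K t (J (g 0)))| <= c.
Proof.
move=> tg Og; have h := J_quotient_dist t tg Og.
rewrite (flow_Z (- T - t)) (flow_trajectory normal_unique (- T - t) tg _ erefl); last exact: O_free.
have hA : 0 <= quotient_dist K (Z (- T - t)) (g (- T - t)).
  by apply: quotient_dist_ge0; exact: trajectory_phase_space.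
have hB : 0 <= quotient_dist K (billiard_flow K t z0) (billiard_flow K t (J (g 0))).
  have [th h0] := J_trajectory tg Og.
  rewrite flow_Z (flow_trajectory normal_unique _ th (O_free (JO Og)) h0).
  exact: (quotient_dist_ge0 (trajectory_phase_space t Z_traj) (trajectory_phase_space t th)).
by rewrite !(distrC 0) !subr0 (ger0_norm hA) (ger0_norm hB); exact: le_trans h.
Qed.

Lemma unstable_to_stable e y : O y -> unstable_manifold K e z0 y ->
  stable_manifold K e z0 (J y).
Proof.
move=> Oy uy; have T0 := T_ge0; have [g tg gy] := unstable_trajectory Oy uy.
move: uy; rewrite -gy in Oy *; move=> [py close cvg0]; split.
- exact: J_phase_space.
- move=> t t0; apply: le_trans (J_quotient_dist t tg Oy) _.
  have := close (- T - t); rewrite flow_Z (flow_trajectory normal_unique _ tg (O_free Oy) erefl).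
  by apply; lra.
- apply/cvgrPdist_le => c c0; move/cvgrPdist_le : cvg0 => /(_ c c0) [M [_ hM]].
  exists (- T - M); split; first exact: num_real.
  by move=> t Mt; apply: dist_bound => //; apply: hM; lra.
Qed.

Lemma stable_to_unstable e : 0 < e ->
  \forall y \near z0, stable_manifold K e z0 y -> unstable_manifold K e z0 (J y).
Proof.
move=> e0; have T0 := T_ge0.
have nO : nbhs z0 O := open_nbhs_nbhs (conj openO Oz0).
pose P := [set y | O y -> forall g, billiard_trajectory K g -> g 0 = y ->
  forall t, - T <= t -> t <= 0 -> quotient_dist K (Z t) (g t) <= e].
have nP : nbhs (J z0) P by rewrite Jz0; exact: Z_near.
have nJ : \forall y \near z0, P (J y) by exact: J_cont nP.
apply: filterS (filterI nO nJ) => y [Oy near_y] sy.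
have [g tg gy] := stable_trajectory Oy sy.
move: sy near_y; rewrite -gy in Oy *; move=> [py close cvg0] near_y; split.
- exact: J_phase_space.
- move=> t t0; have [tT|Tt] := leP t (- T).
    apply: le_trans (J_quotient_dist t tg Oy) _.
    have := close (- T - t); rewrite flow_Z (flow_trajectory normal_unique _ tg (O_free Oy) erefl).
    by apply; lra.
  have [th h0] := J_trajectory tg Oy; have OJ := JO Oy.
  rewrite flow_Z (flow_trajectory normal_unique _ th (O_free (JO Oy)) h0).
  by apply: (near_y OJ _ th h0) => //; exact: ltW.
- apply/cvgrPdist_le => c c0; move/cvgrPdist_le : cvg0 => /(_ c c0) [M [_ hM]].
  exists (- T - M); split; first exact: num_real.
  by move=> t Mt; apply: dist_bound => //; apply: hM; lra.
Qed.

Lemma nonwandering_J e y : O y -> unstable_manifold K e z0 y ->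
  nonwandering K y -> nonwandering K (J y).
Proof.
move=> Oy /(unstable_trajectory Oy) [g tg gy].
rewrite -gy in Oy *; move=> [py [M [_ bM]]]; split; first exact: J_phase_space.
exists (Num.max M 1); split; first exact: num_real.
move=> B; rewrite gt_max => /andP[MB B1] _ [t _ <-].
have [th h0] := J_trajectory tg Oy.
rewrite (flow_trajectory normal_unique _ th (O_free (JO Oy)) h0).
rewrite /= [leLHS]prod_normE ge_max; apply/andP; split.
  have gA : [set billiard_flow K t (g 0) | t in [set: R]] (g (- T - t)).
    exists (- T - t) => //; exact: (flow_trajectory normal_unique _ tg (O_free Oy) erefl).
  by have := bM B MB _ gA; rewrite /= [leLHS]prod_normE ge_max => /andP[].
rewrite /= normrN; apply: le_trans (ler_norm_enorm _) _.
have [_ v1] := trajectory_phase_space (- T - t) tg.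
by rewrite enorm_incoming v1 ltW.
Qed.

End Reversal_symmetry.

Section Curves.
Context {R : realType} {V : normedModType R}.

Lemma curve_quotient_cvg (c : R^o -> V) : differentiable c 0 ->
  s^-1 *: (c s - c 0) @[s --> (0 : R)^'] --> 'd c 0 1.
Proof.
move=> dc; have := diff_derivable (v := (1 : R^o)) dc; rewrite -deriveE // /derivable /derive.
rewrite (_ : (fun h : R^o => _) = fun s => s^-1 *: (c s - c 0)) //.
by apply/funext => s; rewrite /= addr0; congr (_ *: (c _ - _)); exact: mulr1.
Qed.

Lemma near_curve (c : R^o -> V) (I : set R^o) (A : set V) : differentiable c 0 ->
  open I /\ I 0 -> open A /\ A (c 0) -> \forall s \near (0 : R), A (c s) /\ I s.
Proof.
move=> /differentiable_continuous cc oI oA.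
have nA : nbhs (0 : R) (c @^-1` A) by exact: cc (open_nbhs_nbhs oA).
exact: (filterI nA (open_nbhs_nbhs oI)).
Qed.

Lemma punctured_both_sides (P : set R) : (\forall s \near (0 : R)^', P s) ->
  (exists2 s, 0 < s & P s) /\ (exists2 s, s < 0 & P s).
Proof.
move=> [e /= e0 he]; have e2 : 0 < e / 2 by rewrite divr_gt0.
split; [exists (e / 2) | exists (- (e / 2))] => //; try by rewrite oppr_lt0.
  by apply: he => /=; [rewrite sub0r normrN gtr0_norm; lra | rewrite gt_eqF].
by apply: he => /=; [rewrite sub0r opprK gtr0_norm; lra | rewrite oppr_eq0 gt_eqF].
Qed.

Lemma cvg_le0 {T : Type} {F : set_system T} {FF : ProperFilter F} (f : T -> R) (l : R) :
  f @ F --> l -> (\forall x \near F, f x <= 0) -> l <= 0.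
Proof.
move=> fl f0; rewrite leNgt; apply/negP => l0.
have fpos : \forall x \near F, 0 < f x by exact: (fl _ (lt_nbhsr l0)).
by have [x [h1 h2]] := filter_ex (filterI f0 fpos); move: h1; rewrite leNgt h2.
Qed.

Lemma cvg_fst_comp {T : Type} {W : normedModType R} {F : set_system T} {FF : Filter F}
  (g : T -> V * W) (x : (V * W)%type) : g @ F --> x -> (g t).1 @[t --> F] --> x.1.
Proof.
move=> gx; apply: (@cvg_comp _ _ _ g fst _ _ _ gx); exact: cvg_fst.
Qed.

Lemma cvg_snd_comp {T : Type} {W : normedModType R} {F : set_system T} {FF : Filter F}
  (g : T -> V * W) (x : (V * W)%type) : g @ F --> x -> (g t).2 @[t --> F] --> x.2.
Proof.
move=> gx; apply: (@cvg_comp _ _ _ g snd _ _ _ gx); exact: cvg_snd.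
Qed.

End Curves.

Section Base_orbit.
Context {R : realType} {n k0 : nat} {Kc : 'I_k0 -> set 'rV[R]_n}.
Hypothesis convex_Kc : forall i, strictly_convex_domain (Kc i).
Hypothesis disjoint_Kc : forall i j, i != j -> Kc i `&` Kc j = set0.
Hypothesis no_eclipse : forall i j l, i != j -> l != i -> l != j ->
  convex_hull (Kc i `|` Kc j) `&` Kc l = set0.
Local Notation K := (\bigcup_i Kc i).

Context {i0 i1 : 'I_k0} {q0 q1 : 'rV[R]_n}.
Hypothesis i01 : i0 != i1.
Hypothesis Kq0 : Kc i0 q0.
Hypothesis Kq1 : Kc i1 q1.
Hypothesis closest : forall p0 p1, Kc i0 p0 -> Kc i1 p1 ->
  enorm (q1 - q0) <= enorm (p1 - p0).

Let d := enorm (q1 - q0).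
Let m := d^-1 *: (q1 - q0).
Local Notation Z := (@zigzag R n q0 q1).
Local Notation bounce := (@bounce_time R n q0 q1).

Context {U : set 'rV[R]_n} {f : 'rV[R]_n -> R^o} {r tau delta : R}.
Hypothesis chart : boundary_chart K q0 U f.
Hypothesis nuE : m = unit_normal f q0.
Hypothesis transverse : forall x v, `|x - q0| < r -> `|v - m| < r ->
  U x /\ 0 < dot v (grad f x).
Hypothesis tau_gt0 : 0 < tau.
Hypothesis tau_lt : 4 * tau < d.
Hypothesis delta_gt0 : 0 < delta.
Hypothesis delta_lt : delta + 4 * tau + 3 * tau * delta < r.

Local Notation z0 := (q0 + tau *: m, m).
Local Notation O := (@collision_domain R n q0 m f tau delta).
Local Notation J := (@reversal R n f tau).
Let O2 : set (phase R n) := O `&` [set y | O (J y)].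
Let Z0 (t : R) : phase R n := Z (t + tau).

Local Notation col L := (L chart nuE transverse tau_gt0 delta_gt0 delta_lt).

Let d_gt0 : 0 < d.
Proof. exact: (gap_gt0 disjoint_Kc i01 Kq0 Kq1). Qed.

Let m1 : enorm m = 1.
Proof. exact: (enorm_axis disjoint_Kc i01 Kq0 Kq1). Qed.

Let normals := table_normal_unique convex_Kc disjoint_Kc.

Let onormal0 : outward_normal K q0 m.
Proof. exact: (outward_normal0 convex_Kc disjoint_Kc i01 Kq0 Kq1 closest). Qed.

Let bounceS (k : int) : (bounce (k, true) = bounce (k, false) + d) *
  (bounce (k + 1, false) = bounce (k, true) + d).
Proof. exact: bounce_timeS. Qed.

Let bounce00 : bounce (0, false) = 0.
Proof. by rewrite /bounce_time /= mul0r addr0. Qed.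

Let Z_bounce k : Z (bounce k) = if k.2 then (q1, - m) else (q0, m).
Proof. exact: (zigzag_bounce disjoint_Kc i01 Kq0 Kq1). Qed.

Lemma base_domain_free y : O y -> ~ bdry K y.1.
Proof.
have t0 := tau_gt0; move=> [yb [f0 _]] /(bdry_mem (closed_table convex_Kc)).
have h0 : `|0 : R| <= 3 * tau by rewrite normr0; lra.
have [Uy _] := col ray_transverse yb h0.
by rewrite ray0 in Uy; have [_ _ _ _ Kf] := chart; move=> /(Kf _ Uy); rewrite leNgt f0.
Qed.

Lemma base_domain_z0 : O2 z0.
Proof.
have Oz := col collision_domain_z0.
by split => //=; rewrite (col reversal_z0).
Qed.

Lemma reversal_cont y : O y -> {for y, continuous J}.
Proof.
by move=> Oy; apply: differentiable_continuous; have [] := col C1_on_reversal Oy.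
Qed.

Lemma open_base_domain : open O2.
Proof.
have oO : open O := col open_collision_domain.
rewrite openE => y [Oy OJy]; apply: filterI; first exact: (open_nbhs_nbhs (conj oO Oy)).
exact: (reversal_cont Oy (open_nbhs_nbhs (conj oO OJy))).
Qed.

Lemma reversal_base_domain y : O2 y -> O2 (J y).
Proof.
move=> [Oy OJy]; split; first exact: OJy.
have E : J (J y) = y := col reversalK Oy OJy.
by rewrite /mkset E.
Qed.

Lemma base_path g t : billiard_trajectory K g -> O2 (g 0) ->
  - (3 * tau) <= t -> t <= 0 -> g t = (@collision_path R n f tau) (g 0) t.
Proof. by move=> tg [Og OJg]; exact: (col collision_trajectory normals). Qed.

Lemma base_path_before g t : billiard_trajectory K g -> O2 (g 0) ->
  - (3 * tau) <= t -> t <= - (2 * tau) ->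
  g t = free_motion (flip (J (g 0))) (t + 2 * tau).
Proof.
have t0 := tau_gt0; move=> tg Og t3 t2; rewrite base_path //; last lra.
exact: (col collision_path_before) Og.1 t2.
Qed.

Lemma reversal_flow g : billiard_trajectory K g -> O2 (g 0) ->
  g (- (2 * tau)) = flip (J (g 0)).
Proof.
have t0 := tau_gt0; move=> tg Og.
rewrite base_path_before //; last lra.
by rewrite addNr free_motion0.
Qed.

Lemma base_trajectory : billiard_trajectory K Z0.
Proof.
apply: (shift_trajectory normals).
exact: (zigzag_trajectory convex_Kc disjoint_Kc no_eclipse i01 Kq0 Kq1 closest).
Qed.

Lemma base_point : Z0 0 = z0.
Proof.
have t0 := tau_gt0; have tl := tau_lt; rewrite /Z0 add0r.
have b0 := bounce00.
rewrite (zigzag_up disjoint_Kc i01 Kq0 Kq1 (k := 0)) ?bounceS ?b0 -/d -/m ?subr0 //.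
  exact: ltW.
by rewrite add0r; lra.
Qed.

Lemma base_phase_space : phase_space K z0.
Proof. by rewrite -base_point; have [] := base_trajectory 0. Qed.

Lemma base_moves y : phase_space K y -> exists2 c, 0 < c &
  forall M, (exists2 t, t < M & c < quotient_dist K (Z0 t) y) /\
            (exists2 t, M < t & c < quotient_dist K (Z0 t) y).
Proof.
have d0 := d_gt0; move=> py; exists (d / 4); first by lra.
have d2 : 0 < 2 * d by lra.
have far : exists b, forall k, d / 4 < quotient_dist K (Z0 (bounce (k, b) - tau)) y.
  have dist k b : enorm ((if b then q1 else q0) - y.1) <=
      quotient_dist K (Z0 (bounce (k, b) - tau)) y.
    have pZ : phase_space K (Z0 (bounce (k, b) - tau)).
      by have [] := base_trajectory (bounce (k, b) - tau).
    apply: le_trans (quotient_dist_foot pZ py).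
    by rewrite /Z0 subrK Z_bounce /=; case: b {pZ}.
  have : d <= enorm (q1 - y.1) + enorm (q0 - y.1).
    rewrite (enormBC q0) /d -(subrKA y.1); exact: ler_enormD.
  have [h|h] := ltP (d / 4) (enorm (q1 - y.1)); [exists true | exists false] => k.
    by apply: lt_le_trans h (dist k true).
  by apply: lt_le_trans (dist k false); lra.
have [b hb] := far => M; pose k := Num.floor ((M + tau) / (2 * d)).
have /andP[k1 k2] := floor_itv ((M + tau) / (2 * d)).
rewrite -/k ler_pdivlMr // in k1; rewrite -/k ltr_pdivrMr // intrD mulrDl mul1r in k2.
split.
  exists (bounce (k - 1, b) - tau) => //; rewrite /bounce_time /= intrD mulrDl.
  by case: b {hb}; rewrite -/d; lra.
exists (bounce (k + 1, b) - tau) => //; rewrite /bounce_time /= intrD mulrDl.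
by case: b {hb}; rewrite -/d; lra.
Qed.

Let hit := (@hit R n f tau).
Let hit_time := (@hit_time R n f tau).
Let bounced := (@bounced R n f tau).

Let near_enorm (F : phase R n -> 'rV[R]_n) (a : 'rV[R]_n) (eta : R) : 0 < eta ->
  F y @[y --> (z0 : phase R n)] --> a -> \forall y \near (z0 : phase R n), enorm (F y - a) < eta.
Proof.
move=> eta0 Fa.
have h : enorm (F y - a) @[y --> (z0 : phase R n)] --> enorm (a - a).
  by apply: cvg_enorm; apply: cvgB => //; exact: cvg_cst.
have h0 : enorm (a - a) < eta by rewrite subrr enorm0.
exact: (h _ (lt_nbhsl h0)).
Qed.

Lemma base_close y eta t : O2 y -> phase_space K y -> 0 < eta ->
  enorm (hit y - q0) < eta -> `|hit_time y - tau| < eta ->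
  enorm (y.2 - m) < eta -> enorm (bounced y + m) < eta ->
  - (2 * tau) <= t -> t <= 0 ->
  phase_space K (@collision_path R n f tau z0 t) ->
  phase_space K (@collision_path R n f tau y t) ->
  quotient_dist K (@collision_path R n f tau z0 t) (@collision_path R n f tau y t) <= (4 + tau) * eta.
Proof.
move=> Oy [_ y1] eta0 hy ry vy by_ t2 t0 pz py; have tg := tau_gt0.
have timez : hit_time z0 = tau := col hit_time_z0.
have hitz : hit z0 = q0 := col hit_z0.
have bz : bounced z0 = - m := col bounced_z0.
have b1 : enorm (bounced y) = 1 by rewrite /bounced (col enorm_bounced Oy.1).
have qz : exterior K q0 := exterior_bdry (outward_normal_bdry onormal0).
have pm : phase_space K (q0, m) by split.
have pmN : phase_space K (q0, - m) by split => //=; rewrite enormN.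
have id1 : ident K (q0, m) (q0, - m).
  right; split => //; exists m; split => //=.
  rewrite /reflect_vec (dot_enorm1 m1); apply/rowP => i; rewrite !mxE; ring.
have id2 : ident K (q0, - m) (q0, m).
  right; split => //; exists m; split => //=.
  rewrite /reflect_vec dotNl (dot_enorm1 m1); apply/rowP => i; rewrite !mxE; ring.
have straight (u v : 'rV[R]_n) : enorm v = 1 -> enorm (v - u) < eta ->
    `|t + tau| <= tau -> penorm ((q0 + (t + tau) *: u, u) -
       (hit y + (t + hit_time y) *: v, v)) <= (4 + tau) * eta.
  move=> v1 uv tt; apply: le_trans (ler_penorm _) _ => /=.
  have -> : q0 + (t + tau) *: u - (hit y + (t + hit_time y) *: v) =
      (q0 - hit y) + ((t + tau) *: (u - v) + (tau - hit_time y) *: v).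
    by apply/rowP => i; rewrite !mxE; ring.
  have h1 := ler_enormD (q0 - hit y) ((t + tau) *: (u - v) + (tau - hit_time y) *: v).
  have h2 := ler_enormD ((t + tau) *: (u - v)) ((tau - hit_time y) *: v).
  rewrite !enormZ v1 mulr1 in h2.
  have h3 : `|t + tau| * enorm (u - v) <= tau * eta.
    by apply: ler_pM => //; [exact: enorm_ge0 | rewrite enormBC ltW].
  move: h1 h2 h3 hy ry uv; rewrite (enormBC q0) (enormBC u v) (distrC tau); lra.
have mixed (u v : 'rV[R]_n) : enorm u = 1 -> enorm v = 1 -> enorm (v + u) < eta ->
    `|t + tau| < eta -> `|t + hit_time y| < eta ->
    penorm ((q0 + (t + tau) *: u, u) - (q0, u)) +
    penorm ((q0, - u) - (hit y + (t + hit_time y) *: v, v)) <= (4 + tau) * eta.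
  move=> u1 v1 uv tt tr.
  have h1 : penorm ((q0 + (t + tau) *: u, u) - (q0, u)) <= `|t + tau|.
    apply: le_trans (ler_penorm _) _.
    by rewrite /= [q0 + _]addrC addrK subrr enorm0 enormZ u1 mulr1 addr0.
  have h2 : penorm ((q0, - u) - (hit y + (t + hit_time y) *: v, v)) <=
      enorm (q0 - hit y) + `|t + hit_time y| + enorm (v + u).
    apply: le_trans (ler_penorm _) _; rewrite /= opprD addrA lerD //.
      by apply: le_trans (ler_enormB _ _) _; rewrite enormZ v1 mulr1.
    by rewrite -enormN opprD !opprK addrC.
  have te : 0 < tau * eta by rewrite mulr_gt0.
  move: h1 h2 hy uv tt tr te; rewrite (enormBC q0); lra.
have zE : @collision_path R n f tau z0 t = if - tau <= t then (q0 + (t + tau) *: m, m)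
    else (q0 + (t + tau) *: - m, - m).
  by rewrite /collision_path -/(hit_time z0) -/(hit z0) -/(bounced z0) timez hitz bz.
have yE : @collision_path R n f tau y t = if - hit_time y <= t then (hit y + (t + hit_time y) *: y.2, y.2)
    else (hit y + (t + hit_time y) *: bounced y, bounced y) by [].
rewrite zE yE in pz py *; move: ry; rewrite ltr_norml => /andP[r1 r2].
have [tz|tz] := leP (- tau) t; have [ty|ty] := leP (- hit_time y) t.
- rewrite tz ty in pz py *; apply: le_trans (straight _ _ y1 vy _); last by rewrite ler_norml; lra.
  by apply: quotient_dist_le; exact: quotient_chain_jump.
- have ty' : (- hit_time y <= t) = false by apply/negbTE; rewrite -ltNge.
  rewrite tz ty' in pz py *.
  apply: le_trans (mixed _ _ m1 b1 by_ _ _); [|rewrite ltr_norml; lra..].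
  by apply: quotient_dist_le; exact: quotient_chain_jump2.
- have tz' : (- tau <= t) = false by apply/negbTE; rewrite -ltNge.
  rewrite tz' ty in pz py *.
  have mN1 : enorm (- m) = 1 by rewrite enormN.
  apply: le_trans (mixed _ _ mN1 y1 vy _ _); [|rewrite ltr_norml; lra..].
  by rewrite opprK; apply: quotient_dist_le; exact: quotient_chain_jump2.
- have tz' : (- tau <= t) = false by apply/negbTE; rewrite -ltNge.
  have ty' : (- hit_time y <= t) = false by apply/negbTE; rewrite -ltNge.
  rewrite tz' ty' in pz py *.
  have bm : enorm (bounced y - - m) < eta by rewrite opprK.
  apply: le_trans (straight _ _ b1 bm _); last by rewrite ler_norml; lra.
  by apply: quotient_dist_le; exact: quotient_chain_jump.
Qed.

Lemma base_near e : 0 < e -> \forall y \near (z0 : phase R n), O2 y ->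
  forall g, billiard_trajectory K g -> g 0 = y ->
  forall t, - (2 * tau) <= t -> t <= 0 -> quotient_dist K (Z0 t) (g t) <= e.
Proof.
move=> e0; have tg := tau_gt0; pose eta := e / (4 + tau).
have t4 : 0 < 4 + tau by lra.
have eta0 : 0 < eta by rewrite divr_gt0.
have Oz := base_domain_z0.
have nh : \forall y \near (z0 : phase R n), enorm (hit y - q0) < eta.
  by apply: near_enorm => //; have := col cvg_hit Oz.1; rewrite (col hit_z0).
have nr : \forall y \near (z0 : phase R n), `|hit_time y - tau| < eta.
  have := col hit_time_continuous Oz.1; rewrite (col hit_time_z0) => /cvgrPdist_lt /(_ eta eta0).
  by apply: filterS => y; rewrite distrC.
have nv : \forall y \near (z0 : phase R n), enorm (y.2 - m) < eta.
  by apply: near_enorm => //; exact: cvg_snd.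
have nb : \forall y \near (z0 : phase R n), enorm (bounced y - - m) < eta.
  apply: near_enorm => //; rewrite -(col bounced_z0).
  by apply: differentiable_continuous; have [] := col C1_on_bounced Oz.1.
apply: filterS (filterI (filterI nh nr) (filterI nv nb)) => y [[hy ry] [vy by_]] Oy.
move=> g gt gy t t2 t0.
have OZ : O2 (Z0 0) by rewrite base_point.
have [py pz] : phase_space K (g t) /\ phase_space K (Z0 t).
  by split; [have [] := gt t | have [] := base_trajectory t].
have py0 : phase_space K y by rewrite -gy; have [] := gt 0.
have t3 : - (3 * tau) <= t by lra.
rewrite -gy in Oy; rewrite (base_path gt Oy t3 t0) (base_path base_trajectory OZ t3 t0) in py pz *.
rewrite base_point gy in py pz Oy *.
have -> : e = (4 + tau) * eta by rewrite mulrC divfK // gt_eqF.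
by apply: base_close => //; rewrite -[m]opprK.
Qed.

Let base_free y : O2 y -> ~ bdry K y.1.
Proof. by move=> [Oy _]; exact: base_domain_free. Qed.

Let T_ge0 : 0 <= 2 * tau.
Proof. by have t0 := tau_gt0; lra. Qed.

Let J_cont0 : {for (z0 : phase R n), continuous J}.
Proof. exact: reversal_cont base_domain_z0.1. Qed.

Lemma base_flow t : billiard_flow K t z0 = Z0 t.
Proof. exact: (flow_Z normals base_free base_domain_z0 base_trajectory base_point). Qed.

Lemma base_unstable_trajectory e y : O2 y -> unstable_manifold K e z0 y ->
  exists2 g, billiard_trajectory K g & g 0 = y.
Proof.
exact: (unstable_trajectory normals base_free base_domain_z0 base_trajectory
  base_point base_moves).
Qed.

Lemma base_unstable_to_stable e y : O2 y -> unstable_manifold K e z0 y ->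
  stable_manifold K e z0 (J y).
Proof.
exact: (unstable_to_stable normals T_ge0 base_free base_domain_z0 reversal_base_domain
  (col reversal_z0) reversal_flow base_trajectory base_point base_moves).
Qed.

Lemma base_stable_to_unstable e : 0 < e ->
  \forall y \near (z0 : phase R n), stable_manifold K e z0 y -> unstable_manifold K e z0 (J y).
Proof.
exact: (stable_to_unstable normals T_ge0 base_free base_domain_z0 open_base_domain
  reversal_base_domain (col reversal_z0) J_cont0 reversal_flow base_trajectory
  base_point base_moves base_near).
Qed.

Lemma base_nonwandering_J e y : O2 y -> unstable_manifold K e z0 y ->
  nonwandering K y -> nonwandering K (J y).
Proof.
exact: (nonwandering_J normals base_free base_domain_z0 reversal_base_domain
  reversal_flow base_trajectory base_point base_moves).
Qed.

Lemma nonwandering_base : nonwandering K z0.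
Proof.
split; first exact: base_phase_space.
exists (`|q0| + d + 1); split; first exact: num_real.
move=> B MB _ [t _ <-]; rewrite base_flow /Z0 /= [leLHS]prod_normE ge_max.
have d0 := d_gt0; have q00 : 0 <= `|q0| by exact: normr_ge0.
apply/andP; split.
  have [rho [/andP[rho0 rhod] -> _ _]] := zigzag_segment disjoint_Kc i01 Kq0 Kq1 (t + tau).
  rewrite -/d -/m; have h := ler_normD q0 (rho *: m); move: h.
  have -> : `|rho *: m| = rho * `|m| by rewrite (normrZ rho m) ger0_norm.
  have : rho * `|m| <= d * 1.
    by apply: ler_pM => //; have := ler_norm_enorm m; rewrite m1.
  lra.
have [[_ v1] _ _] := base_trajectory t.
by apply: le_trans (ler_norm_enorm _) _; move: v1; rewrite /Z0 => ->; lra.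
Qed.

Lemma base_compare e y : 0 < e -> 8 * e < d -> 3 * e < tau ->
  (forall l, l != i0 -> l != i1 ->
   forall rho p, 0 <= rho <= d -> Kc l p -> e < enorm (q0 + rho *: m - p)) ->
  O2 y -> unstable_manifold K e z0 y ->
  dot (y.1 - (q0 + tau *: m)) m <= 0 /\
  dot ((J y).2 - m) ((J y).1 - (q0 + tau *: m) + tau *: ((J y).2 - m)) <= 0.
Proof.
move=> e0 es et e_far Oy uy; have [g tg gy] := base_unstable_trajectory Oy uy.
have t0 := tau_gt0; have tl := tau_lt.
pose Y t := g (t - tau).
have Yt : billiard_trajectory K Y by exact: (shift_trajectory normals).
have ZE t : Z t = Z0 (t - tau) by rewrite /Z0 subrK.
have foot t : enorm ((Z t).1 - (Y t).1) <=
    quotient_dist K (billiard_flow K (t - tau) z0) (billiard_flow K (t - tau) y).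
  rewrite base_flow (flow_trajectory normals _ tg (base_free Oy) gy) ZE.
  have [pz _ _] := base_trajectory (t - tau); have [pg _ _] := tg (t - tau).
  exact: quotient_dist_foot.
have [_ close cvg0] := uy.
have near_tau t : t <= tau -> enorm ((Z t).1 - (Y t).1) <= e.
  by move=> tt; apply: le_trans (foot t) _; apply: close; lra.
have asym c : 0 < c -> exists M, forall t, t < M -> enorm ((Z t).1 - (Y t).1) <= c.
  move=> c0; move/cvgrPdist_le : cvg0 => /(_ c c0) [M [_ hM]].
  exists (M + tau) => t tM; apply: le_trans (foot t) _.
  have tM' : t - tau < M by lra.
  by have := hM _ tM'; rewrite distrC subr0; exact: le_trans (ler_norm _).
have out s : 3 * e < `|s| -> `|s| <= 2 * tau -> forall k, 3 * e < `|s - bounce k|.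
  move=> s1 s2 k.
  have [->|] := bounce_time_sep disjoint_Kc i01 Kq0 Kq1 k (0, false).
    by rewrite bounce00 subr0.
  rewrite bounce00 subr0 -/d => h.
  have := ler_normB s (s - bounce k); rewrite opprB addrC subrK; lra.
have compare s : s <= tau -> 3 * e < `|s| -> `|s| <= 2 * tau ->
    dot (Y s).2 ((Z s).1 - (Y s).1) <= 0 /\ dot (Z s).2 ((Y s).1 - (Z s).1) <= 0.
  move=> st s1 s2; apply: (shadow_compare convex_Kc disjoint_Kc no_eclipse i01 Kq0 Kq1
    closest e0 es e_far Yt _ (out s s1 s2) asym) => t ts.
  by apply: near_tau; exact: le_trans ts st.
have [|||_] := compare tau; [by []|rewrite gtr0_norm; lra|rewrite gtr0_norm; lra|].
have Ytau : Y tau = y by rewrite /Y subrr.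
have Ztau : Z tau = z0 by rewrite ZE subrr base_point.
rewrite Ytau Ztau /= dotC => ineq0; split => //.
have [|||] := compare (- (2 * tau)); [lra|rewrite normrN gtr0_norm; lra|rewrite normrN gtr0_norm; lra|].
have Og : O2 (g 0) by rewrite gy.
have OZ : O2 (Z0 0).
  rewrite base_point; exact: base_domain_z0.
have back g' : billiard_trajectory K g' -> O2 (g' 0) ->
    g' (- (2 * tau) - tau) = free_motion (flip (J (g' 0))) (- tau).
  move=> tg' Og'; have E : - (2 * tau) - tau + 2 * tau = - tau by lra.
  have lo : - (3 * tau) <= - (2 * tau) - tau by lra.
  have hi : - (2 * tau) - tau <= - (2 * tau) by lra.
  by have := base_path_before tg' Og' lo hi; rewrite E.
have YE : Y (- (2 * tau)) = free_motion (flip (J y)) (- tau).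
  by rewrite -gy; exact: back tg Og.
have ZE2 : Z (- (2 * tau)) = free_motion (flip z0) (- tau).
  by rewrite ZE (back _ base_trajectory OZ) base_point (col reversal_z0).
rewrite YE ZE2 /free_motion /flip /=.
set P := (J y).1 - (q0 + tau *: m) + tau *: ((J y).2 - m).
have PE : (J y).1 + - tau *: - (J y).2 - (q0 + tau *: m + - tau *: - m) = P.
  by rewrite /P; apply/rowP => i; rewrite !mxE; ring.
have PE' : q0 + tau *: m + - tau *: - m - ((J y).1 + - tau *: - (J y).2) = - P.
  by rewrite -PE opprB.
rewrite PE PE' => -[h1 h2]; rewrite dotNl dotNr opprK in h1; rewrite dotNl in h2.
rewrite dotBl; lra.
Qed.

Let D : phase R n -> phase R n := 'd J (z0 : phase R n).

Lemma base_unstable_cone (b : phase R n) : unstable_space K z0 b ->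
  [/\ dot b.1 m = 0, dot b.2 m = 0 & dot (D b).2 ((D b).1 + tau *: (D b).2) <= 0].
Proof.
move=> ub; have d0 := d_gt0; have t0 := tau_gt0.
have ne0 : \forall e \near (0 : R)^'+, 0 < e by exact: nbhs_right_gt.
have ne1 : \forall e \near (0 : R)^'+, e < d / 8 by apply: nbhs_right_lt; lra.
have ne2 : \forall e \near (0 : R)^'+, e < tau / 3 by apply: nbhs_right_lt; lra.
have far := near_segment_far convex_Kc disjoint_Kc no_eclipse i01 Kq0 Kq1.
have [e [[[e0 e1] [e2 e_far]] [I [c [[oI I0] C1c c0 cb Ic]]]]] :=
  @filter_ex _ (at_right 0) _ _ (filterI (filterI (filterI ne0 ne1) (filterI ne2 far)) ub).
have [cd _] := C1c _ I0.
have c_cont : c s @[s --> (0 : R)] --> (z0 : phase R n).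
  by rewrite -c0; exact: differentiable_continuous.
have nOI : \forall s \near (0 : R), O2 (c s) /\ I s.
  have Oc0 : O2 (c 0) by rewrite c0; exact: base_domain_z0.
  exact: (near_curve cd (conj oI I0) (conj open_base_domain Oc0)).
have nOI' : \forall s \near (0 : R)^', O2 (c s) /\ I s by exact: cvg_within nOI.
have Q1 : s^-1 *: (c s - z0) @[s --> (0 : R)^'] --> b.
  by have := curve_quotient_cvg cd; rewrite cb c0.
have Jd : is_diff (c 0) J D.
  by rewrite c0; apply: differentiableP; have [] := col C1_on_reversal base_domain_z0.1.
have Jc := is_diff_comp (differentiableP cd) Jd.
have Q2 : s^-1 *: (J (c s) - z0) @[s --> (0 : R)^'] --> D b.
  have := curve_quotient_cvg (@ex_diff _ _ _ _ _ _ _ Jc).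
  by rewrite (@diff_val _ _ _ _ _ _ _ Jc) /= cb c0 (col reversal_z0).
have ineq s : O2 (c s) -> I s ->
    dot ((c s).1 - (q0 + tau *: m)) m <= 0 /\
    dot ((J (c s)).2 - m) ((J (c s)).1 - (q0 + tau *: m) + tau *: ((J (c s)).2 - m)) <= 0.
  have e8 : 8 * e < d by lra.
  have e3 : 3 * e < tau by lra.
  by move=> Os /Ic; exact: (base_compare e0 e8 e3 e_far Os).
split.
- have L : s^-1 * dot ((c s).1 - (q0 + tau *: m)) m @[s --> (0 : R)^'] --> dot b.1 m.
    have -> : (fun s => s^-1 * dot ((c s).1 - (q0 + tau *: m)) m) =
        fun s => dot (s^-1 *: (c s - z0)).1 m.
      by apply/funext => s; rewrite dotZl.
    by apply: cvg_dot; [exact: cvg_fst_comp | exact: cvg_cst].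
  apply/eqP; rewrite eq_le !leNgt; apply/andP; split; apply/negP => bm.
    have pos := L _ (lt_nbhsr bm).
    have [[s s0 [[Os Is] /= h]] _] := punctured_both_sides (filterI nOI' pos).
    have [h' _] := ineq s Os Is; move: h; rewrite pmulr_rgt0 ?invr_gt0 //; lra.
  have neg := L _ (lt_nbhsl bm).
  have [_ [s s0 [[Os Is] /= h]]] := punctured_both_sides (filterI nOI' neg).
  have [h' _] := ineq s Os Is; move: h; rewrite nmulr_rlt0 ?invr_lt0 //; lra.
- have v_cvg : (c s).2 - m @[s --> (0 : R)^'] --> (0 : 'rV[R]_n).
    rewrite -(subrr m); apply: cvgB; last exact: cvg_cst.
    by apply: (cvg_snd_comp (x := z0)); exact: cvg_within_filter c_cont.
  have L : dot (s^-1 *: (c s - z0)).2 ((c s).2 - m) + 2 * dot (s^-1 *: (c s - z0)).2 m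
      @[s --> (0 : R)^'] --> dot b.2 0 + 2 * dot b.2 m.
    apply: cvgD; first by apply: cvg_dot => //; exact: cvg_snd_comp.
    apply: cvgM; first exact: cvg_cst.
    by apply: cvg_dot; [exact: cvg_snd_comp | exact: cvg_cst].
  have E : \forall s \near (0 : R)^', dot (s^-1 *: (c s - z0)).2 ((c s).2 - m) +
      2 * dot (s^-1 *: (c s - z0)).2 m = 0.
    apply: filterS nOI' => s [_ /Ic [[_ v1] _ _]].
    rewrite !dotZl !dotBl !dotBr (dot_enorm1 v1) (dot_enorm1 m1) (dotC m); ring.
  have L0 : dot (s^-1 *: (c s - z0)).2 ((c s).2 - m) + 2 * dot (s^-1 *: (c s - z0)).2 m
      @[s --> (0 : R)^'] --> (0 : R).
    by exact: cvg_near_cst E.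
  have E0 : dot b.2 0 + 2 * dot b.2 m = 0.
    by apply: cvg_unique L L0.
  by move: E0; rewrite dot0r; lra.
- have L : dot (s^-1 *: (J (c s) - z0)).2
      ((s^-1 *: (J (c s) - z0)).1 + tau *: (s^-1 *: (J (c s) - z0)).2)
      @[s --> (0 : R)^'] --> dot (D b).2 ((D b).1 + tau *: (D b).2).
    apply: cvg_dot; first exact: cvg_snd_comp.
    by apply: cvgD; [exact: cvg_fst_comp | apply: cvgZl_tmp; exact: cvg_snd_comp].
  apply: cvg_le0 L _; apply: filterS nOI' => s [Os Is].
  have [_ h] := ineq s Os Is.
  have -> : (s^-1 *: (J (c s) - z0)).1 + tau *: (s^-1 *: (J (c s) - z0)).2 =
     s^-1 *: ((J (c s)).1 - (q0 + tau *: m) + tau *: ((J (c s)).2 - m)).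
    have aux (k : R) (x y : 'rV[R]_n) : k *: x + tau *: (k *: y) = k *: (x + tau *: y).
      by rewrite scalerDr !scalerA mulrC.
    exact: aux.
  by rewrite /= dotZl dotZr mulrA mulr_ge0_le0 // -expr2 sqr_ge0.
Qed.

End Base_orbit.

Section Chart_estimates.
Context {R : realType} {n : nat} {A U : set 'rV[R]_n} {q : 'rV[R]_n}
  {f : 'rV[R]_n -> R^o}.
Hypothesis chart : boundary_chart A q U f.
Local Notation m := (unit_normal f q).
Local Notation S := ('d (unit_normal f) q : 'rV[R]_n -> 'rV[R]_n).

Let grad_cont : {for q, continuous (grad f)}.
Proof.
have [_ [oU Uq] C2f _ _] := chart.
by apply: differentiable_continuous; have [] := C1_on_grad oU C2f Uq.
Qed.

Let m_gradE : dot m (grad f q) = enorm (grad f q).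
Proof.
have [_ _ _ g0 _] := chart.
by rewrite /unit_normal dotZl -sqr_enorm expr2 mulKf // enorm_eq0.
Qed.

Lemma transverse_radius : exists2 r, 0 < r &
  forall x v, `|x - q| < r -> `|v - m| < r -> U x /\ 0 < dot v (grad f x).
Proof.
have [_ [oU Uq] _ g0 _] := chart.
have n1 : \forall x \near q, U x := open_nbhs_nbhs (conj oU Uq).
have n2 : \forall p \near (q, m), U p.1 by exact: (cvg_fst n1).
have c3 : dot p.2 (grad f p.1) @[p --> (q, m)] --> dot m (grad f q).
  apply: cvg_dot; first exact: cvg_snd.
  apply: (@cvg_comp _ _ _ fst (grad f) _ _ _ cvg_fst); exact: grad_cont.
have pos : 0 < dot m (grad f q) by rewrite m_gradE enorm_gt0.
have n3 : \forall p \near (q, m), 0 < dot p.2 (grad f p.1) := c3 _ (lt_nbhsr pos).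
have n4 : nbhs ((q, m) : phase R n) [set p | U p.1 /\ 0 < dot p.2 (grad f p.1)].
  exact: filterI n2 n3.
move: n4 => /nbhs_ballP[e /= e0 he].
exists e; first exact: e0.
move=> x v xq vm; have b1 : ball q e x by rewrite -ball_normE /= distrC.
have b2 : ball m e v by rewrite -ball_normE /= distrC.
exact: he (x, v) (conj b1 b2).
Qed.

Let Sd : differentiable (unit_normal f) q.
Proof.
have [_ [oU Uq] C2f g0 _] := chart.
pose V := U `&` [set x | grad f x != 0].
have Vq : nbhs q V.
  apply: filterI; first exact: (open_nbhs_nbhs (conj oU Uq)).
  have cg : enorm (grad f x) @[x --> q] --> enorm (grad f q) by exact: cvg_enorm grad_cont.
  rewrite -enorm_gt0 in g0; have pos : \forall x \near q, 0 < enorm (grad f x) := cg _ (lt_nbhsr g0).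
  by apply: filterS pos => x /=; rewrite enorm_gt0.
have oV := @open_interior _ V.
have Vi x : V^° x -> U x /\ grad f x != 0 by exact: interior_subset.
have [] // := C1_on_unit_normal oV (fun x h => (Vi x h).2) _ (x := q).
by have [h1 h2] := C2f; split => [|v]; [apply: C1_onS h1 | apply: C1_onS (h2 v)] => x /Vi [].
Qed.

Let S_cont : continuous S.
Proof. exact: diff_continuous. Qed.

Lemma shape_operator_bound : exists2 M, 0 <= M & forall u, enorm (S u) <= M * enorm u.
Proof.
have [k k0 kS] := linear_lipschitz S_cont.
exists (n%:R * k) => [|u]; first by rewrite mulr_ge0 // ltW.
apply: le_trans (ler_enorm_norm _) _; rewrite -mulrA ler_wpM2l //.
apply: le_trans (kS u) _; rewrite ler_wpM2l ?ler_norm_enorm //; exact: ltW.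
Qed.

Lemma curvature_lower_bound : positive_curvature A -> exists2 kappa, 0 < kappa &
  forall u, dot u m = 0 -> kappa * dot u u <= dot (S u) u.
Proof.
move=> curv; pose C := [set u : 'rV[R]_n | enorm u = 1 /\ dot u m = 0].
have normalize (u : 'rV[R]_n) : u != 0 -> dot u m = 0 ->
    C ((enorm u)^-1 *: u) /\ u = enorm u *: ((enorm u)^-1 *: u).
  move=> u0 um; have e0 : enorm u != 0 by rewrite enorm_eq0.
  split; last by rewrite scalerA divff // scale1r.
  split; last by rewrite dotZl um mulr0.
  by rewrite enormZ ger0_norm ?invr_ge0 ?enorm_ge0 // mulVf.
have [C0|/set0P C0] := eqVneq C set0.
  exists 1 => // u um; have [->|u0] := eqVneq u 0; first by rewrite !dot0r mulr0.
  by have [] := normalize u u0 um; rewrite C0.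
have C_cpt : compact C.
  apply: bounded_closed_compact.
    exists 1; split; first exact: num_real.
    by move=> B B1 u [u1 _]; apply: le_trans (ler_norm_enorm u) _; rewrite u1 ltW.
  have -> : C = (@enorm R n @^-1` [set 1]) `&` ((fun u => dot u m) @^-1` [set 0]) by [].
  apply: closedI; apply: closed_comp; try exact: closed_eq.
    by move=> u _; apply: (@cvg_enorm R n _ (nbhs u) _ id u); exact: cvg_id.
  move=> u _; apply: (@cvg_dot R n _ (nbhs u) _ id (fun=> m)); first exact: cvg_id.
  exact: cvg_cst.
have F_cont : {within C, continuous (fun u => dot (S u) u)}.
  apply: continuous_subspaceT => u.
  apply: (@cvg_dot R n _ (nbhs u) _ S id); last exact: cvg_id.
  exact: S_cont.
have [c] := compact_EVT_min C0 C_cpt F_cont; rewrite inE => -[c1 cm] cmin.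
have c0 : c != 0 by rewrite -enorm_eq0 c1 oner_eq0.
exists (dot (S c) c); first exact: (curv q U f chart).
move=> u um; have [->|u0] := eqVneq u 0; first by rewrite !dot0r mulr0.
have [Cu uE] := normalize u u0 um.
have := cmin _ (mem_set Cu); set w := (enorm u)^-1 *: u in Cu uE *.
have [w1 _] := Cu => le; have -> : S u = enorm u *: S w by rewrite {1}uE linearZ.
rewrite -sqr_enorm dotZl {3}uE dotZr mulrA -expr2 mulrC.
by rewrite ler_wpM2l // sqr_ge0.
Qed.

End Chart_estimates.

Section Transversality.
Context {R : realType} {n : nat}.
Implicit Types (b a : phase R n) (m u dv Su : 'rV[R]_n).

Lemma penormZ k b : penorm (k *: b) = `|k| * penorm b.
Proof.
rewrite /penorm /= !dotZl !dotZr !mulrA -mulrDr -expr2.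
by rewrite sqrtrM ?sqr_ge0 // sqrtr_sqr.
Qed.

Lemma dalphaZl k a b : dalpha (k *: a) b = k * dalpha a b.
Proof. by rewrite /dalpha /= !dotZl mulrDr mulrN. Qed.

Lemma cone_transversality m u dv Su a b tau M kappa C : enorm m = 1 -> 0 < tau ->
  0 <= M -> 0 < kappa -> dot u m = 0 -> u = b.1 - tau *: b.2 ->
  dv = b.2 - 2 *: Su - (2 * dot m Su) *: m ->
  enorm Su <= M * enorm u -> kappa * dot u u <= dot Su u ->
  2 * tau * dot dv dv <= dot dv u ->
  a = (u - tau *: dv, - dv) -> C = 1 + (1 + tau) * ((2 * tau)^-1 + 4 * M) ->
  2 * kappa / C ^+ 2 * penorm a * penorm b <= `|dalpha a b|.
Proof.
move=> m1 t0 M0 k0 um uE dvE SuM Suk cone aE CE.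
have u_ge := enorm_ge0 u; have v_ge := enorm_ge0 dv.
have t2 : 0 < 2 * tau by lra.
have iv0 : 0 <= (2 * tau)^-1 by rewrite invr_ge0 ltW.
have dv_le : enorm dv <= (2 * tau)^-1 * enorm u.
  rewrite mulrC ler_pdivlMr //.
  have [->|dv0] := eqVneq dv 0; first by rewrite enorm0 mul0r.
  have v_gt : 0 < enorm dv by rewrite enorm_gt0.
  rewrite -(ler_pM2l v_gt) mulrA -expr2 sqr_enorm [leLHS]mulrC; apply: le_trans cone _.
  exact: ler_dot.
have b2E : b.2 = dv + 2 *: Su + (2 * dot m Su) *: m.
  by rewrite dvE; apply/rowP => i; rewrite !mxE; ring.
have b1E : b.1 = u + tau *: b.2 by rewrite uE subrK.
have b2_le : enorm b.2 <= ((2 * tau)^-1 + 4 * M) * enorm u.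
  rewrite b2E; apply: le_trans (ler_enormD _ _) _.
  apply: le_trans (lerD (ler_enormD _ _) (lexx _)) _.
  rewrite !enormZ m1 mulr1 normrM normr_nat.
  have := ler_norm_dot m Su; rewrite m1 mul1r; lra.
have C1 : 1 <= C by rewrite CE lerDl mulr_ge0 //; [lra | rewrite addr_ge0 ?mulr_ge0].
have C_gt : 0 < C by lra.
have pb : penorm b <= C * enorm u.
  apply: le_trans (ler_penorm _) _.
  have : enorm b.1 <= enorm u + tau * enorm b.2.
    by rewrite b1E; apply: le_trans (ler_enormD _ _) _; rewrite enormZ gtr0_norm.
  have : (1 + tau) * enorm b.2 <= (1 + tau) * (((2 * tau)^-1 + 4 * M) * enorm u).
    by rewrite ler_pM2l //; lra.
  rewrite CE !mulrDl !mul1r; lra.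
have pa : penorm a <= C * enorm u.
  apply: le_trans (ler_penorm _) _; rewrite aE /= enormN.
  have : enorm (u - tau *: dv) <= enorm u + tau * enorm dv.
    by apply: le_trans (ler_enormB _ _) _; rewrite enormZ gtr0_norm.
  have : (1 + tau) * enorm dv <= (1 + tau) * ((2 * tau)^-1 * enorm u).
    by rewrite ler_pM2l //; lra.
  have : 0 <= (1 + tau) * (4 * M * enorm u) by rewrite !mulr_ge0 //; lra.
  rewrite CE !mulrDl !mulrDr !mulrDl !mul1r; lra.
have dE : dalpha a b = - (2 * dot dv u + 2 * dot Su u).
  rewrite aE /dalpha /= b1E dotBl dotNl dotDr !dotZl !dotZr.
  have -> : dot u b.2 = dot dv u + 2 * dot Su u.
    by rewrite b2E !dotDr !dotZr um (dotC u dv) (dotC u Su); lra.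
  lra.
have uu := dot_ge0 u.
have vu : 0 <= dot dv u by apply: le_trans cone; rewrite mulr_ge0 ?dot_ge0 // ltW.
have main : 2 * kappa * dot u u <= `|dalpha a b|.
  rewrite dE normrN ger0_norm; first lra.
  have := mulr_ge0 (ltW k0) uu; lra.
apply: le_trans main; rewrite -sqr_enorm.
have ab : penorm a * penorm b <= C ^+ 2 * enorm u ^+ 2.
  by rewrite -exprMn expr2; apply: ler_pM => //; exact: penorm_ge0.
have k2 : 0 <= 2 * kappa / C ^+ 2 by rewrite divr_ge0 ?sqr_ge0 //; lra.
rewrite -mulrA; apply: le_trans (ler_wpM2l k2 ab) _.
by rewrite mulrA divfK // expf_neq0 // gt_eqF.
Qed.

End Transversality.

Section Base_point.
Context {R : realType} {n k0 : nat} {Kc : 'I_k0 -> set 'rV[R]_n}.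
Hypothesis convex_Kc : forall i, strictly_convex_domain (Kc i).
Hypothesis disjoint_Kc : forall i j, i != j -> Kc i `&` Kc j = set0.
Hypothesis no_eclipse : forall i j l, i != j -> l != i -> l != j ->
  convex_hull (Kc i `|` Kc j) `&` Kc l = set0.
Local Notation K := (\bigcup_i Kc i).

Context {i0 i1 : 'I_k0} {q0 q1 : 'rV[R]_n}.
Hypothesis i01 : i0 != i1.
Hypothesis Kq0 : Kc i0 q0.
Hypothesis Kq1 : Kc i1 q1.
Hypothesis closest : forall p0 p1, Kc i0 p0 -> Kc i1 p1 ->
  enorm (q1 - q0) <= enorm (p1 - p0).

Let d := enorm (q1 - q0).
Let m := d^-1 *: (q1 - q0).

Context {U : set 'rV[R]_n} {f : 'rV[R]_n -> R^o} {r tau delta : R}.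
Hypothesis chart : boundary_chart K q0 U f.
Hypothesis nuE : m = unit_normal f q0.
Hypothesis transverse : forall x v, `|x - q0| < r -> `|v - m| < r ->
  U x /\ 0 < dot v (grad f x).
Hypothesis tau_gt0 : 0 < tau.
Hypothesis tau_lt : 4 * tau < d.
Hypothesis delta_gt0 : 0 < delta.
Hypothesis delta_lt : delta + 4 * tau + 3 * tau * delta < r.

Local Notation z0 := (q0 + tau *: m, m).
Local Notation O := (@collision_domain R n q0 m f tau delta).
Local Notation J := (@reversal R n f tau).
Let O2 : set (phase R n) := O `&` [set y | O (J y)].

Let D : phase R n -> phase R n := 'd J (z0 : phase R n).

Local Notation col L := (L chart nuE transverse tau_gt0 delta_gt0 delta_lt).
Local Notation orbit L := (L convex_Kc disjoint_Kc no_eclipse _ _ _ _ i01 Kq0 Kq1 closest _ _ _ _ _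
  chart nuE transverse tau_gt0 tau_lt delta_gt0 delta_lt).

Let finV : finite_dimensional (phase R n : normedModType R).
Proof. exact: (finite_dimensional_prod (finite_dimensional_rV n) (finite_dimensional_rV n)). Qed.

Let openO2 : open O2.
Proof. exact: (col open_base_domain). Qed.

Let O2z0 : O2 z0.
Proof. exact: (col base_domain_z0). Qed.

Let C1J : C1_on O2 (J : phase R n -> phase R n).
Proof.
have sub : O2 `<=` O by move=> y; case.
exact: C1_onS sub (col C1_on_reversal).
Qed.

Let JK y : O2 y -> J (J y) = y.
Proof. by case=> Oy OJy; exact: (col reversalK Oy OJy). Qed.

Let JO y : O2 y -> O2 (J y).
Proof. exact: (col reversal_base_domain). Qed.

Let Jz0 : J z0 = z0.
Proof. exact: (col reversal_z0). Qed.

Let nO2 : nbhs (z0 : phase R n) O2.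
Proof. exact: open_nbhs_nbhs (conj openO2 O2z0). Qed.

Lemma diff_reversal_unstable b : unstable_space K z0 b -> stable_space K z0 (D b).
Proof.
apply: filterS => e; apply: (tangent_space_transport finV openO2 O2z0 C1J Jz0).
by apply: filterS nO2 => y Oy; exact: ((orbit base_unstable_to_stable) e y Oy).
Qed.

Lemma diff_reversal_stable b : stable_space K z0 b -> unstable_space K z0 (D b).
Proof.
have pos : \forall e \near (0 : R)^'+, 0 < e by exact: nbhs_right_gt.
move=> sb; apply: filterS (filterI pos sb) => e [e0].
apply: (tangent_space_transport finV openO2 O2z0 C1J Jz0).
exact: ((orbit base_stable_to_unstable) _ e0).
Qed.

Lemma diff_reversal_unstable_tangent b : unstable_tangent K z0 b ->
  stable_tangent K z0 (D b).
Proof.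
have pos : \forall e \near (0 : R)^'+, 0 < e by exact: nbhs_right_gt.
move=> ub; apply: filterS (filterI pos ub) => e [e0 [E1b b0 [V [psi [param ex]]]]].
have W21 := (orbit base_stable_to_unstable) _ e0.
apply: (tangent_to_transport finV openO2 O2z0 JO JK C1J Jz0 diff_reversal_stable
  diff_reversal_unstable _ W21 param _ E1b b0 ex).
- by move=> y Oy; exact: ((orbit base_unstable_to_stable) e y Oy).
- by move=> y Oy; exact: ((orbit base_nonwandering_J) e y Oy).
Qed.

Lemma stable_space_scale k b : stable_space K z0 b -> stable_space K z0 (k *: b).
Proof. by apply: filterS => e; exact: tangent_space_scale. Qed.

Lemma stable_tangent_scale k b : k != 0 -> stable_tangent K z0 b ->
  stable_tangent K z0 (k *: b).
Proof.
move=> k_neq0; apply: filterS => e; apply: tangent_to_scale => // v.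
exact: stable_space_scale.
Qed.

Lemma base_transversality : exists2 mu, 0 < mu & forall b, unstable_space K z0 b ->
  mu * penorm (D b) * penorm b <= `|dalpha (D b) b|.
Proof.
have t0 := tau_gt0.
have [M M0 SM] := shape_operator_bound chart.
have [V chart0] := chart_of_table convex_Kc disjoint_Kc Kq0 chart.
have [_ _ _ _ curv] := convex_Kc i0.
have [kappa kappa0 Sk] := curvature_lower_bound chart0 curv.
pose C := 1 + (1 + tau) * ((2 * tau)^-1 + 4 * M).
have C_gt : 0 < C.
  have iv0 : 0 <= (2 * tau)^-1 by rewrite invr_ge0; lra.
  apply: ltr_wpDr => //; rewrite mulr_ge0 //; [lra | rewrite addr_ge0 ?mulr_ge0 //].
exists (2 * kappa / C ^+ 2) => [|b ub]; first by rewrite divr_gt0 ?exprn_gt0 //; lra.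
have [bm1 bm2 cone] := (orbit base_unstable_cone) _ ub.
pose u := b.1 - tau *: b.2; pose Su := 'd (unit_normal f) q0 u.
pose dv := b.2 - 2 *: Su - (2 * dot m Su) *: m.
have DE : D b = (u - tau *: dv, - dv) by exact: (col diff_reversal_z0 bm1 bm2).
have um : dot u m = 0 by rewrite /u dotBl dotZl bm1 bm2 mulr0 subr0.
have m1 : enorm m = 1 by exact: (enorm_axis disjoint_Kc i01 Kq0 Kq1).
apply: (cone_transversality m1 t0 M0 kappa0 um (erefl u) (erefl dv) (SM u)) => //.
  by apply: Sk; rewrite -nuE.
move: cone; rewrite -/D DE /= dotNl dotDr dotBr dotZr dotZr dotNr; lra.
Qed.

Lemma base_conclusion : exists2 mu, 0 < mu & forall b : phase R n, penorm b = 1 ->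
  unstable_space K z0 b -> unstable_tangent K z0 b ->
  exists a : phase R n, [/\ penorm a = 1, stable_space K z0 a, stable_tangent K z0 a
    & mu <= `|dalpha a b|].
Proof.
have [mu mu0 hmu] := base_transversality; exists mu => // b b1 ub ut.
have D0 : 0 < penorm (D b).
  rewrite lt_neqAle penorm_ge0 andbT eq_sym; apply/eqP => Db0.
  have b0 : b = 0.
    have Db : D b = 0.
      have [E1 E2] : enorm (D b).1 = 0 /\ enorm (D b).2 = 0.
        move: Db0; rewrite /penorm /enorm => /eqP; rewrite sqrtr_eq0 => le0.
        have h1 := dot_ge0 (D b).1; have h2 := dot_ge0 (D b).2.
        have -> : dot (D b).1 (D b).1 = 0 by lra.
        by have -> : dot (D b).2 (D b).2 = 0 by [lra]; rewrite sqrtr0.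
      by rewrite [D b]surjective_pairing; congr pair; apply/eqP; rewrite -enorm_eq0 ?E1 ?E2.
    by rewrite -(diff_involution openO2 O2z0 JK C1J Jz0 b) -/D Db /D linear0.
  by move: b1; rewrite b0 penorm0 => /esym/eqP; rewrite oner_eq0.
have k_neq0 : (penorm (D b))^-1 != 0 by rewrite invr_eq0 gt_eqF.
exists ((penorm (D b))^-1 *: D b); split.
- by rewrite penormZ ger0_norm ?invr_ge0 ?penorm_ge0 // mulVf // gt_eqF.
- exact: (stable_space_scale _ (diff_reversal_unstable ub)).
- exact: (stable_tangent_scale k_neq0 (diff_reversal_unstable_tangent ut)).
- rewrite dalphaZl normrM ger0_norm ?invr_ge0 ?penorm_ge0 // mulrC ler_pdivlMr //.
  by have := hmu b ub; rewrite b1 mulr1.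
Qed.

End Base_point.

Theorem theorem1p1 (R : realType) (n k0 : nat) (hn : (2 <= n)%N)
  (hk0 : (3 <= k0)%N) (Kc : 'I_k0 -> set 'rV[R]_n)
  (hconv : forall i, strictly_convex_domain (Kc i))
  (hdisj : forall i j, i != j -> Kc i `&` Kc j = set0)
  (hnoeclipse : forall i j l, i != j -> l != i -> l != j ->
     convex_hull (Kc i `|` Kc j) `&` Kc l = set0) :
  let K := \bigcup_i Kc i in
  exists (z0 : phase R n) (mu : R),
    [/\ nonwandering K z0, ~ bdry K z0.1, 0 < mu &
      forall b : phase R n, penorm b = 1 ->
        unstable_space K z0 b -> unstable_tangent K z0 b ->
        exists a : phase R n,
          [/\ penorm a = 1, stable_space K z0 a, stable_tangent K z0 a
            & mu <= `|dalpha a b|]].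
Proof.
move=> K; have lt0 : (0 < k0)%N by apply: leq_trans hk0.
have lt1 : (1 < k0)%N by apply: leq_trans hk0.
pose i0 := Ordinal lt0; pose i1 := Ordinal lt1.
have i01 : i0 != i1 by [].
have [ne0 cK0 _ _ _] := hconv i0; have [ne1 cK1 _ _ _] := hconv i1.
have [q0 [q1 [Kq0 Kq1 closest]]] := closest_pair ne0 ne1 cK0 cK1.
have [U [f [chart nuE]]] := outward_normal0 hconv hdisj i01 Kq0 Kq1 closest.
have d0 : 0 < enorm (q1 - q0) by exact: (gap_gt0 hdisj i01 Kq0 Kq1).
have [r r0] := transverse_radius chart; rewrite -nuE => transverse.
pose tau := Num.min (enorm (q1 - q0) / 8) (r / 16).
pose delta := Num.min 1 (r / 16).
have tau0 : 0 < tau by rewrite lt_min !divr_gt0.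
have delta0 : 0 < delta by rewrite lt_min ltr01 divr_gt0.
have tau_d : tau <= enorm (q1 - q0) / 8 by rewrite ge_min lexx.
have tau_r : tau <= r / 16 by rewrite ge_min lexx orbT.
have delta1 : delta <= 1 by rewrite ge_min lexx.
have delta_r : delta <= r / 16 by rewrite ge_min lexx orbT.
have tau_lt : 4 * tau < enorm (q1 - q0) by lra.
have delta_lt : delta + 4 * tau + 3 * tau * delta < r.
  have : tau * delta <= tau * 1 by rewrite ler_pM2l.
  lra.
have [mu mu0 hmu] := base_conclusion hconv hdisj hnoeclipse i01 Kq0 Kq1 closest chart
  nuE transverse tau0 tau_lt delta0 delta_lt.
exists (q0 + tau *: ((enorm (q1 - q0))^-1 *: (q1 - q0)), (enorm (q1 - q0))^-1 *: (q1 - q0)), mu.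
split => //.
- exact: (nonwandering_base hconv hdisj hnoeclipse i01 Kq0 Kq1 closest chart
    nuE transverse tau0 tau_lt delta0 delta_lt).
- have [Oz _] := base_domain_z0 chart nuE transverse tau0 delta0 delta_lt.
  exact: (base_domain_free hconv chart nuE transverse tau0 delta0 delta_lt Oz).
Qed.
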